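(* For all $r,s\in[0,\infty]$ with $s\le r$ there exists a Delone set $\omega$ of finite local complexity (FLC) in the additive group $\mathbb Q_2$ of $2$-adic numbers, with $\omega\subseteq\mathbb Z[\tfrac12]$, such that (i) $\omega$ has uniform patch frequencies (UPF) and is pure point diffractive; (ii) the patch counting entropy of $\omega$ is $r$, i.e. $\displaystyle\limsup_{n\to\infty}\frac{\log|\operatorname{Pat}_\omega(B_n)|}{\theta(B_n)}=r$; (iii) $\displaystyle\liminf_{n\to\infty}\frac{\log|\operatorname{Pat}_\omega(B_n)|}{\theta(B_n)}=s$.
   Context: Let $G=\mathbb Q_2$ be the additive group of $2$-adic numbers with the metric given by the $2$-adic absolute value $|\cdot|_2$ (so $|2^n a/b|_2=2^{-n}$ for odd $a,b$); it is a $\sigma$-compact locally compact Abelian group. $\mathbb Z[1/2]=\{m/2^n;\ m\in\mathbb Z,n\in\mathbb N\}\subseteq\mathbb Q\subseteq\mathbb Q_2$. $B_n=\{x\in\mathbb Q_2;\ |x|_2\le n\}$ is the closed ball of radius $n$ around $0$. $\theta$ is a fixed Haar measure on $\mathbb Q_2$; $|\cdot|$ applied to a set denotes cardinality. **Van Hove sequences.** For $A,K\subseteq G$ let $\partial_K A:=(K+A)\cap\overline{K+(G\setminus A)}$. A sequence $(A_n)_{n\in\mathbb N}$ of compact subsets of $G$ is van Hove if $\lim_{n\to\infty}\theta(\partial_KA_n)/\theta(A_n)=0$ for every compact $K\subseteq G$. **Delone sets.** $\omega\subseteq G$ is Delone if it is relatively dense (there is a compact $K\subseteq G$ with $K+\omega=G$)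 and uniformly discrete (there is a precompact neighbourhood $V$ of $0$ such that $\{V+g;\ g\in\omega\}$ is a disjoint family). **Patches, FLC, UPF.** For compact $A\subseteq G$ let $\operatorname{Pat}_\omega(A):=\{(\omega-g)\cap A;\ g\in\omega\}$; its elements are the $A$-patches of $\omega$. $\omega$ is FLC if $\operatorname{Pat}_\omega(A)$ is finite for every compact $A\subseteq G$. A FLC Delone set $\omega$ has UPF if for every compact $A\subseteq G$, every non-empty $A$-patch $P$ of $\omega$ and every van Hove sequence $(A_n)_{n\in\mathbb N}$ the limit $\lim_{n\to\infty}|\{g\in A_n;\ (\omega-g)\cap A=P\}|/\theta(A_n)$ exists. **Pure point diffraction.** A measure $\gamma$ on $G$ is the unique autocorrelation of $\omega$ if for every van Hove sequence $(A_n)$ the measures $\frac{1}{\theta(A_n)}\sum_{g,g'\in A_n\cap\omega}\delta_{g-g'}$ converge to $\gamma$ in the weak*-topology (i.e. tested against continuous compactly supported functions on $G$). Every FLC Delone set with UPF has a unique autocorrelation $\gamma$. This $\gamma$ is positive definite and so has a Fourier transform $\hat\gamma$, the unique positive (Radon) measure on the dual group $\hat G$ with $\int_G f*\tilde f\,d\gamma=\int_{\hat G}|\check f|^2\,d\hat\gamma$ for all continuous compactly supported $f\colon G\to\mathbb C$, where $\tilde f(g)=\overline{f(-g)}$ and $\check f(\chi)=\int_G\chi(g)f(g)\,d\theta(g)$. The set $\omega$ is pure point diffractive if $\hat\gamma$ is a pure point measure. *)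

(* Defs.v *)
From HB Require Import structures.
From mathcomp Require Import all_boot all_order all_algebra.
From mathcomp Require Import lra finmap generic_quotient ring_quotient complex.
From mathcomp Require Import all_classical all_reals all_analysis.

Set Implicit Arguments.
Unset Strict Implicit.
Unset Printing Implicit Defensive.

Import Order.TTheory GRing.Theory Num.Theory.
Import numFieldNormedType.Exports.
Import ComplexField.Normc.

Local Open Scope classical_set_scope.
Local Open Scope quotient_scope.
Local Open Scope ring_scope.

(* [abs2 (2^n * a / b) = 2^-n] for odd [a] and [b]; all values being rational,
   the metric of [Q2] takes its values in [rat]. *)
Definition abs2 (x : rat) : rat :=
  if x == 0 then 0
  else (2 : rat) ^ ((logn 2 `|denq x|)%:Z - (logn 2 `|numq x|)%:Z).

Section abs2_theory.

Lemma abs2_0 : abs2 0 = 0. Proof. by rewrite /abs2 eqxx. Qed.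

Lemma abs2_gt0 x : x != 0 -> 0 < abs2 x.
Proof. by move=> x0; rewrite /abs2 (negPf x0) exprz_gt0. Qed.

Lemma abs2_ge0 x : 0 <= abs2 x.
Proof. by have [->|/abs2_gt0/ltW//] := eqVneq x 0; rewrite abs2_0. Qed.

Lemma abs2_eq0 x : abs2 x = 0 -> x = 0.
Proof. by move=> h; apply/eqP; apply: contraT => /abs2_gt0; rewrite h ltxx. Qed.

Lemma abs2N x : abs2 (- x) = abs2 x.
Proof. by rewrite /abs2 oppr_eq0 numqN denqN abszN. Qed.

Lemma abs2B x y : abs2 (x - y) = abs2 (y - x).
Proof. by rewrite -abs2N opprB. Qed.

Lemma abs2_frac (m d : int) : m != 0 -> d != 0 ->
  abs2 (m%:~R / d%:~R) = 2 ^ ((logn 2 `|d|)%:Z - (logn 2 `|m|)%:Z).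
Proof.
move=> m0 d0; set x : rat := m%:~R / d%:~R.
have x0 : x != 0 by rewrite mulf_neq0 ?invr_neq0 ?intr_eq0.
have E : (numq x * d = m * denq x)%R.
  apply/(@intr_inj rat); rewrite !intrM.
  have := divq_num_den x; rewrite {3}/x => /eqP.
  by rewrite eqr_div ?intr_eq0 ?denq_eq0// => /eqP.
have /(congr1 (logn 2)) : (`|numq x| * `|d| = `|m| * `|denq x|)%N.
  by rewrite -!abszM E.
have n0 : numq x != 0 by rewrite numq_eq0.
rewrite !lognM ?absz_gt0 ?denq_eq0// => L.
rewrite /abs2 (negPf x0); congr (_ ^ _).
apply/eqP; rewrite subr_eq addrAC eq_sym subr_eq -!PoszD.
by rewrite addnC L addnC.
Qed.

Lemma logn2_add (a b : int) (k : nat) : a + b != 0 ->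
  (a = 0 \/ (k <= logn 2 `|a|)%N) -> (b = 0 \/ (k <= logn 2 `|b|)%N) ->
  (k <= logn 2 `|(a + b)%R|)%N.
Proof.
have H (c : int) : c = 0 \/ (k <= logn 2 `|c|)%N -> ((2 ^ k)%N%:Z %| c)%Z.
  case=> [->|]; first exact: dvdz0.
  have [->|c0] := eqVneq c 0; first by rewrite dvdz0.
  by rewrite -pfactor_dvdn ?absz_gt0.
by move=> ab0 /H ha /H hb; rewrite -pfactor_dvdn ?absz_gt0//; by have := rpredD ha hb; rewrite dvdzE.
Qed.

Lemma abs2D_max x y : abs2 (x + y) <= Num.max (abs2 x) (abs2 y).
Proof.
have [->|xy0] := eqVneq (x + y) 0.
  by rewrite abs2_0 le_max abs2_ge0.
have [->|x0] := eqVneq x 0; first by rewrite add0r le_max lexx orbT.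
have [->|y0] := eqVneq y 0; first by rewrite addr0 le_max lexx.
pose a := numq x * denq y; pose b := numq y * denq x; pose d := denq x * denq y.
have d0 : d != 0 by rewrite mulf_neq0 ?denq_eq0.
have a0 : a != 0 by rewrite mulf_neq0 ?denq_eq0 ?numq_eq0.
have b0 : b != 0 by rewrite mulf_neq0 ?denq_eq0 ?numq_eq0.
have xE : x = a%:~R / d%:~R.
  rewrite -[LHS]divq_num_den; apply/eqP.
  by rewrite eqr_div ?intr_eq0 ?denq_eq0// -!intrM eqr_int /a /d mulrAC mulrA.
have yE : y = b%:~R / d%:~R.
  rewrite -[LHS]divq_num_den; apply/eqP.
  by rewrite eqr_div ?intr_eq0 ?denq_eq0// -!intrM eqr_int /b /d -mulrA.
have xyE : x + y = (a + b)%:~R / d%:~R by rewrite {1}xE {1}yE -mulrDl intrD.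
have ab0 : a + b != 0.
  by apply: contraNneq xy0 => h; rewrite xyE h mul0r.
rewrite xyE xE yE !abs2_frac// le_max !ler_eXz2l//.
rewrite !lerD2l !lerN2 !lez_nat.
have [h|h] := leqP (logn 2 `|a|) (logn 2 `|b|).
  by rewrite logn2_add//; right.
by rewrite orbC logn2_add//; right => //; exact: ltnW.
Qed.

Lemma abs2D x y : abs2 (x + y) <= abs2 x + abs2 y.
Proof.
by rewrite (le_trans (abs2D_max x y))// ge_max lerDl lerDr !abs2_ge0.
Qed.

Lemma abs2_dist x y : `|abs2 x - abs2 y| <= abs2 (x - y).
Proof.
rewrite ler_norml lerBlDr -{3}(subrK y x) abs2D andbT.
by rewrite lerNl opprB lerBlDr -{1}(subrK x y) abs2B abs2D.
Qed.

Lemma abs2_stable x y : abs2 (x - y) < abs2 x -> abs2 y = abs2 x.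
Proof.
move=> h; apply/eqP; rewrite eq_le; apply/andP; split.
  have := abs2D_max x (y - x); rewrite addrC subrK => /le_trans; apply.
  by rewrite ge_max lexx abs2B ltW.
have := abs2D_max (x - y) y; rewrite subrK le_max => /orP[|//].
by rewrite leNgt h.
Qed.

End abs2_theory.

Definition is_cauchy2 (u : nat -> rat) :=
  forall e : rat, 0 < e ->
  exists N, forall m n, (N <= m)%N -> (N <= n)%N -> abs2 (u m - u n) < e.

Definition cauchy2 : {pred nat -> rat} := fun u => `[< is_cauchy2 u >].

Lemma cauchy2_zmod_closed : zmod_closed cauchy2.
Proof.
split=> [|u v /asboolP cu /asboolP cv]; apply/asboolP => e e0.
  by exists 0%N => m n _ _; rewrite subrr abs2_0 e0.
have [M uM] := cu _ (divr_gt0 e0 (ltr0Sn _ 1)).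
have [N vN] := cv _ (divr_gt0 e0 (ltr0Sn _ 1)).
exists (maxn M N) => m n; rewrite !geq_max => /andP[Mm Nm] /andP[Mn Nn].
rewrite (splitr e) [X in abs2 X](_ : _ = (u m - u n) + (v n - v m)); last first.
  by rewrite !fctE opprB [v n - _]addrC addrACA [_ + v n]addrC.
by rewrite (le_lt_trans (abs2D _ _))// ltrD ?uM ?vN.
Qed.

HB.instance Definition _ :=
  GRing.isZmodClosed.Build (nat -> rat) cauchy2 cauchy2_zmod_closed.

Record cauchy2_seq :=
  Cauchy2Seq { cauchy2_val :> nat -> rat ; _ : cauchy2_val \in cauchy2 }.

HB.instance Definition _ := [isSub for cauchy2_val].
HB.instance Definition _ := [Choice of cauchy2_seq by <:].
HB.instance Definition _ := [SubChoice_isSubZmodule of cauchy2_seq by <:].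

Definition is_null2 (u : cauchy2_seq) :=
  forall e : rat, 0 < e -> exists N, forall n, (N <= n)%N -> abs2 (u n) < e.

Definition null2 : {pred cauchy2_seq} := fun u => `[< is_null2 u >].

Lemma null2_zmod_closed : zmod_closed null2.
Proof.
split=> [|u v /asboolP cu /asboolP cv]; apply/asboolP => e e0.
  by exists 0%N => n _; rewrite abs2_0 e0.
have [M uM] := cu _ (divr_gt0 e0 (ltr0Sn _ 1)).
have [N vN] := cv _ (divr_gt0 e0 (ltr0Sn _ 1)).
exists (maxn M N) => n; rewrite geq_max => /andP[Mn Nn].
by rewrite (splitr e) (le_lt_trans (abs2D _ _))// ltrD ?abs2N ?uM ?vN.
Qed.

HB.instance Definition _ :=
  GRing.isZmodClosed.Build cauchy2_seq null2 null2_zmod_closed.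

Definition Q2 : Type := Quotient.quot null2.
HB.instance Definition _ := GRing.Zmodule.on Q2.
HB.instance Definition _ := EqQuotient.on Q2.

(* The sequence of absolute values of a 2-adic Cauchy sequence is null or
   eventually constant, so the limit below exists in [rat]. *)
Definition absQ2 (x : Q2) : rat :=
  limn (fun n => abs2 (repr x n) : rat^o).

Section absQ2_theory.

Lemma cauchy2_abs_cvg (u : cauchy2_seq) : cvgn (fun n => abs2 (u n) : rat^o).
Proof.
have [/asboolP nu|/asboolPn nu] := boolP (u \in null2).
  apply/cvg_ex; exists (0 : rat^o); apply/cvgrPdist_lt => e e0.
  have [N uN] := nu _ e0; exists N => // n /= Nn.
  by rewrite sub0r normrN ger0_norm ?abs2_ge0 ?uN.
have [e e0 ue] : exists2 e : rat, 0 < e &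
    forall N, exists2 n, (N <= n)%N & e <= abs2 (u n).
  apply: contrapT => h; apply: nu => e e0; apply: contrapT => h'.
  apply: h; exists e => // N; apply: contrapT => h''; apply: h'.
  exists N => n Nn; rewrite ltNge; apply/negP => eun; apply: h''.
  by exists n.
have /asboolP cu := valP u; have [N uN] := cu _ e0.
have [m Nm em] := ue N.
apply/cvg_ex; exists (abs2 (u m) : rat^o); apply/cvgrPdist_lt => d d0.
exists N => // n /= Nn.
rewrite (@abs2_stable (u m) (u n)) ?subrr ?normr0//.
exact: lt_le_trans (uN _ _ Nm Nn) em.
Qed.

Lemma absQ2_cvg (u : cauchy2_seq) :
  (fun n => abs2 (u n) : rat^o) @ \oo --> (absQ2 (\pi_Q2 u) : rat^o).
Proof.
set r := repr (\pi_Q2 u).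
have rl : (fun n => abs2 (r n) : rat^o) @ \oo --> (absQ2 (\pi_Q2 u) : rat^o).
  exact: cauchy2_abs_cvg.
have /asboolP nur : u - r \in null2.
  by rewrite Quotient.idealrBE /r reprK.
apply/cvgrPdist_lt => e e0.
have e20 : 0 < e / 2 by rewrite divr_gt0.
have /cvgrPdist_lt /(_ _ e20) [N1 _ H1] := rl.
have [N2 H2] := nur _ e20.
exists (maxn N1 N2) => // n /=; rewrite geq_max => /andP[/H1/= h1 /H2 h2].
rewrite (splitr e) -(subrK (abs2 (r n)) (absQ2 _)) -addrA.
rewrite (le_lt_trans (ler_normD _ _))// ltrD//.
by rewrite distrC (le_lt_trans (abs2_dist _ _)).
Qed.

Lemma absQ2_pi (u : cauchy2_seq) (l : rat^o) :
  (fun n => abs2 (u n) : rat^o) @ \oo --> l -> absQ2 (\pi_Q2 u) = l.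
Proof.
by move=> ul; apply: (cvg_unique _ (@absQ2_cvg u) ul); exact: norm_hausdorff.
Qed.

Lemma absQ2_ge0 x : 0 <= absQ2 x.
Proof.
rewrite -(reprK x) leNgt; apply/negP => h.
have h0 : 0 < - absQ2 (\pi_Q2 (repr x)) by rewrite oppr_gt0.
have /cvgrPdist_lt /(_ _ h0) [N _ /(_ N (leqnn N))/=] := (@absQ2_cvg (repr x)).
rewrite distrC ger0_norm ?subr_ge0 ?(le_trans (ltW h)) ?abs2_ge0//.
by rewrite gtrDr ltNge abs2_ge0.
Qed.

Lemma absQ2_0 : absQ2 0 = 0.
Proof.
rewrite -[0 in LHS](_ : \pi_Q2 0 = 0); last by rewrite -[RHS](raddf0 (\pi_Q2)).
apply: absQ2_pi; rewrite (_ : (fun _ => _) = cst 0); first exact: cvg_cst.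
by apply/funext => n; rewrite /= abs2_0.
Qed.

Lemma absQ2_eq0 x : absQ2 x = 0 -> x = 0.
Proof.
rewrite -(reprK x) => h; apply/eqP.
rewrite -[X in _ == X](raddf0 (\pi_Q2)).
rewrite -Quotient.idealrBE subr0; apply/asboolP => e e0.
have /cvgrPdist_lt /(_ _ e0) [N _ H] := (@absQ2_cvg (repr x)); exists N => n Nn.
by have := H n Nn; rewrite /= h sub0r normrN ger0_norm ?abs2_ge0.
Qed.

Lemma absQ2N x : absQ2 (- x) = absQ2 x.
Proof.
rewrite -(reprK x) -[- _](raddfN (\pi_Q2)).
apply: absQ2_pi; rewrite (_ : (fun _ => _) = fun n => abs2 (repr x n)).
  exact: absQ2_cvg.
by apply/funext => n; rewrite abs2N.
Qed.

Lemma absQ2D x y : absQ2 (x + y) <= absQ2 x + absQ2 y.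
Proof.
rewrite -(reprK x) -(reprK y) -[\pi _ + _](raddfD (\pi_Q2)).
set u := repr x; set v := repr y.
apply/ler_addgt0Pr => e e0.
have e30 : 0 < e / 3%:R by rewrite divr_gt0.
have /cvgrPdist_lt /(_ _ e30) [N1 _ H1] := (@absQ2_cvg u).
have /cvgrPdist_lt /(_ _ e30) [N2 _ H2] := (@absQ2_cvg v).
have /cvgrPdist_lt /(_ _ e30) [N3 _ H3] := (@absQ2_cvg (u + v)).
pose n := maxn N1 (maxn N2 N3).
have := H1 n (leq_maxl _ _).
have := H2 n (leq_trans (leq_maxl _ _) (leq_maxr _ _)).
have := H3 n (leq_trans (leq_maxr _ _) (leq_maxr _ _)).
have := abs2D (u n) (v n).
rewrite /= !ltr_norml => h0 /andP[_ h3] /andP[h2 _] /andP[h1 _].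
lra.
Qed.

End absQ2_theory.

Section Q2_metric.
Let dist (x y : Q2) : rat := absQ2 (x - y).

Let dist_xx x : dist x x = 0. Proof. by rewrite /dist subrr absQ2_0. Qed.

Let dist_eq0 x y : dist x y = 0 -> x = y.
Proof. by move=> /absQ2_eq0/eqP; rewrite subr_eq0 => /eqP. Qed.

Let dist_sym x y : dist x y = dist y x.
Proof. by rewrite /dist -absQ2N opprB. Qed.

Let dist_triangle y x z : dist x z <= dist x y + dist y z.
Proof. by rewrite /dist -(subrKA y x (- z)) absQ2D. Qed.

HB.instance Definition _ :=
  isMetric.Build rat Q2 dist_xx dist_eq0 dist_sym dist_triangle.

End Q2_metric.

Lemma mdistQ2E (x y : Q2) : mdist x y = absQ2 (x - y).
Proof. by []. Qed.

HB.instance Definition _ := isPointed.Build Q2 0.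

Lemma Q2_sub_continuous : continuous (fun x : Q2 * Q2 => x.1 - x.2).
Proof.
move=> [x y] /=; apply/cvg_ballP => e e0.
have e20 : 0 < e / 2 by rewrite divr_gt0.
near=> z; rewrite ballEmdist /= mdistQ2E.
have : ball x (e / 2) z.1.
  by near: z; apply: cvg_fst; exact: nbhsx_ballx.
have : ball y (e / 2) z.2.
  by near: z; apply: cvg_snd; exact: nbhsx_ballx.
rewrite !ballEmdist /= !mdistQ2E => h2 h1.
rewrite (splitr e) [X in absQ2 X](_ : _ = (x - z.1) - (y - z.2)); last first.
  by rewrite !opprB [z.2 - z.1]addrC addrACA [- y + z.2]addrC.
by rewrite (le_lt_trans (absQ2D _ _))// absQ2N ltrD.
Unshelve. all: by end_near. Qed.

HB.instance Definition _ :=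
  PreTopologicalNmodule_isTopologicalZmodule.Build Q2 Q2_sub_continuous.

Lemma cst_cauchy2 (x : rat) : (fun=> x) \in cauchy2.
Proof. by apply/asboolP => e e0; exists 0%N => m n _ _; rewrite subrr abs2_0. Qed.

Definition Q2_of_rat (x : rat) : Q2 := \pi_Q2 (Cauchy2Seq (cst_cauchy2 x)).

Lemma absQ2_of_rat (x : rat) : absQ2 (Q2_of_rat x) = abs2 x.
Proof.
rewrite /Q2_of_rat (@absQ2_pi _ (abs2 x))// (_ : (fun _ => _) = cst (abs2 x)) //.
exact: cvg_cst.
Qed.

Definition dyadic : set rat :=
  [set x | exists (m : int) (n : nat), x = m%:~R / 2%:R ^+ n].

Notation borel T := (g_sigma_algebraType (@open T)).

Section borel_measures.
Variables (R : realType) (T : ptopologicalType).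
Implicit Type mu : {measure set (borel T) -> \bar R}.

Definition radon mu :=
  [/\ forall K : set T, compact K -> (mu K < +oo)%E,
      forall B : set T, measurable (B : set (borel T)) ->
        mu B = ereal_inf [set mu U | U in [set U : set T | open U /\ B `<=` U]]
    & forall U : set T, open U ->
        mu U =
        ereal_sup [set mu K | K in [set K : set T | compact K /\ K `<=` U]]].

Definition pure_point mu :=
  forall B : set T, measurable (B : set (borel T)) ->
    mu B = \esum_(x in B) mu [set x].

End borel_measures.

Notation "'Cx' R" := (R[i]^o) (at level 8, R at level 2).

Definition Cintegral d (T : measurableType d) (R : realType)
    (mu : {measure set T -> \bar R}) (f : T -> R[i]) : R[i] :=
  ((\int[mu]_x complex.Re (f x)) +i* (\int[mu]_x complex.Im (f x)))%C.

Definition add_sets (K A : set Q2) : set Q2 := [set x + y | x in K & y in A].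

Definition translate (w : set Q2) (g : Q2) : set Q2 := [set x - g | x in w].

Definition relatively_dense (w : set Q2) :=
  exists2 K : set Q2, compact K & add_sets K w = setT.

Definition uniformly_discrete (w : set Q2) :=
  exists V : set Q2, [/\ nbhs 0 V, precompact V &
    trivIset w (fun g => [set v + g | v in V])].

Definition delone (w : set Q2) := relatively_dense w /\ uniformly_discrete w.

Definition patches (w A : set Q2) : set (set Q2) :=
  [set translate w g `&` A | g in w].

Definition flc (w : set Q2) :=
  forall A : set Q2, compact A -> finite_set (patches w A).

Definition ballQ2 (n : nat) : set Q2 := [set x | absQ2 x <= n%:R].

Definition boundary (K A : set Q2) : set Q2 :=
  add_sets K A `&` closure (add_sets K (~` A)).

Section averages.
Variable R : realType.
Implicit Types (theta : {measure set (borel Q2) -> \bar R}) (w : set Q2).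

Definition haar theta :=
  [/\ radon theta, theta setT != 0%E &
    forall (g : Q2) (B : set Q2), measurable (B : set (borel Q2)) ->
      theta [set x + g | x in B] = theta B].

(* Positivity makes the quotients in the limit meaningful: division by [0]
   yields [0]. *)
Definition van_hove theta (A : nat -> set Q2) :=
  [/\ forall n, compact (A n), forall n, (0 < theta (A n))%E &
    forall K : set Q2, compact K ->
      (fun n => fine (theta (boundary K (A n))) / fine (theta (A n))) @ \oo
        --> (0 : R)].

Definition upf theta w :=
  forall A P : set Q2, compact A -> patches w A P -> P !=set0 ->
  forall F : nat -> set Q2, van_hove theta F ->
    cvgn (fun n =>
      #|` fset_set [set g | F n g /\ translate w g `&` A = P]|%:R
        / fine (theta (F n)) : R).

Definition log_patch_density theta w (n : nat) : \bar R :=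
  (ln (#|` fset_set (patches w (ballQ2 n))|%:R : R)
     / fine (theta (ballQ2 n)))%:E.

Definition Cc (f : Q2 -> Cx R) :=
  continuous f /\ compact (closure [set x | f x != 0]).

Definition unique_autocorrelation theta w
    (gamma : {measure set (borel Q2) -> \bar R}) :=
  radon gamma /\
  forall F : nat -> set Q2, van_hove theta F ->
  forall f : Q2 -> Cx R, Cc f ->
    (fun n => ((fine (theta (F n)))^-1)%:C%C *
       \sum_(p \in (F n `&` w) `*` (F n `&` w)) f (p.1 - p.2) : Cx R) @ \oo
      --> (Cintegral gamma f : Cx R).

Definition characters : set {compact-open, Q2 -> Cx R} :=
  [set chi | [/\ continuous (chi : Q2 -> Cx R),
    forall x y, chi (x + y) = chi x * chi y & forall x, `|chi x| = 1]].

Definition dualQ2 : Type := set_type characters.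
HB.instance Definition _ := Topological.on dualQ2.

Lemma cst1_character : (cst 1 : Q2 -> Cx R) \in characters.
Proof.
apply/mem_set; split => [|x y|x]; first exact: cst_continuous.
- by rewrite /= mulr1.
- by rewrite /= normr1.
Qed.

HB.instance Definition _ := isPointed.Build dualQ2
  (exist (fun chi => chi \in characters) (cst 1) cst1_character).

Definition inv_transform theta (f : Q2 -> Cx R) (chi : dualQ2) : Cx R :=
  Cintegral theta (fun g => (val chi : Q2 -> Cx R) g * f g).

Definition tilde (f : Q2 -> Cx R) : Q2 -> Cx R := fun g => conjc (f (- g)).

Definition convolution theta (f h : Q2 -> Cx R) : Q2 -> Cx R :=
  fun g => Cintegral theta (fun x => f x * h (g - x)).

(* The integral over the dual is of a nonnegative function, hence taken in
   [\bar R]; the equation also says that it is finite. *)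
Definition fourier_transform theta
    (gamma : {measure set (borel Q2) -> \bar R})
    (gammahat : {measure set (borel dualQ2) -> \bar R}) :=
  radon gammahat /\
  forall f : Q2 -> Cx R, Cc f ->
    let c := Cintegral gamma (convolution theta f (tilde f)) in
    complex.Im c = 0 /\
    (\int[gammahat]_chi ((normc (inv_transform theta f chi)) ^+ 2)%:E
      = (complex.Re c)%:E)%E.

Definition pure_point_diffractive theta w :=
  exists gamma gammahat, [/\ unique_autocorrelation theta w gamma,
    fourier_transform theta gamma gammahat & pure_point gammahat].

End averages.

(* Main.v *)
(* Write [S_j = {i / 2^j : 0 <= i < 2^j}]. The dyadic numbers in [0, 1) form a section
   of Q_2 / Z_2 whose intersection with every coset of 2^-j Z_2 is a translate of [S_j].
   Shifting each point by a suitable natural number keeps one point in every coset of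
   Z_2; the shifts are chosen such that, for every [j], only finitely many cosets of
   2^-j Z_2 do not meet the set in a translate of [S_j].

   Patch frequencies, autocorrelation and diffraction do not see the exceptional cosets:
   along a van Hove sequence a set behaves like the disjoint union of its cosets of
   2^-j Z_2. The autocorrelation is, up to normalization, the sum of (1 - |t|)_+ delta_t
   over the dyadic [t], with the real absolute value, and its Fourier transform is the sum
   of sinc(w)^2 delta_w over the characters [w] in Z[1/2]. For a test function supported in
   2^-j Z_2 and nearly constant on the cosets of 2^l Z_2 the Fourier identity reduces to
   Parseval on a finite cyclic group, with sinc^2 replaced by a Fejer kernel.

   The number of patches on 2^-j Z_2 equals the number [c_j] of exceptional cosets up to
   factors exponential in [j], which are negligible against exp(const 2^j); and [c_j] may
   grow as slowly or as fast as desired, subject to [c_(j+1) >= 2 c_j]. *)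
Require Import Defs.
From HB Require Import structures.
From mathcomp Require Import all_boot all_order all_algebra.
From mathcomp Require Import zify ring lra finmap generic_quotient ring_quotient complex.
From mathcomp Require Import all_classical all_reals all_analysis measurable_realfun.
Set Implicit Arguments.
Unset Strict Implicit.
Unset Printing Implicit Defensive.
Import Order.TTheory GRing.Theory Num.Theory.
Import numFieldNormedType.Exports.
Import ComplexField.Normc.
Local Open Scope classical_set_scope.
Local Open Scope quotient_scope.
Local Open Scope ring_scope.

(** * 2-adic numbers *)

(** Averages see only the density of a pattern, patch counting sees each pattern once; the shifts
    exploit this gap, and the point to secure is that different exceptional cosets can be told
    apart. A common shift of a whole coset of 2^-k Z_2 is invisible inside that coset, so the
    surrounding coset of 2^-(k+1) Z_2 has to contain an unshifted point as a reference. Comparing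
    the two reveals [p], which gives at least [c k.+1 - c k] patches on 2^-(k+1) Z_2; the doubling
    condition makes this difference comparable to [c k.+1]. With [c j] close to exp(t0 2^j a_j),
    where t0 is the volume of Z_2, doubling amounts to a_(j+1) >= a_j / 2. The density may thus jump
    up at once but descends at best by halving, so the values near [r] are placed at j = 2^m, which
    leaves ever longer stretches for the descent to [s]. On the Fourier side, the identity
    F_(M+1)(x) + F_(M+1)(x + 2^M) = F_M(x) for Fejer kernels makes the sums over a period exactly
    independent of M, so an error enters only where F_M is compared with sinc^2 on a centred
    period. *)

Lemma abs2M x y : abs2 (x * y) = abs2 x * abs2 y.
Proof.
have [->|x0] := eqVneq x 0; first by rewrite mul0r abs2_0 mul0r.
have [->|y0] := eqVneq y 0; first by rewrite mulr0 abs2_0 mulr0.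
have E : x * y = (numq x * numq y)%:~R / (denq x * denq y)%:~R.
  by rewrite !intrM invfM mulrACA !divq_num_den.
rewrite E abs2_frac ?mulf_neq0 ?numq_eq0 ?denq_eq0//.
rewrite /abs2 (negPf x0) (negPf y0) -expfzDr// !abszM.
rewrite !lognM ?absz_gt0 ?numq_eq0 ?denq_eq0//; congr (_ ^ _); lia.
Qed.

Lemma abs2_int (m : int) : abs2 m%:~R <= 1.
Proof.
have [->|m0] := eqVneq m 0; first by rewrite abs2_0.
rewrite -[m%:~R]divr1 (@abs2_frac m 1)// logn1 sub0r.
rewrite -[leRHS](expr0z (2:rat)) ler_eXz2l//; lia.
Qed.

Lemma abs2_expz (k : int) : abs2 (2 ^ k) = 2 ^ (- k).
Proof.
case: k => n.
  rewrite -exprnP -[_ ^+ n]divr1 -natrX.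
  rewrite (@abs2_frac (2 ^ n)%N 1) ?eqz_nat -?lt0n ?expn_gt0//.
  by rewrite logn1 sub0r /= lognX logn_prime// muln1.
rewrite NegzE -exprnN -[_ ^- _]mul1r -natrX.
rewrite (@abs2_frac 1 (2 ^ n.+1)%N) ?eqz_nat -?lt0n ?expn_gt0//.
by rewrite logn1 subr0 /= lognX logn_prime// muln1 opprK.
Qed.

Lemma dyadic_int (m : int) : dyadic m%:~R.
Proof. by exists m, 0%N; rewrite expr0 divr1. Qed.

Lemma dyadic_expz (k : int) : dyadic (2 ^ k).
Proof.
case: k => n; first by exists (2 ^ n)%N, 0%N; rewrite expr0 divr1 -pmulrn natrX.
by exists 1, n.+1; rewrite NegzE -exprnN mul1r.
Qed.

Lemma dyadicM x y : dyadic x -> dyadic y -> dyadic (x * y).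
Proof.
move=> [m [n ->]] [m' [n' ->]]; exists (m * m'), (n + n')%N.
by rewrite intrM exprD invfM mulrACA.
Qed.

Lemma dyadicN x : dyadic x -> dyadic (- x).
Proof. by move=> [m [n ->]]; exists (- m), n; rewrite intrN mulNr. Qed.

Lemma dyadicD x y : dyadic x -> dyadic y -> dyadic (x + y).
Proof.
move=> [m [n ->]] [m' [n' ->]].
exists (m * 2 ^+ n' + m' * 2 ^+ n), (n + n')%N.
by rewrite intrD !intrM !rmorphXn/= exprD; field; rewrite !expf_neq0.
Qed.

Lemma dyadicB x y : dyadic x -> dyadic y -> dyadic (x - y).
Proof. by move=> dx /dyadicN; exact: dyadicD. Qed.

Lemma dyadic_abs2_le1 x : dyadic x -> abs2 x <= 1 -> x \is a Num.int.
Proof.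
move=> [m [n ->]].
have [->|m0] := eqVneq m 0; first by rewrite mul0r.
have -> : (2 : rat) ^+ n = ((2 ^ n)%N%:Z)%:~R by rewrite -pmulrn natrX.
rewrite abs2_frac ?eqz_nat -?lt0n ?expn_gt0//= lognX logn_prime// muln1.
rewrite -[leRHS](expr0z (2 : rat)) ler_eXz2l// subr_le0 lez_nat => nm.
have : ((2 ^ n)%N%:Z %| m)%Z.
  by rewrite dvdzE/= pfactor_dvdn// absz_gt0.
case/dvdzP => q ->; rewrite intrM mulfK ?intr_int//.
by rewrite intr_eq0 eqz_nat expn_eq0.
Qed.

Lemma dyadic_abs2_le (k : int) x :
  dyadic x -> abs2 x <= 2 ^ k <-> x * 2 ^ k \is a Num.int.
Proof.
move=> dx; have E : abs2 (x * 2 ^ k) = abs2 x / 2 ^ k.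
  by rewrite abs2M abs2_expz -invr_expz.
have e0 : (0 : rat) < 2 ^ k by rewrite exprz_gt0.
split=> h.
  apply: dyadic_abs2_le1; first exact/dyadicM/dyadic_expz.
  by rewrite E ler_pdivrMr// mul1r.
have /intrP [m mE] := h.
by have := abs2_int m; rewrite -mE E ler_pdivrMr// mul1r.
Qed.

(** Write the denominator of [q] as [b * 2 ^ n] with [b] odd. A Bezout relation u b + v 2^(n+l) = 1
    shows that [u] may replace 1/b up to a multiple of 2^(n+l) / b, and [b] is a 2-adic unit. *)
Lemma dyadic_dense (q : rat) (l : nat) :
  exists2 d, dyadic d & abs2 (q - d) <= 2 ^ (- l%:Z).
Proof.
pose D := `|denq q|%N; pose n := logn 2 D; pose b := (D %/ 2 ^ n)%N.
have D0 : (0 < D)%N by rewrite absz_gt0 denq_eq0.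
have Db : D = (b * 2 ^ n)%N by rewrite /b divnK// pfactor_dvdnn.
have b0 : (0 < b)%N by move: D0; rewrite Db muln_gt0 => /andP[].
have c2 : coprime 2 b.
  rewrite prime_coprime//; apply/negP => b2.
  have : (2 ^ n.+1 %| D)%N by rewrite Db expnS dvdn_mul.
  by rewrite pfactor_dvdn// ltnn.
have cb : coprime b (2 ^ (n + l)) by rewrite coprime_sym coprimeXl.
have : coprimez b (2 ^ (n + l))%N by [].
case/coprimezP => -[u v] /= uv.
exists ((numq q * u)%:~R / 2 ^+ n); first by exists (numq q * u), n.
have -> : q - (numq q * u)%:~R / 2 ^+ n =
    2 ^+ l * (numq q * v)%:~R / b%:~R.
  rewrite -{1}[q]divq_num_den -[denq q]absz_denq -/D Db.
  rewrite -!pmulrn !intrM natrM natrX.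
  have : (u * b + v * (2 ^ (n + l))%N)%:~R = 1 :> rat by rewrite uv.
  rewrite intrD !intrM -!pmulrn natrX exprD => uv'.
  have B : 1 - u%:~R * b%:R = v%:~R * (2 ^+ n * 2 ^+ l) :> rat.
    by apply/eqP; rewrite subr_eq addrC uv'.
  have bn0 : b%:R != 0 :> rat by rewrite pnatr_eq0 -lt0n.
  have n0 : 2 ^+ n != 0 :> rat by rewrite expf_neq0.
  transitivity ((numq q)%:~R * (1 - u%:~R * b%:R) / (b%:R * 2 ^+ n) : rat).
    by field; rewrite bn0 n0.
  by rewrite B; field; rewrite bn0 n0.
have ab : abs2 (b%:~R^-1) = 1.
  by rewrite -[_^-1]mul1r (@abs2_frac 1)// ?eqz_nat -?lt0n//= (logn_coprime c2) logn1.
by rewrite !abs2M ab mulr1 exprnP abs2_expz ler_piMr ?abs2_int//.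
Qed.

Lemma Q2_of_ratD x y : Q2_of_rat (x + y) = Q2_of_rat x + Q2_of_rat y.
Proof.
rewrite /Q2_of_rat -[RHS](raddfD (\pi_Q2)); congr (\pi_Q2 _).
exact/val_inj.
Qed.

Lemma Q2_of_ratN x : Q2_of_rat (- x) = - Q2_of_rat x.
Proof.
rewrite /Q2_of_rat -[RHS](raddfN (\pi_Q2)); congr (\pi_Q2 _).
exact/val_inj.
Qed.

Lemma Q2_of_ratB x y : Q2_of_rat (x - y) = Q2_of_rat x - Q2_of_rat y.
Proof. by rewrite Q2_of_ratD Q2_of_ratN. Qed.

Lemma Q2_of_rat0 : Q2_of_rat 0 = 0.
Proof. by rewrite -(subrr 0) Q2_of_ratB subrr. Qed.

Lemma Q2_of_rat_inj : injective Q2_of_rat.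
Proof.
move=> x y /eqP; rewrite -subr_eq0 -Q2_of_ratB => /eqP xy.
apply/eqP; rewrite -subr_eq0; apply/eqP/abs2_eq0.
by rewrite -absQ2_of_rat xy absQ2_0.
Qed.

Lemma Q2_rat_dense (x : Q2) (e : rat) : 0 < e ->
  exists q, absQ2 (x - Q2_of_rat q) < e.
Proof.
move=> e0; have e20 : 0 < e / 2 by rewrite divr_gt0.
have /asboolP cx := valP (repr x); have [N xN] := cx _ e20.
exists (repr x N).
rewrite -{1}(reprK x) /Q2_of_rat -[_ - _](raddfB (\pi_Q2)).
set u := _ - _; apply: (@le_lt_trans _ _ (e / 2)); last first.
  by rewrite ltr_pdivrMr// ltr_pMr// ltr1n.
apply/ler_addgt0Pr => d d0.
have /cvgrPdist_lt /(_ _ d0) [M _ H] := @absQ2_cvg u.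
have := H (maxn M N) (leq_maxl _ _).
have /= := xN (maxn M N) N (leq_maxr _ _) (leqnn _).
rewrite ltr_norml => h1 /andP[_ h2].
apply: ltW; apply: lt_le_trans (_ : d + abs2 (u (maxn M N)) <= _).
  by rewrite -ltrBlDr.
by rewrite addrC lerD2r; apply: ltW.
Qed.

Lemma absQ2D_max x y : absQ2 (x + y) <= Num.max (absQ2 x) (absQ2 y).
Proof.
apply/ler_addgt0Pr => e e0; have e30 : 0 < e / 3%:R by rewrite divr_gt0.
have [p xp] := Q2_rat_dense x e30; have [q yq] := Q2_rat_dense y e30.
have h1 : absQ2 (x + y) <= abs2 (p + q) + (e / 3%:R + e / 3%:R).
  rewrite -absQ2_of_rat Q2_of_ratD -lerBlDl.
  rewrite -(subrK (Q2_of_rat p + Q2_of_rat q) (x + y)) lerBlDl.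
  apply: (le_trans (absQ2D _ _)); rewrite addrC lerD2l opprD addrACA.
  by apply: (le_trans (absQ2D _ _)); rewrite lerD// ltW.
have hh (z : Q2) r : absQ2 (z - Q2_of_rat r) < e / 3%:R ->
    abs2 r <= absQ2 z + e / 3%:R.
  move=> zr; rewrite -absQ2_of_rat -[Q2_of_rat r](subrKC z).
  apply: (le_trans (absQ2D _ _)); rewrite lerD2l -absQ2N opprB ltW//.
have := abs2D_max p q; rewrite le_max => /orP[h|h].
  rewrite -lerBlDr le_max; apply/orP; left.
  have := hh _ _ xp; lra.
rewrite -lerBlDr le_max; apply/orP; right.
have := hh _ _ yq; lra.
Qed.

(** The group 2^-k Z_2: large [k] means a large ball, and negative [k] gives small neighbourhoods of
    0. *)
Definition Bz (k : int) : set Q2 := [set x | absQ2 x <= 2 ^ k].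

Lemma Bz0 k : Bz k 0.
Proof. by rewrite /Bz/= absQ2_0 ltW// exprz_gt0. Qed.

Lemma BzN k x : Bz k (- x) <-> Bz k x.
Proof. by rewrite /Bz/= absQ2N. Qed.

Lemma BzD k x y : Bz k x -> Bz k y -> Bz k (x + y).
Proof.
by rewrite /Bz/= => kx ky; rewrite (le_trans (absQ2D_max _ _))// ge_max kx ky.
Qed.

Lemma BzB k x y : Bz k x -> Bz k y -> Bz k (x - y).
Proof. by move=> kx ky; apply: BzD => //; exact/BzN. Qed.

Lemma BzC k x y : Bz k (x - y) <-> Bz k (y - x).
Proof. by rewrite -BzN opprB. Qed.

Lemma Bz_trans k y x z : Bz k (x - y) -> Bz k (y - z) -> Bz k (x - z).
Proof. by move=> xy yz; rewrite -(subrKA y); exact: BzD. Qed.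

Lemma Bz_le k l : (k <= l)%R -> Bz k `<=` Bz l.
Proof. by move=> kl x /= /le_trans; apply; rewrite ler_eXz2l. Qed.

Lemma Bz_dyadic k d : dyadic d -> Bz k (Q2_of_rat d) <-> d * 2 ^ k \is a Num.int.
Proof. by move=> dd; rewrite /Bz/= absQ2_of_rat dyadic_abs2_le. Qed.

Lemma Q2_dyadic_dense (l : int) (x : Q2) :
  exists2 d, dyadic d & Bz l (x - Q2_of_rat d).
Proof.
have l0 : 0 < (2 : rat) ^ l by rewrite exprz_gt0.
have [q /ltW xq] := Q2_rat_dense x l0.
have [d dd qd] := dyadic_dense q `|l|; exists d => //.
apply: (@Bz_trans _ (Q2_of_rat q)) => //; rewrite -Q2_of_ratB /Bz/=.
by rewrite absQ2_of_rat (le_trans qd)// ler_eXz2l//; lia.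
Qed.

Lemma Bz_bigcup : \bigcup_(j : nat) Bz j = setT.
Proof.
apply/seteqP; split => // x _; exists (Num.bound (absQ2 x)) => //.
by rewrite /Bz/= -exprnP ltW// upper_nthrootP.
Qed.

(** For [i < 2 ^ n] these represent the cosets of [Bz (k - n)] in [Bz k]; for [n = k] they form the
    set [S_k]. *)
Definition coset_rep (k : int) (i : nat) : rat := i%:R * 2 ^ (- k).

Lemma dyadic_coset_rep k i : dyadic (coset_rep k i).
Proof. by apply: dyadicM; [rewrite pmulrn; exact: dyadic_int|exact: dyadic_expz]. Qed.

Lemma Bz_coset_rep k i : Bz k (Q2_of_rat (coset_rep k i)).
Proof.
apply/Bz_dyadic; first exact: dyadic_coset_rep.
by rewrite -mulrA -expfzDr// addNr expr0z mulr1.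
Qed.

(** A dyadic approximation of [x] still lies in [Bz k], hence equals m / 2^k with an integer m;
    reducing m modulo [2 ^ n] moves it within its coset of [Bz (k - n)]. *)
Lemma Bz_cover (k : int) (n : nat) x : Bz k x ->
  exists2 i, (i < 2 ^ n)%N & Bz (k - n%:Z) (x - Q2_of_rat (coset_rep k i)).
Proof.
move=> kx; have [d dd xd] := Q2_dyadic_dense (k - n%:Z) x.
have /Bz_dyadic-/(_ dd) /intrP [m dm] : Bz k (Q2_of_rat d).
  rewrite -[Q2_of_rat d](subKr x); apply: BzB => //.
  by apply: Bz_le xd; lia.
have n0 : (2 ^ n)%N%:Z != 0 :> int by rewrite eqz_nat -lt0n expn_gt0.
exists `|(m %% (2 ^ n)%N)%Z|%N.
  by rewrite -ltz_nat gez0_abs ?modz_ge0// ltz_pmod// ltz_nat expn_gt0.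
apply: (Bz_trans xd); rewrite -Q2_of_ratB; apply/Bz_dyadic.
  by apply/dyadicB => //; exact: dyadic_coset_rep.
rewrite /coset_rep.
have -> : d = m%:~R * 2 ^ (- k) by rewrite -dm -mulrA -expfzDr// subrr expr0z mulr1.
rewrite -mulrBl -mulrA -expfzDr// addKr pmulrn gez0_abs ?modz_ge0//.
rewrite -intrB {1}(divz_eq m (2 ^ n)%N) addrK intrM -mulrA.
rewrite -[X in X%:~R * 2 ^ _]/(Posz _) -pmulrn natrX exprnP -expfzDr// subrr.
by rewrite expr0z mulr1 intr_int.
Qed.

Lemma Bz_coset_rep_uniq (k : int) (n i i' : nat) : (i < 2 ^ n)%N -> (i' < 2 ^ n)%N ->
  Bz (k - n%:Z) (Q2_of_rat (coset_rep k i) - Q2_of_rat (coset_rep k i')) -> i = i'.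
Proof.
wlog ii' : i i' / (i' <= i)%N.
  move=> H h h' B; have [/H|/ltnW/H] := leqP i' i; first exact.
  by move=> H'; apply/esym/H' => //; exact/BzC.
move=> h h'; rewrite -Q2_of_ratB => /Bz_dyadic.
move=> /(_ (dyadicB (dyadic_coset_rep _ _) (dyadic_coset_rep _ _))).
rewrite -mulrBl -mulrA -expfzDr// addKr -natrB// => /intrP[m].
move=> /(congr1 ( *%R^~ (2 ^ n%:Z))); rewrite -mulrA -expfzDr// addNr expr0z mulr1.
rewrite -exprnP -natrX !pmulrn -intrM => /intr_inj.
move: h; set P := (2 ^ n)%N => h E; case: m E => [[|m]|m] E; [lia| |lia].
have : (i - i')%N%:Z = P + m * P by rewrite E -[m.+1]addn1; lia.
lia.
Qed.

Lemma nbhs_Q2 (x : Q2) (A : set Q2) :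
  nbhs x A <-> exists l : nat, forall y, Bz (- l%:Z) (y - x) -> A y.
Proof.
split=> [/nbhs_ballP[e /= e0]|[l lA]].
  rewrite ballEmdist => eA; exists (Num.bound e^-1).
  move=> y /= yx; apply: eA => /=; rewrite mdistQ2E -absQ2N opprB.
  by apply: le_lt_trans yx _; rewrite -exprnN realalg.RealAlg.upper_nthrootVP.
apply/nbhs_ballP; exists (2 ^ (- l%:Z)) => /=; first by rewrite exprz_gt0.
rewrite ballEmdist => y /=; rewrite mdistQ2E -absQ2N opprB => /ltW; exact: lA.
Qed.

Lemma open_Q2 (A : set Q2) :
  (forall x, A x -> exists l : nat, forall y, Bz (- l%:Z) (y - x) -> A y) -> open A.
Proof. by move=> H; rewrite openE => x /H ?; exact/nbhs_Q2. Qed.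

Lemma open_coset k c : open [set x | Bz k (x - c)].
Proof.
apply: open_Q2 => x /= xc; exists `|k|%N => y yx.
by apply: (Bz_trans _ xc); apply: Bz_le yx; lia.
Qed.

Lemma closed_coset k c : closed [set x | Bz k (x - c)].
Proof.
rewrite -openC; apply: open_Q2 => x /= xc; exists `|k|%N => y yx yc.
by apply: xc; apply: (Bz_trans _ yc); apply/BzC; apply: Bz_le yx; lia.
Qed.

Lemma open_Bz k : open (Bz k).
Proof. by have := @open_coset k 0; congr open; apply/seteqP; split => x /=; rewrite subr0. Qed.

Lemma absQ2_pi_le (u : cauchy2_seq) e : 
  (exists N, forall n, (N <= n)%N -> abs2 (u n) <= e) -> absQ2 (\pi_Q2 u) <= e.
Proof.
move=> [N uN]; apply/ler_addgt0Pr => d d0.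
have /cvgrPdist_lt /(_ _ d0) [M _ H] := @absQ2_cvg u.
have /= := H (maxn M N) (leq_maxl _ _).
have := uN (maxn M N) (leq_maxr _ _).
by rewrite ltr_norml => h /andP[_]; lra.
Qed.

Lemma ultra_bigcup T (F : set_system T) (A : nat -> set T) N : UltraFilter F ->
  F [set x | exists2 i, (i < N)%N & A i x] -> exists i, F (A i).
Proof.
move=> FU; elim: N => [|N IH] FA.
  by have /filter_ex[x []] := FA.
have [/IH//|h] := in_ultra_setVsetC [set x | exists2 i, (i < N)%N & A i x] FU.
exists N; apply: filterS (filterI FA h) => x -[[i +] +] /=.
rewrite ltnS leq_eqVlt => /orP[/eqP -> //|iN] Ai []; by exists i.
Qed.

(** At each precision [l] an ultrafilter picks one of finitely many cosets. Centres of these cosets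
    form a Cauchy sequence of rationals, and its class is the limit. *)
Lemma compact_Bz k : compact (Bz k).
Proof.
rewrite compact_ultra => F FU FB.
have H (l : nat) : exists d, dyadic d /\
    F [set x | Bz (- l%:Z) (x - Q2_of_rat d)].
  pose n := `|(k + l%:Z)%R|%N.
  have : F [set x | exists2 i, (i < 2 ^ n)%N &
      Bz (k - n%:Z) (x - Q2_of_rat (coset_rep k i))].
    by apply: filterS FB => x /(Bz_cover n).
  move=> /ultra_bigcup[i Fi]; exists (coset_rep k i); split.
    exact: dyadic_coset_rep.
  by apply: filterS Fi => x /=; apply: Bz_le; rewrite /n; lia.
have {H} [d H] := choice H.
have dmn m n : (m <= n)%N -> abs2 (d n - d m) <= 2 ^ (- m%:Z).
  move=> mn; have [x [/= xm xn]] := filter_ex (filterI (H m).2 (H n).2).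
  have : Bz (- m%:Z) (Q2_of_rat (d n) - Q2_of_rat (d m)).
    apply: Bz_trans xm; apply/BzC; apply: Bz_le xn; lia.
  by rewrite -Q2_of_ratB /Bz/= absQ2_of_rat.
have dc : d \in cauchy2.
  apply/asboolP => e e0; exists (Num.bound e^-1) => m n Nm Nn.
  rewrite -(subrKA (d (Num.bound e^-1))).
  rewrite (le_lt_trans (abs2D_max _ _))// [abs2 (_ - d n)]abs2B gt_max.
  by rewrite !(le_lt_trans (dmn _ _ _))// -exprnN realalg.RealAlg.upper_nthrootVP.
pose x : Q2 := \pi_Q2 (Cauchy2Seq dc).
have xd n : Bz (- n%:Z) (x - Q2_of_rat (d n)).
  rewrite /Bz/= /x /Q2_of_rat -[_ - _](raddfB (\pi_Q2)).
  by apply: absQ2_pi_le; exists n => m nm /=; exact: dmn.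
have Fx : F --> x.
  move=> A /nbhs_Q2[l lA]; apply: filterS (H l).2 => y /= yd; apply: lA.
  by apply: (Bz_trans yd); apply/BzC.
exists x; split => //.
have [y [/= yk yl]] := filter_ex (filterI FB (H `|k|%N).2).
rewrite -(subrK y x); apply: BzD => //; apply: (@Bz_le (- `|k|%N%:Z)); first by lia.
by apply: Bz_trans (xd _) _; apply/BzC.
Qed.

Lemma closed_Bz k : closed (Bz k).
Proof. by have := @closed_coset k 0; congr closed; apply/seteqP; split => x /=; rewrite subr0. Qed.

Lemma compact_sub_Bz (K : set Q2) : compact K -> exists j : nat, K `<=` Bz j.
Proof.
rewrite compact_cover => /(_ nat setT (fun j : nat => Bz j)).
case=> [||D _ KD]; first by move=> i _; exact: open_Bz.
  by move=> x _; rewrite [X in X x](Bz_bigcup).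
exists (\max_(i <- D) i)%N => x /KD[i /= iD]; apply: Bz_le.
by rewrite lez_nat (@leq_bigmax_seq _ _ xpredT id).
Qed.

(** * Atomic measures *)

Section atomic_measure.
Local Open Scope ereal_scope.
Variables (R : realType) (I : countType) (T : ptopologicalType).
Variables (a : I -> {nonneg R}) (t : I -> T).

(** The countable index type is enumerated through [pickle_inv]; numbers that code no index
    contribute the zero measure. *)
Definition atom_seq (n : nat) : {measure set (borel T) -> \bar R} :=
  if pickle_inv n is Some i then mscale (a i) (dirac (t i : borel T)) else mzero.

Definition atomic : {measure set (borel T) -> \bar R} := mseries atom_seq 0.

Lemma nneseries_pickle (g : I -> \bar R) : (forall i, 0 <= g i) ->
  \sum_(0 <= n <oo) (if @pickle_inv I n is Some i then g i else 0) =
  \esum_(i in setT) g i.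
Proof.
move=> g0; rewrite ereal_series nneseries_esum; last first.
  by move=> n _; case: pickle_inv.
pose h n := if @pickle_inv I n is Some i then g i else 0.
transitivity (\esum_(n in range (@choice.pickle I)) h n).
  rewrite [LHS]esum_mkcond [RHS]esum_mkcond; apply: eq_esum => n _.
  rewrite /h mem_set//.
  case: ifPn => //; case E : (pickle_inv n) => [i|]//.
  case/negP; apply/mem_set; exists i => //.
  by have := @pickle_invK I n; rewrite E.
rewrite esum_image; last by move=> i j _ _; exact: (pcan_inj choice.pickleK).
by apply: eq_esum => i _; rewrite /h choice.pickleK_inv.
Qed.

Lemma atomicE (A : set T) :
  atomic A = \esum_(i in t @^-1` A) (a i)%:num%:E.
Proof.
transitivity (\sum_(0 <= n <oo) (if @pickle_inv I n is Some i then
    (a i)%:num%:E * (\1_A (t i))%:E else 0)).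
  by apply: eq_eseriesr => n _; rewrite /atom_seq; case: pickle_inv.
rewrite nneseries_pickle; last by move=> i; rewrite mule_ge0// lee_fin.
rewrite [RHS]esum_mkcond; apply: eq_esum => i _.
rewrite indicE; have [|] := boolP (t i \in A) => h.
  by rewrite mule1 ifT// mem_set//; move/set_mem : h.
by rewrite mule0 ifF//; apply/negbTE; apply: contra h => /set_mem/= ?; exact/mem_set.
Qed.

Lemma integral_atomic_measurable (f : borel T -> \bar R) :
  measurable_fun setT f -> (forall x, 0 <= f x) ->
  \int[atomic]_x f x = \esum_(i in setT) (a i)%:num%:E * f (t i).
Proof.
move=> mf f0; rewrite ge0_integral_measure_series//.
rewrite -nneseries_pickle; last by move=> i; rewrite mule_ge0.
apply: eq_eseriesr => n _; rewrite /atom_seq; case: pickle_inv => [i|].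
  by rewrite ge0_integral_mscale//= integral_dirac// diracT mul1e.
by rewrite integral_measure_zero.
Qed.

Hypothesis T1 : forall x : T, closed [set x].

Lemma measurable_point (x : T) : measurable ([set x] : set (borel T)).
Proof.
by rewrite -[X in measurable X]setCK; apply: measurableC; apply: sub_sigma_algebra; exact: closed_openC.
Qed.

Import HBNNSimple.

(* The simple functions below [h] that are supported on finitely many atoms already
   exhaust the integral. *)
Lemma integral_atomic (h : T -> R) : (forall x, 0 <= h x)%R ->
  \int[atomic]_x (h x)%:E = \esum_(i in setT) (a i)%:num%:E * (h (t i))%:E.
Proof.
move=> h0; apply/eqP; rewrite eq_le; apply/andP; split.
  rewrite ge0_integralTE; last by move=> x; rewrite lee_fin.
  apply: ge_ereal_sup => _ [g /= gh <-].
  rewrite -integralT_nnsfun integral_atomic_measurable.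
  - by apply: le_esum => i _; rewrite lee_wpmul2l ?lee_fin// -lee_fin.
  - exact/measurable_EFinP.
  - by move=> x; rewrite lee_fin.
apply: ge_ereal_sup => _ [X [finX _] <-].
pose Y := t @` X; have finY : finite_set Y by exact: finite_image.
pose g : borel T -> \bar R := fun x => (\sum_(y \in Y) h y * \1_[set y] x)%R%:E.
have gE x : g x = (if x \in Y then h x else 0%R)%:E.
  rewrite /g; congr EFin; case: ifPn => [/set_mem xY|].
    rewrite (fsbigD1 x)//= indicE mem_set// mulr1 fsbig1 ?addr0// => y /= [yY].
    move=> yx; rewrite indicE memNset ?mulr0// => /= xy; exact/yx/esym.
  rewrite notin_setE => xY; rewrite fsbig1// => y yY.
  by rewrite indicE memNset ?mulr0// => /= xy; apply: xY; rewrite xy.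
have mg : measurable_fun setT g.
  apply/measurable_EFinP; under eq_fun do rewrite fsbig_finite//.
  apply: measurable_sum => y; apply: measurable_funM => //.
  by apply: measurable_indic; exact: measurable_point.
have g0 x : 0 <= g x by rewrite gE lee_fin; case: ifP.
apply: (@le_trans _ _ (\int[atomic]_x g x)).
  rewrite integral_atomic_measurable//; apply: esum_ge; exists X => //.
  apply: lee_fsum => // i Xi; rewrite gE ifT//; apply/mem_set.
  by exists i.
rewrite [leRHS]ge0_integralTE; last by move=> x; rewrite lee_fin.
rewrite [leLHS]ge0_integralTE//.
apply: le_ereal_sup => _ [k /= kg <-]; exists k => //= x.
by apply: le_trans (kg x) _; rewrite gE lee_fin; case: ifP.
Qed.

End atomic_measure.

Section atomic_radon.
Local Open Scope ereal_scope.
Variables (R : realType) (I : countType) (T : ptopologicalType).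
Variables (a : I -> {nonneg R}) (t : I -> T).
Hypothesis T1 : forall x : T, closed [set x].
Variable U : nat -> set T.
Hypothesis oU : forall k, open (U k).
Hypothesis ndU : forall k l, (k <= l)%N -> U k `<=` U l.
Hypothesis coverU : forall x, exists k, U k x.
Hypothesis finU : forall k, atomic a t (U k) < +oo.
Local Notation mu := (atomic a t).

Lemma le_atomic (A B : set T) : A `<=` B -> mu A <= mu B.
Proof.
move=> AB; rewrite !atomicE esum_mkcond [leRHS]esum_mkcond; apply: le_esum => i _.
case: ifPn => [/set_mem/= /AB tB|_]; last by case: ifP; rewrite ?lee_fin.
by rewrite mem_set.
Qed.

Lemma atomic_pure_point : pure_point mu.
Proof.
move=> B _; rewrite atomicE.
rewrite (eq_esum (b := fun x => \esum_(i in t @^-1` [set x]) (a i)%:num%:E)); last first.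
  by move=> x _; exact: atomicE.
rewrite esum_esum; last by move=> *; rewrite lee_fin.
apply: (@reindex_esum _ _ _ _ _ (fun p => p.2) (fun i => (a i)%:num%:E)).
split.
- by move=> [x i] /= [Bx ti]; rewrite /preimage/= ti.
- move=> [x i] [y j] /set_mem[/= _ xi] /set_mem[/= _ yj] /= ij.
  by rewrite -xi -yj ij.
- by move=> i /= Bi; exists (t i, i) => //.
Qed.

Lemma finite_atomic_compact (K : set T) : compact K -> mu K < +oo.
Proof.
rewrite compact_cover => /(_ nat setT U)[//||D _ KD].
  by move=> x _; have [k Ukx] := coverU x; exists k.
apply: le_lt_trans (finU (\max_(i <- D) i)%N); apply: le_atomic.
move=> x /KD[i /= iD]; apply: ndU.
by rewrite (@leq_bigmax_seq _ _ xpredT id).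
Qed.

Lemma atomic_inner (A : set T) :
  mu A = ereal_sup [set mu K | K in [set K : set T | compact K /\ K `<=` A]].
Proof.
apply/eqP; rewrite eq_le; apply/andP; split; last first.
  by apply: ge_ereal_sup => _ [K [_ KA] <-]; exact: le_atomic.
rewrite atomicE; apply: ge_ereal_sup => _ [X [finX XA] <-].
apply: (@le_trans _ _ (mu (t @` X))); last first.
  apply: ereal_sup_ubound; exists (t @` X) => //; split.
    exact/finite_compact/finite_image.
  by move=> _ [i /XA Ai <-].
rewrite atomicE; apply: esum_ge; exists X => //; split => // i Xi.
by exists i.
Qed.

(** In each [U k] finitely many points carry all but e / 2^(k+1) of the mass. Removing from the
    space those of them that lie outside [B] leaves an open set, whose excess over [B] has mass at
    most the sum of these remainders. *)
Lemma atomic_outer (B : set T) : measurable (B : set (borel T)) ->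
  mu B = ereal_inf [set mu V | V in [set V : set T | open V /\ B `<=` V]].
Proof.
move=> mB; apply/eqP; rewrite eq_le; apply/andP; split.
  by apply: le_ereal_inf_tmp => _ [V [_ BV] <-]; exact: le_atomic.
apply/lee_addgt0Pr => e e0.
have HY0 k : exists Yk : set T, [/\ finite_set Yk, Yk `<=` U k &
    mu (U k `\` Yk) <= (e / (2 ^ k.+1)%:R)%:E].
  have d0 : (0 < e / (2 ^ k.+1)%:R)%R by rewrite divr_gt0// ltr0n expn_gt0.
  have muUE : mu (U k) = \esum_(i in t @^-1` U k) (a i)%:num%:E by exact: atomicE.
  have Ufin : mu (U k) \is a fin_num by rewrite ge0_fin_numE.
  have := Ufin; rewrite {1}muUE => /(ub_ereal_sup_adherent d0)[_ [X [finX XU] <-]].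
  rewrite -[ereal_sup _]/(\esum_(i in t @^-1` U k) (a i)%:num%:E) -muUE => XB.
  exists (t @` X); split.
  - exact: finite_image.
  - by move=> _ [i /XU ? <-].
  have finY : finite_set (t @` X) by exact: finite_image.
  have mY : measurable ((t @` X) : set (borel T)).
    by rewrite -(@bigcup_imset1 _ _ X t); apply: fin_bigcup_measurable => // i _; exact: measurable_point.
  have mU : measurable (U k : set (borel T)) by exact: sub_sigma_algebra.
  rewrite measureD//; last by rewrite -ge0_fin_numE.
  have -> : U k `&` (t @` X) = t @` X.
    by apply/setIidPr => _ [i /XU ? <-].
  have : \sum_(i \in X) (a i)%:num%:E <= mu (t @` X).
    by rewrite atomicE; apply: esum_ge; exists X => //; split => // i Xi; exists i.
  have muYfin : mu (t @` X) \is a fin_num.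
    by rewrite ge0_fin_numE// (le_lt_trans _ (finU k))//; apply: le_atomic => _ [i /XU ? <-].
  move: XB; rewrite fsumEFin// -(fineK Ufin) -(fineK muYfin) => XB XY.
  apply: (@le_trans _ _ ((fine (mu (U k)))%:E - (fine (mu (t @` X)))%:E)).
    by rewrite !fineK.
  move: XB XY; move: (fine _) (fine _) (\sum_(i \in X) _)%R => u v w.
  by rewrite -!EFinB lte_fin !lee_fin; lra.
have [Y HY] := choice HY0.
(* A point of [Y k] is removed only if [k] is the first index with [U k y]. Hence [D] meets every
   [U l] in a finite set and is closed. *)
pose D := [set y | exists k, [/\ Y k y, ~ B y & forall l, (l < k)%N -> ~ U l y]].
have finDU l : finite_set (D `&` U l).
  apply: (@sub_finite_set _ _ (\bigcup_(k in `I_l.+1) Y k)).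
    move=> y [[k [Yk _ yk]] Ul]; exists k => //=; rewrite ltnS leqNgt.
    by apply/negP => /yk.
  by apply: bigcup_finite => // k _; have [] := HY k.
have oV : open (~` D).
  rewrite openE => x Dx; have [l Ulx] := coverU x.
  have oW : open (U l `\` (D `&` U l)).
    rewrite setDE; apply: openI => //; apply: closed_openC.
    rewrite -(@image_id _ (D `&` U l)) -bigcup_imset1.
    by apply: closed_bigcup => // y _; exact: T1.
  apply: (@filterS _ _ _ (U l `\` (D `&` U l))).
    by move=> y [Uy nDU] Dy; apply: nDU.
  by apply: open_nbhs_nbhs; split => //; split => // -[].
apply: (@le_trans _ _ (mu (~` D))).
  apply: ereal_inf_lbound; exists (~` D) => //; split => // y By [k [_]].
  by [].
have mUY k : measurable ((U k `\` Y k) : set (borel T)).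
  apply: measurableD; first exact: sub_sigma_algebra.
  rewrite -(@image_id _ (Y k)) -bigcup_imset1.
  apply: fin_bigcup_measurable; first by have [] := HY k.
  by move=> i _; exact: measurable_point.
apply: (@le_trans _ _ (mu (B `|` \bigcup_k (U k `\` Y k)))).
  apply: le_atomic => y nDy; have [By|nBy] := pselect (B y); [by left|right].
  have exk : exists k, `[< U k y >] by have [k ?] := coverU y; exists k; apply/asboolP.
  exists (ex_minn exk) => //; case: ex_minnP => k /asboolP Uk kmin'; split => // Yk.
  apply: nDy; exists k; split => // l lk Ul.
  by have := kmin' l; rewrite leqNgt lk => H; move/asboolP : Ul => /H.
apply: le_trans (measureU2 _ _ _) _ => //.
  exact: bigcup_measurable.
rewrite leeD2l//; apply: le_trans (_ : \sum_(0 <= k <oo) mu (U k `\` Y k) <= _).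
  apply: measure_sigma_subadditive => //; exact: bigcup_measurable.
apply: le_trans (_ : \sum_(0 <= k <oo) (e / (2 ^ k.+1)%:R)%:E <= _).
  by apply: lee_nneseries => // k _; have [] := HY k.
exact: epsilon_trick0 (ltW e0).
Qed.

Lemma atomic_is_radon : radon mu.
Proof.
split; first exact: finite_atomic_compact.
- exact: atomic_outer.
- by move=> A _; exact: atomic_inner.
Qed.

End atomic_radon.

(** * The Fejer kernel compared with sinc^2 *)

Section sinc.
Variable R : realType.
Implicit Types x y u : R.

Lemma le_of_derive_ge0 (f df : R -> R) (b : R) :
  (forall x, is_derive x (1 : R) f (df x)) ->
  (forall x, 0 < x < b -> 0 <= df x) ->
  forall x, 0 <= x <= b -> f 0 <= f x.
Proof.
move=> fd df0 x /andP[x0 xb].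
have fdx y : derivable f y 1 by have [] := fd y.
apply: (@ger0_derive1_ndecr _ f 0 b) => //.
- move=> y; rewrite in_itv/= => y0; rewrite derive1E.
  by have [_ ->] := fd y; exact: df0.
- apply: continuous_subspaceT => y; apply: differentiable_continuous.
  exact/derivable1_diffP.
Qed.

Lemma sin_le_id u : 0 <= u <= pi -> sin u <= u.
Proof.
move=> /(@le_of_derive_ge0 (fun x => x - sin x) (fun x => 1 - cos x)).
rewrite sin0 subrr subr_ge0; apply => x; last by rewrite subr_ge0 cos_le1.
Qed.

Lemma mul_cos_le_sin u : 0 <= u <= pi -> u * cos u <= sin u.
Proof.
move=> /(@le_of_derive_ge0 (fun x => sin x - x * cos x) (fun x => x * sin x)).
rewrite sin0 mul0r subrr subr_ge0; apply => x; last first.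
  by move=> /andP[x0 xpi]; rewrite mulr_ge0 ?ltW// sin_gt0_pi// x0.
apply: is_derive_eq; rewrite !scaler1 /GRing.scale/=; ring.
Qed.

(** Square u cos u <= sin u and use cos^2 = 1 - sin^2. In this form the bound reads u^2 - sin^2 u <=
    u^2 sin^2 u, which is what [fejer_sinc2] consumes. *)
Lemma sqr_sin_ge u : `|u| <= pi / 2 -> u ^+ 2 <= sin u ^+ 2 * (1 + u ^+ 2).
Proof.
wlog u0 : u / 0 <= u.
  move=> H; have [/H//|/ltW u0] := leP 0 u.
  by have := H (- u); rewrite normrN sinN !sqrrN oppr_ge0; exact.
rewrite ger0_norm// => upi; have pi0 := pi_gt0 R.
have h : 0 <= u * cos u <= sin u.
  rewrite mulr_ge0 ?mul_cos_le_sin ?cos_ge0_pihalf//=; last by lra.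
  by rewrite u0 /=; lra.
have : (u * cos u) ^+ 2 <= sin u ^+ 2 by rewrite ler_sqr ?nnegrE; lra.
by rewrite exprMn cos2sin2; lra.
Qed.

Lemma sqr_sin_le u : `|u| <= pi / 2 -> sin u ^+ 2 <= u ^+ 2.
Proof.
wlog u0 : u / 0 <= u.
  move=> H; have [/H//|/ltW u0] := leP 0 u.
  by have := H (- u); rewrite normrN sinN !sqrrN oppr_ge0; exact.
rewrite ger0_norm// => upi; have pi0 := pi_gt0 R.
rewrite ler_sqr ?nnegrE// ?sin_le_id//; first by rewrite u0; lra.
by apply: sin_ge0_pi; lra.
Qed.

(* [fejer M x = (sin (pi x) / (2 ^ M * sin (pi x / 2 ^ M))) ^ 2], written as a product to
   avoid the zeros of the denominator. *)
Definition fejer (M : nat) x : R := \prod_(i < M) cos (pi * x / 2 ^+ i.+1) ^+ 2.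

Lemma fejerS M x : fejer M.+1 x = fejer M x * cos (pi * x / 2 ^+ M.+1) ^+ 2.
Proof. by rewrite /fejer big_ord_recr. Qed.

Lemma fejer_ge0 M x : 0 <= fejer M x.
Proof. by apply: prodr_ge0 => i _; exact: sqr_ge0. Qed.

(** The formula sin 2u = 2 sin u cos u, iterated [M] times. *)
Lemma fejer_sin M x : 4 ^+ M * sin (pi * x / 2 ^+ M) ^+ 2 * fejer M x = sin (pi * x) ^+ 2.
Proof.
elim: M => [|M IH]; first by rewrite /fejer big_ord0 !expr0 divr1 mul1r mulr1.
rewrite -IH fejerS exprS.
have -> : pi * x / 2 ^+ M = (pi * x / 2 ^+ M.+1) *+ 2.
  by rewrite exprS -mulr_natr; field; rewrite expf_neq0.
rewrite sin_mulr2n; ring.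
Qed.

Definition sinc2 x : R := if x == 0 then 1 else (sin (pi * x) / (pi * x)) ^+ 2.

Lemma sinc2_ge0 x : 0 <= sinc2 x.
Proof. by rewrite /sinc2; case: ifP => _; rewrite ?ler01 ?sqr_ge0. Qed.

(** With u = pi x / 2^M, sinc^2 equals the kernel times sin^2 u / u^2, so the difference is at most
    the kernel times sin^2 u. By [fejer_sin] this is 4^-M sin^2 (pi x). The condition on [x], a
    centred period of the kernel, says |u| <= pi / 2. *)
Lemma fejer_sinc2 M x : `|x| <= 2 ^+ M / 2 ->
  0 <= fejer M x - sinc2 x <= 4 ^- M.
Proof.
rewrite /sinc2; have p4 : 0 < (4 : R) ^+ M by rewrite exprn_gt0.
have [-> _|x0 xM] := eqVneq x 0.
  rewrite /fejer big1 ?subrr ?lexx ?invr_ge0 ?ltW// => i _.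
  by rewrite mulr0 mul0r cos0 expr1n.
have pi0 := pi_gt0 R; have p2 : 0 < (2 : R) ^+ M by rewrite exprn_gt0.
pose u := pi * x / 2 ^+ M.
have uM : `|u| <= pi / 2.
  rewrite /u !normrM normfV (gtr0_norm pi0) (gtr0_norm p2).
  rewrite ler_pdivrMr// mulrAC -mulrA ler_pM2l//.
have u0 : u != 0 by rewrite /u mulf_neq0 ?invr_neq0 ?(gt_eqF p2)// mulf_neq0// gt_eqF.
have u2 : 0 < u ^+ 2 by rewrite exprn_even_gt0.
have ge := sqr_sin_ge uM; have le := sqr_sin_le uM.
have s0 : 0 < sin u ^+ 2.
  rewrite lt_neqAle sqr_ge0 andbT; apply/eqP => s0.
  by move: ge; rewrite -s0 mul0r leNgt u2.
have E4 : (4 : R) ^+ M = (2 ^+ M) ^+ 2 by rewrite exprAC; congr (_ ^+ _); ring.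
have -> : (sin (pi * x) / (pi * x)) ^+ 2 = sin u ^+ 2 * fejer M x / u ^+ 2.
  rewrite exprMn -(fejer_sin M) -/u E4 /u.
  move: (fejer M x) => f; move: (sin _) => s; move: (2 ^+ M) p2 => t t0.
  move: (pi : R) pi0 => p p0; field.
  by rewrite x0 (gt_eqF t0) (gt_eqF p0).
have -> : fejer M x - sin u ^+ 2 * fejer M x / u ^+ 2 =
    fejer M x * (u ^+ 2 - sin u ^+ 2) / u ^+ 2 by field.
apply/andP; split.
  by rewrite divr_ge0 ?(ltW u2)// mulr_ge0 ?fejer_ge0// subr_ge0.
rewrite ler_pdivrMr// -(ler_pM2l p4) [leRHS]mulrA divff ?gt_eqF// mul1r.
have h : 4 ^+ M * sin u ^+ 2 * fejer M x <= 1.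
  by rewrite /u fejer_sin -[leRHS](cos2Dsin2 (pi * x)) lerDr sqr_ge0.
apply: le_trans (_ : 4 ^+ M * (fejer M x * (sin u ^+ 2 * u ^+ 2)) <= _).
  rewrite ler_pM2l// ler_wpM2l ?fejer_ge0//; lra.
move: (sin u) h => s h.
have -> : 4 ^+ M * (fejer M x * (s ^+ 2 * u ^+ 2)) = 4 ^+ M * s ^+ 2 * fejer M x * u ^+ 2.
  by ring.
by rewrite ler_piMl// ltW.
Qed.

End sinc.

(** * Exponential sums *)

Section exponentials.
Variable R : realType.
Local Notation C := (R[i]).
Implicit Types x y : R.

Definition ee x : C := (cos (pi *+ 2 * x) +i* sin (pi *+ 2 * x))%C.

Lemma ee0 : ee 0 = 1.
Proof. by rewrite /ee mulr0 cos0 sin0. Qed.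

Lemma eeD x y : ee (x + y) = ee x * ee y.
Proof.
rewrite /ee mulrDr cosD sinD; apply/eqP; rewrite eq_complex /=.
by apply/andP; split; apply/eqP; ring.
Qed.

Lemma eeN x : ee (- x) = conjc (ee x).
Proof. by rewrite /ee mulrN cosN sinN. Qed.

Lemma ee_sum_nat x n : ee (n%:R * x) = ee x ^+ n.
Proof.
elim: n => [|n IH]; first by rewrite mul0r ee0.
by rewrite exprS -IH -eeD; congr ee; rewrite -natr1; ring.
Qed.

Lemma ee1 : ee 1 = 1.
Proof. by rewrite /ee mulr1 cos2pi sin2pi. Qed.

Lemma ee_int (m : int) : ee m%:~R = 1.
Proof.
have H n : ee (n%:R) = 1 by rewrite -[n%:R]mulr1 ee_sum_nat ee1 expr1n.
case: m => n; first exact: H.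
by rewrite NegzE intrN eeN -pmulrn H conjc1.
Qed.

Lemma ee_half : ee (1 / 2) = - 1.
Proof.
have E : pi *+ 2 * (1 / 2) = pi :> R by field.
by rewrite /ee E cospi sinpi; apply/eqP; rewrite eq_complex/= oppr0 !eqxx.
Qed.

Lemma eeDint x y : x - y \is a Num.int -> ee x = ee y.
Proof. by move=> /intrP[m xy]; rewrite -(subrK y x) eeD xy ee_int mul1r. Qed.

(** Doubling lowers the denominator, so by induction 2x is an integer; an odd value would make
    [ee x] equal to -1. *)
Lemma ee_eq1 (n : nat) x : x * 2 ^+ n \is a Num.int -> ee x = 1 -> x \is a Num.int.
Proof.
elim: n x => [x|n IH x]; first by rewrite expr0 mulr1.
rewrite exprS mulrA => /IH H ex.
have /intrP[m xm] : x * 2 \is a Num.int.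
  by apply: H; rewrite mulr_natr mulr2n eeD ex mulr1.
have [k mk] : exists k : int, m = k * 2 \/ m = k * 2 + 1.
  exists (m %/ 2)%Z; have := divz_eq m 2; have := modz_ge0 m (isT : 2 != 0 :> int).
  by have := ltz_pmod m (isT : 0 < 2 :> int); lia.
case: mk => mk; have {}xm : x = m%:~R / 2 by rewrite -xm mulfK.
  by rewrite xm mk intrM mulfK// intr_int.
move: ex; have -> : x = k%:~R + 1 / 2.
  by rewrite xm mk intrD intrM mulrDl mulfK//.
rewrite eeD ee_int ee_half mul1r => /eqP.
by rewrite eq_complex /= => /andP[/eqP]; lra.
Qed.

Definition nsq (z : C) : R := complex.Re z ^+ 2 + complex.Im z ^+ 2.

Lemma nsqM z z' : nsq (z * z') = nsq z * nsq z'.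
Proof. by case: z z' => [a b] [c d]; rewrite /nsq /=; ring. Qed.

Lemma nsq_ge0 z : 0 <= nsq z.
Proof. by rewrite addr_ge0 ?sqr_ge0. Qed.

Lemma nsqE z : ((nsq z)%:C)%C = z * conjc z.
Proof.
case: z => a b; apply/eqP; rewrite eq_complex /nsq /=; apply/andP.
by split; apply/eqP; ring.
Qed.

Lemma nsq_normc z : nsq z = normc z ^+ 2.
Proof. by case: z => a b; rewrite /nsq /= sqr_sqrtr ?addr_ge0 ?sqr_ge0. Qed.

Lemma norm_ee x : `|ee x| = 1.
Proof. by rewrite normc_def /= cos2Dsin2 sqrtr1. Qed.

Definition dirichlet (M : nat) x : C := \sum_(a < 2 ^ M) ee (x * a%:R / 2 ^+ M).

Lemma big_ord_double (V : zmodType) (F : nat -> V) n :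
  \sum_(i < n.*2) F i = \sum_(i < n) (F i.*2 + F i.*2.+1).
Proof.
elim: n => [|n IH]; first by rewrite !big_ord0.
by rewrite doubleS !big_ord_recr /= IH addrA.
Qed.

Lemma dirichletS M x : dirichlet M.+1 x = dirichlet M x * (1 + ee (x / 2 ^+ M.+1)).
Proof.
rewrite /dirichlet expnS mul2n (big_ord_double (fun a => ee (x * a%:R / 2 ^+ M.+1))).
rewrite mulr_suml; apply: eq_bigr => a _.
rewrite mulrDr mulr1 -eeD; congr (ee _ + ee _).
  by rewrite -muln2 natrM exprS; field; rewrite expf_neq0.
by rewrite -natr1 -muln2 natrM exprS; field; rewrite expf_neq0.
Qed.

(** Splitting the geometric sum by the parity of the index contributes a factor 1 + e(y), whose
    squared modulus is 4 cos^2 (pi y). Thus [fejer] is the normalized square of the Dirichlet sum of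
    length [2 ^ M]. *)
Lemma nsq_dirichlet M x : nsq (dirichlet M x) = 4 ^+ M * fejer M x.
Proof.
elim: M => [|M IH].
  by rewrite /dirichlet big_ord1 mulr0 mul0r ee0 /fejer big_ord0 /nsq/= expr0 expr0n/= expr1n addr0 mul1r.
rewrite dirichletS nsqM IH fejerS [4 ^+ M.+1]exprS.
suff -> : nsq (1 + ee (x / 2 ^+ M.+1)) = 4 * cos (pi * x / 2 ^+ M.+1) ^+ 2 by ring.
rewrite /nsq /=.
have -> : pi *+ 2 * (x / 2 ^+ M.+1) = (pi * x / 2 ^+ M.+1) *+ 2 by rewrite !mulrA mulrnAl mulrnAl.
rewrite cos_mulr2n sin_mulr2n.
have := cos2Dsin2 (pi * x / 2 ^+ M.+1).
move: (cos _) (sin _) => c s h.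
have {h} h : s ^+ 2 = 1 - c ^+ 2 by rewrite -h addrC addKr.
have -> : (1 + (c ^+ 2 *+ 2 - 1)) ^+ 2 + (0 + c * s *+ 2) ^+ 2 =
    4 * c ^+ 2 * (c ^+ 2 + s ^+ 2) by ring.
by rewrite h; ring.
Qed.

Lemma fejer_periodic M x : fejer M (x + 2 ^+ M) = fejer M x.
Proof.
have p4 : (4 : R) ^+ M != 0 by rewrite expf_neq0.
apply: (mulfI p4); rewrite -!nsq_dirichlet; congr nsq.
apply: eq_bigr => a _; apply: eeDint.
have -> : (x + 2 ^+ M) * a%:R / 2 ^+ M - x * a%:R / 2 ^+ M = a%:R.
  by field; rewrite expf_neq0.
by rewrite pmulrn intr_int.
Qed.

(** The first [M] factors have period 2^M, while the shift moves the argument of the last cosine by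
    pi / 2, so cos^2 + sin^2 = 1 removes that factor. *)
Lemma fejer_split M x : fejer M.+1 x + fejer M.+1 (x + 2 ^+ M) = fejer M x.
Proof.
rewrite !fejerS fejer_periodic.
have -> : pi * (x + 2 ^+ M) / 2 ^+ M.+1 = pi * x / 2 ^+ M.+1 + pi / 2.
  rewrite exprS; move: (pi : R) => p; field; rewrite expf_neq0//.
by rewrite cosDpihalf sqrrN -mulrDr cos2Dsin2 mulr1.
Qed.

Lemma sum_ee_orth (n i k : nat) : (i < 2 ^ n)%N -> (k < 2 ^ n)%N ->
  \sum_(m < 2 ^ n) ee (m%:R * ((i%:R - k%:R) / 2 ^+ n)) =
  if i == k then (2 ^ n)%:R else 0.
Proof.
move=> il kl; under eq_bigr do rewrite ee_sum_nat.
set z := ee _; have zn : z ^+ (2 ^ n) = 1.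
  rewrite /z -ee_sum_nat natrX mulrC divfK ?expf_neq0//.
  by rewrite !pmulrn -intrB ee_int.
case: eqVneq => [ik|ik].
  rewrite /z ik subrr mul0r ee0; under eq_bigr do rewrite expr1n.
  by rewrite sumr_const card_ord.
apply/eqP; rewrite -(mulrI_eq0 _ (mulfI (_ : z - 1 != 0))).
  by rewrite -subrX1 zn subrr.
rewrite subr_eq0; apply: contraNneq ik => z1.
have /intrP[q] : (i%:R - k%:R) / 2 ^+ n \is a @Num.int R.
  by apply: (@ee_eq1 n); rewrite // divfK ?expf_neq0// !pmulrn -intrB intr_int.
move=> /(congr1 ( *%R^~ (2 ^+ n))); rewrite divfK ?expf_neq0//.
rewrite -natrX !pmulrn -intrB -intrM => /intr_inj.
set P := (2 ^ n)%N in il kl *; move=> E; case: q E => [[|q]|q] E.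
- by apply/eqP; lia.
- by move: E; rewrite -addn1 PoszD mulrDl mul1r; have : 0 <= q%:Z * P%:Z by []; lia.
- move: E; rewrite NegzE -addn1 PoszD mulNr mulrDl mul1r.
  by have : 0 <= q%:Z * P%:Z by []; lia.
Qed.

Lemma nsq_sum n (F : 'I_n -> C) :
  ((nsq (\sum_(i < n) F i))%:C)%C = \sum_(i < n) \sum_(k < n) F i * conjc (F k).
Proof.
rewrite nsqE mulr_suml; apply: eq_bigr => i _.
by rewrite [conjc _](rmorph_sum (@conjc R)) mulr_sumr.
Qed.

Lemma parseval (n : nat) (g : nat -> C) :
  \sum_(m < 2 ^ n) nsq (\sum_(i < 2 ^ n) ee (m%:R * (i%:R / 2 ^+ n)) * g i) =
  (2 ^ n)%:R * \sum_(i < 2 ^ n) nsq (g i).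
Proof.
apply: (@complexI R); rewrite rmorphM !rmorph_sum /= rmorph_nat.
transitivity (\sum_(m < 2 ^ n) \sum_(i < 2 ^ n) \sum_(k < 2 ^ n)
    (g i * conjc (g k)) * ee (m%:R * ((i%:R - k%:R) / 2 ^+ n))).
  apply: eq_bigr => m _; rewrite nsq_sum.
  apply: eq_bigr => i _; apply: eq_bigr => k _.
  rewrite (_ : conjc _ = ee (- (m%:R * (k%:R / 2 ^+ n))) * conjc (g k)); last by rewrite eeN; exact: rmorphM.
  rewrite mulrACA -eeD mulrC; congr (_ * ee _).
  by field; rewrite expf_neq0.
rewrite exchange_big mulr_sumr; apply: eq_bigr => i _ /=.
rewrite exchange_big (bigD1 i)//= [X in _ + X]big1 ?addr0; last first.
  move=> k ki; rewrite -mulr_sumr sum_ee_orth// ifF ?mulr0//.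
  by apply/negbTE; apply: contra ki => /eqP ik; apply/eqP/val_inj.
by rewrite -mulr_sumr sum_ee_orth// eqxx nsqE mulrC.
Qed.

End exponentials.

Definition coset (k : int) (c : Q2) : set Q2 := [set x | Bz k (x - c)].

Lemma coset0 k : coset k 0 = Bz k.
Proof. by apply/seteqP; split => x; rewrite /coset/= subr0. Qed.

Lemma coset_image k c : coset k c = [set x + c | x in Bz k].
Proof.
apply/seteqP; split => [x xc|_ [x xk <-]]; last by rewrite /coset/= addrK.
by exists (x - c); rewrite ?subrK.
Qed.

Lemma measurable_coset k c : measurable (coset k c : set (borel Q2)).
Proof. by apply: sub_sigma_algebra; exact: open_coset. Qed.

Lemma measurable_Bz k : measurable (Bz k : set (borel Q2)).
Proof. by rewrite -coset0; exact: measurable_coset. Qed.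

Definition grid (k : int) (i : nat) : Q2 := Q2_of_rat (coset_rep k i).

Lemma Bz_bigcup_coset (k : int) (n : nat) :
  Bz k = \bigcup_(i in `I_(2 ^ n)) coset (k - n%:Z) (grid k i).
Proof.
apply/seteqP; split => [x /(Bz_cover n)[i il xi]|x [i _ xi]]; first by exists i.
rewrite -(subrK (grid k i) x); apply: BzD; last exact: Bz_coset_rep.
by apply: Bz_le xi; lia.
Qed.

Lemma trivIset_coset (k : int) (n : nat) :
  trivIset `I_(2 ^ n) (fun i => coset (k - n%:Z) (grid k i)).
Proof.
move=> i i' /= il il' [x [xi xi']]; apply: (@Bz_coset_rep_uniq k n) => //.
by apply: Bz_trans xi'; exact/BzC.
Qed.

(** * Haar measure and integration on Q_2 *)

Section haar.
Variables (R : realType) (theta : {measure set (borel Q2) -> \bar R}).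
Hypothesis htheta : haar theta.

Lemma haar_coset k c : theta (coset k c) = theta (Bz k).
Proof.
by rewrite coset_image; have [_ _] := htheta; apply; exact: measurable_Bz.
Qed.

Lemma haar_compact_fin K : compact K -> theta K \is a fin_num.
Proof. by move=> cK; rewrite ge0_fin_numE//; have [[+ _ _] _ _] := htheta; apply. Qed.

Lemma haar_Bz_fin k : theta (Bz k) \is a fin_num.
Proof. exact/haar_compact_fin/compact_Bz. Qed.

Definition unit_vol : R := fine (theta (Bz 0)).

Lemma haar_Bz_sub (k : int) (n : nat) :
  theta (Bz k) = ((2 ^ n)%:R%:E * theta (Bz (k - n%:Z)))%E.
Proof.
rewrite {1}(Bz_bigcup_coset k n) measure_fin_bigcup//; last 2 first.
- exact: trivIset_coset.
- by move=> i _; exact: measurable_coset.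
rewrite -fsbig_ord.
transitivity (\sum_(i < 2 ^ n) theta (Bz (k - n%:Z)))%E.
  by apply: eq_bigr => i _; exact: haar_coset.
by rewrite -(fineK (haar_Bz_fin _)) sumEFin sumr_const card_ord -EFinM mulr_natl.
Qed.

Lemma haar_Bz k : theta (Bz k) = (unit_vol * 2 ^ k)%:E.
Proof.
rewrite /unit_vol; case: k => n.
  rewrite (haar_Bz_sub n n) subrr -(fineK (haar_Bz_fin 0)) -EFinM.
  by rewrite fineK ?haar_Bz_fin// natrX mulrC.
rewrite (haar_Bz_sub 0 n.+1) sub0r -NegzE.
rewrite -(fineK (haar_Bz_fin (Negz n))) -EFinM /= natrX mulrAC.
rewrite NegzE -exprnN mulfV ?mul1r ?expf_neq0//.
Qed.

(** If the unit ball were null, every ball [Bz k] would be null by scaling, and so would the whole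
    group as their countable union. *)
Lemma unit_vol_gt0 : 0 < unit_vol.
Proof.
rewrite lt_neqAle fine_ge0 ?measure_ge0// andbT; apply/eqP => t0.
have [_ /eqP + _] := htheta; apply.
rewrite -Bz_bigcup; apply/eqP; rewrite eq_le measure_ge0 andbT.
apply: (le_trans (measure_sigma_subadditive _ _ _ (fun=> id))).
- by move=> i; exact: measurable_Bz.
- by apply: bigcup_measurable => i _; exact: measurable_Bz.
by rewrite eseries0// => i _ _; rewrite haar_Bz -t0 mul0r.
Qed.

Lemma haar_coset_vol k c : theta (coset k c) = (unit_vol * 2 ^ k)%:E.
Proof. by rewrite haar_coset haar_Bz. Qed.

Definition tame (h : Q2 -> R) :=
  [/\ measurable_fun [set: borel Q2] h, exists M, forall x, `|h x| <= M &
      exists j : nat, forall x, ~ Bz j x -> h x = 0].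

Lemma tame0 : tame (fun=> 0).
Proof. by split; [exact: measurable_cst|exists 0 => x; rewrite normr0|exists 0%N]. Qed.

Lemma tameD h1 h2 : tame h1 -> tame h2 -> tame (fun x => h1 x + h2 x).
Proof.
move=> [m1 [M1 b1] [j1 s1]] [m2 [M2 b2] [j2 s2]]; split.
- exact: measurable_funD.
- by exists (M1 + M2) => x; rewrite (le_trans (ler_normD _ _))// lerD.
- exists (maxn j1 j2) => x nx; rewrite s1 ?s2 ?addr0// => ?; apply: nx.
    by apply: Bz_le; last eassumption; rewrite lez_nat leq_maxr.
  by apply: Bz_le; last eassumption; rewrite lez_nat leq_maxl.
Qed.

Lemma tameZ (r : R) h : tame h -> tame (fun x => r * h x).
Proof.
move=> [m [M b] [j s]]; split.
- by apply: measurable_funM => //; exact: measurable_cst.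
- by exists (`|r| * M) => x; rewrite normrM ler_wpM2l.
- by exists j => x /s ->; rewrite mulr0.
Qed.

Lemma tame_indic (A : set Q2) h : measurable (A : set (borel Q2)) ->
  tame h -> tame (fun x => h x * \1_A x).
Proof.
move=> mA [m [M b] [j s]]; split.
- by apply: measurable_funM => //; exact: measurable_indic.
- exists M => x; rewrite normrM indicE; case: (_ \in _); last first.
    by rewrite normr0 mulr0 (le_trans _ (b x)).
  by rewrite normr1 mulr1.
- by exists j => x /s ->; rewrite mul0r.
Qed.

Lemma tame_integrable h : tame h -> theta.-integrable setT (EFin \o h).
Proof.
move=> [m [M b] [j s]].
have -> : EFin \o h = (EFin \o h) \_ (Bz j).
  apply/funext => x; rewrite /patch /=; case: ifPn => // /negP nx.
  by rewrite s// => ?; apply: nx; exact/mem_set.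
apply/(integrable_mkcond _ (measurable_Bz j)).
apply: (@measurable_bounded_integrable _ (borel Q2)).
- exact: measurable_Bz.
- by rewrite -ge0_fin_numE ?haar_Bz_fin.
- exact: (@measurable_funTS _ _ (borel Q2)).
- exists M; split; first by rewrite num_real.
  by move=> x Mx y _ /=; rewrite (le_trans (b y))// ltW.
Qed.

Local Notation Rint h := (\int[theta]_x h x).

Lemma RintD h1 h2 : tame h1 -> tame h2 ->
  Rint (fun x => h1 x + h2 x) = Rint h1 + Rint h2.
Proof. by move=> t1 t2; apply: (@RintegralD _ (borel Q2)) => //; exact: tame_integrable. Qed.

Lemma RintZ r h : tame h -> Rint (fun x => r * h x) = r * Rint h.
Proof. by move=> t1; apply: (@RintegralZl _ (borel Q2)) => //; exact: tame_integrable. Qed.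

Lemma Rint_coset h k c a e : tame h -> (forall x, ~ coset k c x -> h x = 0) ->
  (forall x, coset k c x -> `|h x - a| <= e) ->
  `|Rint h - a * (unit_vol * 2 ^ k)| <= e * (unit_vol * 2 ^ k).
Proof.
move=> th h0 he; have mK := measurable_coset k c.
have ti (r : R) : theta.-integrable (coset k c) (EFin \o (cst r : borel Q2 -> R)).
  apply: (@measurable_bounded_integrable _ (borel Q2)) => //.
  - by rewrite haar_coset_vol ltry.
  - exact: bounded_cst.
have hi : theta.-integrable (coset k c) (EFin \o (h : borel Q2 -> R)).
  by apply: integrableS (tame_integrable th).
have -> : Rint h = \int[theta]_(x in coset k c) h x.
  rewrite [RHS]Rintegral_mkcond; congr Rintegral; apply/funext => x.
  rewrite /patch; case: ifPn => // /negP nx; rewrite h0// => ?.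
  by apply: nx; exact/mem_set.
have vE r : \int[theta]_(x in coset k c) r = r * (unit_vol * 2 ^ k).
  by rewrite (Rintegral_cst theta mK) haar_coset_vol.
rewrite ler_norml lerBrDr lerBlDr -!mulNr -!mulrDl -!vE; apply/andP; split.
  apply: le_Rintegral => //; first exact: ti.
  by move=> x /he; rewrite ler_norml => /andP[+ _]; lra.
apply: le_Rintegral => //; first exact: ti.
by move=> x /he; rewrite ler_norml => /andP[_]; lra.
Qed.

Definition tameC (f : Q2 -> Cx R) :=
  tame (fun x => complex.Re (f x)) /\ tame (fun x => complex.Im (f x)).

Local Notation Cint f := (Cintegral theta f).

Lemma tameC0 : tameC (fun=> 0).
Proof. by split; exact: tame0. Qed.

Lemma tameCD f g : tameC f -> tameC g -> tameC (fun x => f x + g x).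
Proof.
have E (u v : R[i]) : complex.Re (u + v) = complex.Re u + complex.Re v /\
  complex.Im (u + v) = complex.Im u + complex.Im v by case: u v => [? ?] [? ?].
move=> [f1 f2] [g1 g2]; split.
  by under eq_fun do rewrite (E _ _).1; exact: tameD.
by under eq_fun do rewrite (E _ _).2; exact: tameD.
Qed.

Let ReZ (u v : R[i]) :
  complex.Re (u * v) = complex.Re u * complex.Re v + (- complex.Im u) * complex.Im v.
Proof. by case: u v => [? ?] [? ?] /=; rewrite mulNr. Qed.

Let ImZ (u v : R[i]) :
  complex.Im (u * v) = complex.Re u * complex.Im v + complex.Im u * complex.Re v.
Proof. by case: u v => [? ?] [? ?] /=; rewrite mulrC. Qed.

Lemma CintD f g : tameC f -> tameC g -> Cint (fun x => f x + g x) = Cint f + Cint g.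
Proof.
move=> [f1 f2] [g1 g2]; rewrite /Cintegral; apply/eqP; rewrite eq_complex /=.
rewrite -!RintD// /Rintegral; apply/andP; split; apply/eqP.
  by congr fine; apply: eq_integral => x _; case: (f x) (g x) => [? ?] [? ?].
by congr fine; apply: eq_integral => x _; case: (f x) (g x) => [? ?] [? ?].
Qed.

Lemma CintZ c f : tameC f -> Cint (fun x => c * f x) = c * Cint f.
Proof.
move=> [f1 f2]; rewrite /Cintegral; apply/eqP; rewrite eq_complex ReZ ImZ /=.
rewrite -!RintZ// -!RintD; try exact: tameZ.
rewrite /Rintegral; apply/andP; split; apply/eqP.
  by congr fine; apply: eq_integral => x _; rewrite ReZ.
by congr fine; apply: eq_integral => x _; rewrite ImZ.
Qed.

Lemma Cint0 : Cint (fun=> 0) = 0.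
Proof. by rewrite -[fun=> 0](_ : (fun=> 0 * 0) = _) ?CintZ ?mul0r//; exact: tameC0. Qed.

Lemma tameC_sum n (F : 'I_n -> Q2 -> Cx R) :
  (forall i, tameC (F i)) -> tameC (fun x => \sum_(i < n) F i x).
Proof.
elim: n F => [|n IH] F tF.
  by under eq_fun do rewrite big_ord0; exact: tameC0.
under eq_fun do rewrite big_ord_recr.
by apply: tameCD => //; exact: IH.
Qed.

Lemma Cint_sum n (F : 'I_n -> Q2 -> Cx R) :
  (forall i, tameC (F i)) ->
  Cint (fun x => \sum_(i < n) F i x) = \sum_(i < n) Cint (F i).
Proof.
elim: n F => [|n IH] F tF.
  by under eq_fun do rewrite big_ord0; rewrite big_ord0 Cint0.
under eq_fun do rewrite big_ord_recr.
rewrite CintD// ?IH// ?big_ord_recr//.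
exact: tameC_sum.
Qed.

Definition cut (A : set Q2) (f : Q2 -> Cx R) : Q2 -> Cx R :=
  fun x => if x \in A then f x else 0.

Lemma tameC_cut A f : measurable (A : set (borel Q2)) -> tameC f -> tameC (cut A f).
Proof.
move=> mA [f1 f2]; split; rewrite /cut.
  rewrite (_ : (fun _ => _) = (fun x => complex.Re (f x) * \1_A x)).
    exact: tame_indic.
  by apply/funext => x; rewrite indicE; case: (_ \in _); rewrite ?mulr1 ?mulr0.
rewrite (_ : (fun _ => _) = (fun x => complex.Im (f x) * \1_A x)).
  exact: tame_indic.
by apply/funext => x; rewrite indicE; case: (_ \in _); rewrite ?mulr1 ?mulr0.
Qed.

Lemma normc_le_ReIm (z : R[i]) : normc z <= `|complex.Re z| + `|complex.Im z|.
Proof.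
case: z => a b /=; rewrite -(ler_sqr) ?nnegrE ?addr_ge0 ?sqrtr_ge0//.
rewrite sqr_sqrtr ?addr_ge0 ?sqr_ge0// sqrrD !real_normK ?num_real//.
by have := mulr_ge0 (normr_ge0 a) (normr_ge0 b); lra.
Qed.

Lemma Re_le_normc (z : R[i]) : `|complex.Re z| <= normc z.
Proof.
case: z => a b /=; rewrite -(ler_sqr) ?nnegrE ?sqrtr_ge0//.
by rewrite sqr_sqrtr ?addr_ge0 ?sqr_ge0// real_normK ?num_real// lerDl sqr_ge0.
Qed.

Lemma Im_le_normc (z : R[i]) : `|complex.Im z| <= normc z.
Proof.
case: z => a b /=; rewrite -(ler_sqr) ?nnegrE ?sqrtr_ge0//.
by rewrite sqr_sqrtr ?addr_ge0 ?sqr_ge0// real_normK ?num_real// lerDr sqr_ge0.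
Qed.

(** The factor 2 comes from estimating real and imaginary parts separately. *)
Lemma Cint_coset f k c z e : tameC f -> (forall x, ~ coset k c x -> f x = 0) ->
  (forall x, coset k c x -> normc (f x - z) <= e) ->
  normc (Cint f - z * (unit_vol * 2 ^ k)%:C%C) <= (e * 2) * (unit_vol * 2 ^ k).
Proof.
move=> [f1 f2] f0 fe; rewrite (le_trans (normc_le_ReIm _))//.
have ReB (u v : R[i]) : complex.Re (u - v) = complex.Re u - complex.Re v by case: u v => [? ?] [? ?].
have ImB (u v : R[i]) : complex.Im (u - v) = complex.Im u - complex.Im v by case: u v => [? ?] [? ?].
rewrite ReB ImB ReZ ImZ /= !mulr0 add0r addr0 mulr_natr mulr2n mulrDl.
rewrite lerD//.
  apply: (@Rint_coset _ k c) => // x; first by move=> /f0 ->.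
  by move=> /fe; apply: le_trans; rewrite -ReB; exact: Re_le_normc.
apply: (@Rint_coset _ k c) => // x; first by move=> /f0 ->.
by move=> /fe; apply: le_trans; rewrite -ImB; exact: Im_le_normc.
Qed.

End haar.

(** * Continuous functions with compact support on Q_2 *)

Section continuity.
Variable R : realType.
Implicit Types f : Q2 -> Cx R.

Lemma normC_real (z : Cx R) : `|z| = ((normc z)%:C)%C.
Proof. by case: z => a b; rewrite normc_def. Qed.

Lemma normc_ge0 (z : R[i]) : 0 <= normc z.
Proof. by case: z => a b; exact: sqrtr_ge0. Qed.

Lemma continuousCP f :
  continuous f <-> (forall x (e : R), 0 < e ->
    exists l : nat, forall y, Bz (- l%:Z) (y - x) -> normc (f y - f x) < e).
Proof.
split=> [cf x e e0|H x].
  have := (@cvgrPdist_lt _ _ _ (nbhs x) (nbhs_filter x) f (f x)).1 (cf x) (e%:C)%C.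
  rewrite ltcR => /(_ e0) /nbhs_Q2[l H]; exists l => y /H /=; rewrite normC_real ltcR.
  by rewrite -normcN opprB.
apply/(@cvgrPdist_lt _ _ _ (nbhs x) (nbhs_filter x)) => e e0; have [_ er] : 0 < complex.Re e /\ e = ((complex.Re e)%:C)%C.
  by move: e0; case: e => a b; rewrite ltcE /= => /andP[/eqP -> ?].
move: e0; rewrite er ltcR => e0; have [l lH] := H x _ e0.
apply/nbhs_Q2; exists l => y /lH; rewrite -er normC_real -normcN opprB.
by rewrite er /= ltcR.
Qed.

Lemma unif_continuousC f (K : set Q2) (e : R) : continuous f -> compact K -> 0 < e ->
  exists l : nat, forall x y, K x -> Bz (- l%:Z) (x - y) -> normc (f x - f y) < e.
Proof.
move=> /continuousCP cf cK e0; have e20 : 0 < e / 2 by rewrite divr_gt0.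
have /(choice (P := fun x l => forall y, Bz (- l%:Z) (y - x) -> normc (f y - f x) < e / 2)) [l lP] :=
  fun x => cf x _ e20.
move: cK; rewrite compact_cover => /(_ Q2 setT (fun c => coset (- (l c)%:Z) c)).
case=> [c _|x _|D _ KD]; first exact: open_coset.
  by exists x => //; rewrite /coset/= subrr; exact: Bz0.
exists (\max_(c <- D) l c)%N => x y /KD[c /= cD xc] xy.
have yc : Bz (- (l c)%:Z) (y - c).
  apply: Bz_trans xc; apply/BzC; apply: Bz_le xy.
  by rewrite lerN2 lez_nat (@leq_bigmax_seq _ _ xpredT l).
rewrite (splitr e) -(subrKA (f c)); apply: le_lt_trans (le_normcD _ _) _.
by rewrite ltrD ?(lP c x)// -normcN opprB (lP c y).
Qed.

Lemma unif_continuousC_supp f (j : nat) (e : R) : continuous f ->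
  (forall x, ~ Bz j x -> f x = 0) -> 0 < e ->
  exists L : nat, forall l, (L <= l)%N -> forall x y, Bz (- l%:Z) (x - y) -> normc (f x - f y) < e.
Proof.
move=> cf f0 e0; have [L LP] := unif_continuousC cf (@compact_Bz j) e0.
exists L => l Ll x y xy; have [jx|njx] := pselect (Bz j x).
  by apply: LP => //; apply: Bz_le xy; lia.
have njy : ~ Bz j y.
  move=> jy; apply: njx; rewrite -(subrK y x); apply: BzD => //.
  by apply: Bz_le xy; lia.
by rewrite !f0// subrr normc0.
Qed.

Lemma continuousC_bounded f (j : nat) : continuous f ->
  (forall x, ~ Bz j x -> f x = 0) -> exists M : R, forall x, normc (f x) <= M.
Proof.
move=> cf f0; have [L /(_ L (leqnn _)) LP] := unif_continuousC_supp cf f0 (ltr01 : 0 < (1 : R)).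
pose g i := normc (f (grid j i)).
exists (1 + \sum_(i < 2 ^ (j + L)) g i) => x.
have [jx|njx] := pselect (Bz j x); last first.
  by rewrite f0// normc0 addr_ge0// sumr_ge0// => i _; exact: normc_ge0.
have [i il xi] := @Bz_cover j (j + L)%N x jx.
rewrite -(subrK (f (grid j i)) (f x)); apply: le_trans (le_normcD _ _) _.
rewrite lerD//.
  by apply/ltW/LP; apply: Bz_le xi; lia.
rewrite (bigD1 (Ordinal il))//= lerDl sumr_ge0// => k _; exact: normc_ge0.
Qed.

Lemma Re_sub (u v : R[i]) : complex.Re (u - v) = complex.Re u - complex.Re v.
Proof. by case: u v => [? ?] [? ?]. Qed.

Lemma Im_sub (u v : R[i]) : complex.Im (u - v) = complex.Im u - complex.Im v.
Proof. by case: u v => [? ?] [? ?]. Qed.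

Lemma measurable_Q2_continuous (h : Q2 -> R) :
  (forall x (e : R), 0 < e -> exists l : nat, forall y, Bz (- l%:Z) (y - x) -> `|h y - h x| < e) ->
  measurable_fun [set: borel Q2] h.
Proof.
move=> H; apply: (measurability _ (RGenOInfty.measurableE R)) => //.
move=> /= _ [_ [a ->] <-]; rewrite setTI; apply: sub_sigma_algebra.
apply: open_Q2 => x /=; rewrite in_itv/= andbT => ax.
have d0 : 0 < h x - a by rewrite subr_gt0.
have [l lP] := H x _ d0; exists l => y /lP; rewrite in_itv/= andbT ltr_norml => /andP[+ _].
by lra.
Qed.

Lemma tameC_continuous f (j : nat) : continuous f ->
  (forall x, ~ Bz j x -> f x = 0) -> tameC f.
Proof.
move=> cf f0; have [M fM] := continuousC_bounded cf f0.
have {}cf := (continuousCP f).1 cf.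
split; split.
- apply: measurable_Q2_continuous => x e /(cf x)[l lP]; exists l => y /lP.
  by rewrite -Re_sub; apply: le_lt_trans; exact: Re_le_normc.
- by exists M => x; rewrite (le_trans (Re_le_normc _)).
- by exists j => x /f0 ->.
- apply: measurable_Q2_continuous => x e /(cf x)[l lP]; exists l => y /lP.
  by rewrite -Im_sub; apply: le_lt_trans; exact: Im_le_normc.
- by exists M => x; rewrite (le_trans (Im_le_normc _)).
- by exists j => x /f0 ->.
Qed.

Lemma Cc_support f : Cc f -> exists j : nat, forall x, ~ Bz j x -> f x = 0.
Proof.
move=> [_ /compact_sub_Bz[j fj]]; exists j => x njx; apply/eqP; apply: contraT => fx.
by exfalso; apply/njx/fj/subset_closure.
Qed.

End continuity.

(** * Summation of sinc^2 weights over the dyadic numbers *)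

Section window.
Variable R : realType.
Local Notation rr := (ratr : rat -> R).

Lemma big_ord_twice (V : nmodType) (F : nat -> V) n :
  \sum_(i < n + n) F i = \sum_(i < n) F i + \sum_(i < n) F (i + n)%N.
Proof.
rewrite big_split_ord /=; congr (_ + _).
by apply: eq_bigr => i _; rewrite addnC.
Qed.

Variables (j : nat) (phi : rat -> R).
Hypothesis phi_per : forall w, phi (w + 2 ^+ j) = phi w.
Hypothesis phi_ge0 : forall w, 0 <= phi w.

Lemma periodic_expn M w : (j <= M)%N -> phi (w + 2 ^+ M) = phi w.
Proof.
move=> jM; have -> : (2 : rat) ^+ M = 2 ^+ j *+ (2 ^ (M - j)).
  by rewrite -[RHS]mulr_natr natrX -exprD subnKC.
elim: (2 ^ (M - j))%N w => [|n IH] w; first by rewrite mulr0n addr0.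
by rewrite mulrS addrA IH phi_per.
Qed.

(** The sum over one period [0, 2^M) of the kernel, with spacing 2^-l. It stands in for the infinite
    sum of sinc^2 times [phi] over 2^-l Z. *)
Definition fejer_sum (l M : nat) : R :=
  \sum_(i < 2 ^ (l + M)) fejer M (rr (i%:R / 2 ^+ l)) * phi (i%:R / 2 ^+ l).

(** The points w and w + 2^M share the value of [phi], which is 2^M-periodic for [M >= j], and their
    kernel values add up to the kernel of level [M] by [fejer_split]. *)
Lemma fejer_sum_step l M : (j <= M)%N -> fejer_sum l M.+1 = fejer_sum l M.
Proof.
move=> jM; rewrite /fejer_sum addnS expnS mul2n -addnn.
rewrite (big_ord_twice (fun i => fejer M.+1 (rr (i%:R / 2 ^+ l)) * phi (i%:R / 2 ^+ l))).
rewrite -big_split; apply: eq_bigr => i _ /=.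
have -> : (i + 2 ^ (l + M))%:R / 2 ^+ l = i%:R / 2 ^+ l + 2 ^+ M :> rat.
  by rewrite natrD natrX exprD; field; rewrite expf_neq0.
rewrite periodic_expn// -mulrDl; congr (_ * _).
by rewrite rmorphD /= rmorphXn /= rmorph_nat fejer_split.
Qed.

Lemma fejer_sumE l M : (j <= M)%N -> fejer_sum l M = fejer_sum l j.
Proof.
move=> jM; rewrite -(subnKC jM); elim: (M - j)%N => [|n IH]; first by rewrite addn0.
by rewrite addnS fejer_sum_step ?leq_addr.
Qed.

(** A grid of spacing 2^-l on the centred interval [-2^M, 2^M): the kernel of level [M.+1] has
    exactly this period, and [fejer_sinc2] applies on it. With [M = 0] it also lists the possible
    atoms of the autocorrelation in [Bz l]. *)
Definition window (l M : nat) (i : nat) : rat := (i%:R - (2 ^ (l + M))%:R) / 2 ^+ l.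

Lemma fejer_sum_window l M : (j <= M.+1)%N ->
  \sum_(i < 2 ^ (l + M.+1)) fejer M.+1 (rr (window l M i)) * phi (window l M i) =
  fejer_sum l M.+1.
Proof.
move=> jM; rewrite /fejer_sum addnS expnS mul2n -addnn.
pose F w := fejer M.+1 (rr w) * phi w.
rewrite (big_ord_twice (fun i => F (window l M i))) (big_ord_twice (fun i => F (i%:R / 2 ^+ l))).
rewrite addrC; congr (_ + _); apply: eq_bigr => i _.
  by rewrite /window natrD addrK.
rewrite -[LHS]/(F _) /F.
have -> : (i + 2 ^ (l + M))%:R / 2 ^+ l = window l M i + 2 ^+ M.+1 :> rat.
  by rewrite /window natrD natrX exprD exprS; field; rewrite expf_neq0.
by rewrite periodic_expn// rmorphD /= rmorphXn /= rmorph_nat fejer_periodic.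
Qed.

Lemma window_norm l M i : (i < 2 ^ (l + M.+1))%N -> `|rr (window l M i)| <= 2 ^+ M.+1 / 2.
Proof.
move=> il; have l0 : 0 < (2 : R) ^+ l by rewrite exprn_gt0.
rewrite /window rmorphM /= fmorphV rmorphXn rmorphB /= !rmorph_nat.
rewrite normrM normfV (gtr0_norm l0) ler_pdivrMr//.
have -> : (2 : R) ^+ M.+1 / 2 = 2 ^+ M by rewrite exprS; field.
rewrite -exprD [(M + l)%N]addnC -natrX ler_norml lerBlDr lerBrDr addNr ler0n /=.
by rewrite -natrD ler_nat addnn -mul2n -expnS -addnS ltnW.
Qed.

Lemma window_inj l M : injective (window l M).
Proof.
move=> i k /eqP; rewrite /window (inj_eq (mulIf _)) ?invr_neq0 ?expf_neq0//.
by rewrite (inj_eq (addIr _)) eqr_nat => /eqP.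
Qed.

Lemma window_dyadic l M i : dyadic (window l M i).
Proof. by exists (i%:Z - (2 ^ (l + M))%N%:Z), l; rewrite /window !pmulrn -intrB. Qed.

Lemma window_cover l M w : w * 2 ^+ l \is a Num.int -> `|w| < 2 ^+ M ->
  exists2 i, (i < 2 ^ (l + M.+1))%N & w = window l M i.
Proof.
move=> /intrP[m wm] wM; have l0 : 0 < (2 : rat) ^+ l by rewrite exprn_gt0.
have wE : w = m%:~R / 2 ^+ l by rewrite -wm mulfK ?gt_eqF.
have mM : `|m| < (2 ^ (l + M))%N%:Z.
  rewrite -(@ltr_int rat) intr_norm -wm normrM (gtr0_norm l0) -pmulrn natrX exprD mulrC.
  by rewrite ltr_pM2l.
exists `|(m + (2 ^ (l + M))%N%:Z)%R|%N.
  by rewrite addnS expnS mul2n -addnn; lia.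
rewrite wE /window; congr (_ / _); rewrite !pmulrn gez0_abs -?intrB ?addrK//.
by lia.
Qed.

(** All of [rat] serves as the countable index type of the atoms; other rationals get weight 0. *)
Definition dyadic_weight (w : rat) : R := if w \in dyadic then sinc2 (rr w) else 0.

Lemma dyadic_weight_ge0 w : 0 <= dyadic_weight w.
Proof. by rewrite /dyadic_weight; case: ifP => // _; exact: sinc2_ge0. Qed.

(** For [M] large the window contains every dyadic element of [X], and there sinc^2 is bounded by
    the kernel; the resulting sum does not depend on [M]. *)
Lemma fsum_dyadic_le_level (X : set rat) l : finite_set X ->
  (forall w, X w -> dyadic w -> w * 2 ^+ l \is a Num.int) ->
  \sum_(w \in X) dyadic_weight w * phi w <= fejer_sum l j.
Proof.
move=> finX Xl; pose Y := [seq w <- fset_set X | w \in dyadic].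
have [M0 M0P] : exists M, forall w, w \in Y -> `|w| < 2 ^+ M.
  exists (\max_(w <- Y) Num.bound `|w|)%N => w wY; apply: upper_nthrootP.
  exact: (@leq_bigmax_seq _ _ xpredT (fun w : rat => Num.bound `|w|)).
pose M := maxn M0 j.
have jM : (j <= M.+1)%N by rewrite leqW ?leq_maxr.
rewrite -(fejer_sumE l jM) -fejer_sum_window//.
pose W := [seq window l M i | i <- iota 0 (2 ^ (l + M.+1))].
have YW : {subset Y <= W}.
  move=> w wY; have [||i il ->] := @window_cover l M w.
  - by move: wY; rewrite mem_filter in_fset_set// => /andP[/set_mem ? /set_mem ?]; exact: Xl.
  - by apply: lt_le_trans (M0P _ wY) _; rewrite ler_eXn2l// leq_maxl.
  - by apply: map_f; rewrite mem_iota.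
apply: (@le_trans _ _ (\sum_(w <- Y) dyadic_weight w * phi w)).
  rewrite fsbig_finite//= big_filter [leRHS]big_mkcond /=; apply: ler_sum => w _.
  by rewrite /dyadic_weight; case: ifP; rewrite ?mul0r.
apply: (@le_trans _ _ (\sum_(w <- W) dyadic_weight w * phi w)).
  have uY : uniq Y by rewrite filter_uniq ?fset_uniq.
  have uW : uniq W by rewrite map_inj_uniq ?iota_uniq//; exact: window_inj.
  rewrite [leRHS](bigID (mem Y)) /= -[leLHS]addr0 lerD//; last first.
    by rewrite sumr_ge0// => w _; rewrite mulr_ge0 ?dyadic_weight_ge0.
  rewrite -[leRHS]big_filter [leRHS](perm_big Y) ?lexx//.
  apply: uniq_perm => [||w] //; first by rewrite filter_uniq.
  by rewrite mem_filter; case: (boolP (w \in Y)) => //= /YW.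
rewrite big_map -{1}[(2 ^ (l + M.+1))%N]subn0 -/(index_iota 0 (2 ^ (l + M.+1))) big_mkord.
apply: ler_sum => i _; rewrite ler_wpM2r//.
rewrite /dyadic_weight mem_set; last exact: window_dyadic.
by rewrite -subr_ge0; have /andP[] := fejer_sinc2 (window_norm (ltn_ord i)).
Qed.

Lemma fsum_dyadic_le (X : set rat) : finite_set X -> exists L, forall l, (L <= l)%N ->
  \sum_(w \in X) dyadic_weight w * phi w <= fejer_sum l j.
Proof.
move=> finX.
have H (w : rat) : exists n : nat, dyadic w -> forall l, (n <= l)%N -> w * 2 ^+ l \is a Num.int.
  have [[m [n ->]]|] := pselect (dyadic w); last by exists 0%N.
  exists n => _ l nl; rewrite -(subnKC nl) exprD mulrA divfK ?expf_neq0//.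
  by rewrite rpredM ?intr_int// rpredX.
have [n nP] := choice H; exists (\max_(w <- fset_set X) n w)%N => l lL.
apply: fsum_dyadic_le_level => // w Xw dw; apply: nP => //.
rewrite (leq_trans _ lL)// (@leq_bigmax_seq _ _ xpredT n)// in_fset_set//.
exact/mem_set.
Qed.

(** There are 2^(l+M+1) terms, and replacing the kernel by sinc^2 costs at most c / 4^(M+1) in
    each. *)
Lemma fejer_sum_le_window (c : R) l M : (j <= M.+1)%N -> (forall w, phi w <= c) ->
  fejer_sum l j <= \sum_(i < 2 ^ (l + M.+1)) dyadic_weight (window l M i) * phi (window l M i)
     + c * 2 ^+ l / 2 ^+ M.+1.
Proof.
move=> jM phic; rewrite -(fejer_sumE l jM) -fejer_sum_window// -lerBlDl -sumrB.
apply: (@le_trans _ _ (\sum_(i < 2 ^ (l + M.+1)) (c / 4 ^+ M.+1))).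
  apply: ler_sum => i _; rewrite -mulrBl mulrC.
  have /andP[h1 h2] := fejer_sinc2 (window_norm (ltn_ord i)).
  rewrite /dyadic_weight mem_set; last exact: window_dyadic.
  by apply: ler_pM.
rewrite sumr_const card_ord -[leLHS]mulr_natr natrX exprD.
have -> : (4 : R) ^+ M.+1 = 2 ^+ M.+1 * 2 ^+ M.+1 by rewrite -exprMn; congr (_ ^+ _); ring.
rewrite le_eqVlt; apply/orP; left; apply/eqP.
by field; rewrite expf_neq0.
Qed.

(** Finite sums stay below [fejer_sum l j] for all large [l], hence below [v]. Conversely, for one
    fixed fine spacing the sums over growing windows come arbitrarily close to [fejer_sum l j]. *)
Lemma esum_dyadic_weight (c v : R) : (forall w, phi w <= c) ->
  (forall e, 0 < e -> exists L, forall l, (L <= l)%N -> `|fejer_sum l j - v| <= e) ->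
  \esum_(w in [set: rat]) ((dyadic_weight w)%:E * (phi w)%:E)%E = v%:E.
Proof.
move=> phic lim; apply/eqP; rewrite eq_le; apply/andP; split.
  apply: ge_ereal_sup => _ [X [finX _] <-].
  rewrite fsumEFin// lee_fin; apply/ler_addgt0Pr => e /lim[L LP].
  have [L' L'P] := fsum_dyadic_le finX.
  have := L'P (maxn L L') (leq_maxr _ _); have := LP (maxn L L') (leq_maxl _ _).
  by rewrite ler_norml => /andP[_]; lra.
apply/lee_addgt0Pr => e e0; have e20 : 0 < e / 2 by rewrite divr_gt0.
have [L /(_ L (leqnn _)) LP] := lim _ e20.
(* Chosen such that 2^(M+1) exceeds 2 c 2^L / e, which brings the error of [fejer_sum_le_window]
   below e / 2. *)
pose M := maxn j (Num.bound (c * 2 ^+ L / (e / 2))).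
have jM : (j <= M.+1)%N by rewrite leqW ?leq_maxl.
have h : c * 2 ^+ L / 2 ^+ M.+1 <= e / 2.
  rewrite ler_pdivrMr ?exprn_gt0// [leRHS]mulrC -ler_pdivrMr//.
  by apply/ltW/upper_nthrootP; rewrite leqW ?leq_maxr.
have := fejer_sum_le_window L jM phic; set S := (\sum_(i < _) _) => FS.
apply: (@le_trans _ _ (S + e)%:E).
  by rewrite lee_fin; move: LP; rewrite ler_norml => /andP[+ _]; lra.
rewrite EFinD leeD2r//; apply: esum_ge.
exists (window L M @` `I_(2 ^ (L + M.+1))); first by split => //; exact: finite_image.
have -> : (\sum_(w \in window L M @` `I_(2 ^ (L + M.+1))) (dyadic_weight w)%:E * (phi w)%:E =
    \sum_(i \in `I_(2 ^ (L + M.+1))) (dyadic_weight (window L M i))%:E * (phi (window L M i))%:E)%E.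
  by apply: fsbig_image => i k _ _; exact: window_inj.
rewrite -fsbig_ord /S -sumEFin; apply: lee_sum => i _; rewrite EFinM; exact: lexx.
Qed.

End window.

Lemma int_expn_le (w : rat) (l m : nat) : (l <= m)%N ->
  w * 2 ^+ l \is a Num.int -> w * 2 ^+ m \is a Num.int.
Proof.
by move=> lm wl; rewrite -(subnKC lm) exprD mulrA rpredM// rpredX.
Qed.

Lemma dyadic_level (w : rat) : dyadic w -> exists l : nat, w * 2 ^+ l \is a Num.int.
Proof. by move=> [m [n ->]]; exists n; rewrite divfK ?expf_neq0// intr_int. Qed.

(** * Characters *)

Section characters.
Variable R : realType.
Local Notation rr := (ratr : rat -> R).

Lemma ratr_is_int (w : rat) : (rr w \is a Num.int) = (w \is a Num.int).
Proof.
apply/idP/idP => /intrP[m E]; last by rewrite E ratr_int intr_int.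
have -> : w = m%:~R by apply: (@fmorph_inj _ _ (@ratr R)); rewrite /= E ratr_int.
exact: intr_int.
Qed.

(** Makes [chi w] a character for every rational [w]: a non-dyadic [w] yields the trivial character,
    which its weight 0 renders harmless. *)
Definition dyadic_or0 (w : rat) : rat := if w \in dyadic then w else 0.

Lemma dyadic_or0P w : dyadic (dyadic_or0 w).
Proof. by rewrite /dyadic_or0; case: ifP => [/set_mem//|_]; exact: (dyadic_int 0). Qed.

Definition level (w : rat) : nat := xget 0%N [set l : nat | w * 2 ^+ l \is a Num.int].

Lemma levelP w : dyadic w -> w * 2 ^+ level w \is a Num.int.
Proof.
by move=> /dyadic_level; exact: (@xgetPex _ 0%N [set l : nat | w * 2 ^+ l \is a Num.int]).
Qed.

Definition approx (l : nat) (x : Q2) : rat :=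
  xget 0 [set d | dyadic d /\ Bz (- l%:Z) (x - Q2_of_rat d)].

Lemma approxP l x : dyadic (approx l x) /\ Bz (- l%:Z) (x - Q2_of_rat (approx l x)).
Proof.
have [d dd xd] := Q2_dyadic_dense (- l%:Z) x.
by apply: (@xgetPex _ 0 [set d | dyadic d /\ Bz (- l%:Z) (x - Q2_of_rat d)]); exists d.
Qed.

(* [x |-> exp (2 i pi w x)]: only the class of [w x] modulo 2-adic integers
   matters, so [x] may be replaced by a dyadic approximation. *)
Definition chi (w : rat) (x : Q2) : Cx R :=
  ee (rr (dyadic_or0 w * approx (level (dyadic_or0 w)) x)).

(** Two approximations of [x] differ by an element of the smaller-precision ball [Bz (- m)], [m]
    being the minimum of the two levels. Since w 2^m is an integer, [w] times the difference is an
    integer and the exponential is unchanged. *)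
Lemma chiE w l d x : dyadic w -> w * 2 ^+ l \is a Num.int -> dyadic d ->
  Bz (- l%:Z) (x - Q2_of_rat d) -> chi w x = ee (rr (w * d)).
Proof.
move=> dw wl dd xd; rewrite /chi /dyadic_or0 mem_set//.
have [da xa] := approxP (level w) x; have wl' := levelP dw.
apply: eeDint; rewrite -rmorphB /= ratr_is_int -mulrBr.
pose m := minn l (level w).
have wm : w * 2 ^+ m \is a Num.int by rewrite /m; case: leqP.
have : Bz (- m%:Z) (Q2_of_rat (approx (level w) x - d)).
  rewrite Q2_of_ratB; apply: (@Bz_trans _ x).
    by apply/BzC; apply: Bz_le xa; rewrite lerN2 lez_nat geq_minr.
  by apply: Bz_le xd; rewrite lerN2 lez_nat geq_minl.
move=> /Bz_dyadic-/(_ (dyadicB da dd)); rewrite -exprnN => h.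
rewrite [X in X \is a _](_ : _ = (w * 2 ^+ m) * ((approx (level w) x - d) * 2 ^- m)).
  by rewrite rpredM.
by rewrite mulrACA divff ?expf_neq0// mulr1.
Qed.

Lemma chi_dyadic_or0 w : chi w = chi (dyadic_or0 w).
Proof. by rewrite /chi [in RHS]/dyadic_or0 mem_set//; exact: dyadic_or0P. Qed.

Lemma chi_coset w l x y : dyadic w -> w * 2 ^+ l \is a Num.int ->
  Bz (- l%:Z) (y - x) -> chi w y = chi w x.
Proof.
move=> dw wl yx; have [da xa] := approxP l x.
rewrite (chiE dw wl da xa) (chiE dw wl da)//.
exact: Bz_trans yx xa.
Qed.

Lemma chi_character w : chi w \in @characters R.
Proof.
rewrite chi_dyadic_or0; have := dyadic_or0P w; move: (dyadic_or0 w) => {}w dw.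
have wl := levelP dw; apply/mem_set; split.
- apply/continuousCP => x e e0; exists (level w) => y /(chi_coset dw wl) ->.
  by rewrite subrr normc0.
- move=> x y; have [da xa] := approxP (level w) x; have [db yb] := approxP (level w) y.
  move: (level w) wl (approx _ x) da xa (approx _ y) db yb => l wl a da xa b db yb.
  rewrite (chiE dw wl da xa) (chiE dw wl db yb) -eeD -rmorphD -mulrDr.
  apply: (chiE dw wl (dyadicD da db)).
  by rewrite Q2_of_ratD opprD addrACA; exact: BzD.
- by move=> x; rewrite norm_ee.
Qed.

Definition chiD (w : rat) : dualQ2 R :=
  exist (fun h => h \in @characters R) (chi w) (chi_character w).

(** If [y] were not an integer, some 2^m y would be a half-integer, where the exponential is -1. The
    induction doubles [y], a step under which the hypothesis is stable. *)
Lemma ee_doubling (n : nat) (y : rat) : y * 2 ^+ n \is a Num.int ->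
  (forall m : nat, 0 < complex.Re (ee (rr (y * 2 ^+ m)))) -> y \is a Num.int.
Proof.
elim: n y => [y|n IH y]; first by rewrite expr0 mulr1.
rewrite exprS mulrA => /IH H ey.
have /intrP[m ym] : y * 2 \is a Num.int.
  by apply: H => m; rewrite -mulrA -exprS.
have [k mk] : exists k : int, m = k * 2 \/ m = k * 2 + 1.
  exists (m %/ 2)%Z; have := divz_eq m 2; have := modz_ge0 m (isT : 2 != 0 :> int).
  by have := ltz_pmod m (isT : 0 < 2 :> int); lia.
case: mk => mk; have {}ym : y = m%:~R / 2 by rewrite -ym mulfK.
  by rewrite ym mk intrM mulfK// intr_int.
have := ey 0%N; rewrite expr0 mulr1.
have -> : y = k%:~R + 1 / 2 by rewrite ym mk intrD intrM mulrDl mulfK.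
have -> : ee (rr (k%:~R + 1 / 2)) = - 1.
  have E : rr (1 / 2) = 1 / 2 by rewrite rmorphM /= rmorph1 fmorphV /= rmorph_nat.
  by rewrite rmorphD /= ratr_int E eeD ee_int mul1r ee_half.
by rewrite /=; lra.
Qed.

Local Notation dual := (dualQ2 R).

Lemma open_dual (K : set Q2) (O : set (Cx R)) : compact K -> open O ->
  open [set h : dual | forall x, K x -> O ((val h : Q2 -> Cx R) x)].
Proof.
move=> cK oO; exists [set g | g @` K `<=` O]; first exact: compact_open_open.
apply/seteqP; split => h /= H; first by move=> x Kx; apply: H; exists x.
by move=> _ [x Kx <-]; exact: H.
Qed.

Lemma open_gt0 : open [set z : Cx R | 0 < complex.Re z].
Proof.
rewrite openE => z /= z0; apply/nbhs_ballP; exists ((complex.Re z)%:C)%C => /=.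
  by rewrite ltcR.
move=> y; rewrite /ball /= => zy.
have : normc (z - y) < complex.Re z by rewrite -ltcR -normC_real.
by move=> /(le_lt_trans (Re_le_normc _)); rewrite Re_sub ltr_norml => /andP[_]; lra.
Qed.

Lemma open_neq (c : Cx R) : open [set z : Cx R | z <> c].
Proof.
rewrite openE => z /= zc; have zc0 : z - c != 0 by rewrite subr_eq0; exact/eqP.
apply/nbhs_ballP; exists `|z - c| => /=; first by rewrite normr_gt0.
by move=> y; rewrite /ball /= => + yc; rewrite yc ltxx.
Qed.

Lemma dual_T1 (h : dual) : closed [set h].
Proof.
rewrite -openC openE => g /= gh.
have [x gx] : exists x, (val g : Q2 -> Cx R) x <> (val h : Q2 -> Cx R) x.
  apply: contrapT => H; apply/gh/val_inj/funext => x.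
  by apply: contrapT => ?; apply: H; exists x.
have := open_dual (@compact_set1 _ x) (@open_neq ((val h : Q2 -> Cx R) x)).
move=> oU; apply: filterS (open_nbhs_nbhs (conj oU _)).
  by move=> k /= kx kh; apply: (kx x) => //; rewrite kh.
by move=> y /= ->.
Qed.

(** An increasing open exhaustion of the dual, playing the role of [U] in [atomic_is_radon].
    Positive real part on the subgroup [Bz (- k)] forces [chi w] to be trivial there, so only the
    atoms with [w] in 2^-k Z remain. *)
Definition dual_nbhd (k : nat) : set dual :=
  [set h : dual | forall x, Bz (- k%:Z) x -> 0 < complex.Re ((val h : Q2 -> Cx R) x)].

Lemma open_dual_nbhd k : open (dual_nbhd k).
Proof. exact: open_dual (@compact_Bz _) open_gt0. Qed.

Lemma dual_nbhd_le k l : (k <= l)%N -> dual_nbhd k `<=` dual_nbhd l.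
Proof.
by move=> kl h hk x xl; apply: hk; apply: Bz_le xl; rewrite lerN2 lez_nat.
Qed.

Lemma dual_nbhd_cover h : exists k, dual_nbhd k h.
Proof.
have /set_mem[/continuousCP ch hM hn] := valP h.
have h0 : (val h : Q2 -> Cx R) 0 = 1.
  have h00 : (val h : Q2 -> Cx R) 0 != 0 by rewrite -normr_gt0 hn.
  by apply: (mulfI h00); rewrite -hM addr0 mulr1.
have [l lP] := ch 0 1 ltr01; exists l => x xl.
have := lP x; rewrite subr0 h0 => /(_ xl) /(le_lt_trans (Re_le_normc _)).
by rewrite Re_sub ltr_norml /= => /andP[+ _]; lra.
Qed.

Lemma dual_nbhd_chi k w : dyadic w -> dual_nbhd k (chiD w) -> w * 2 ^+ k \is a Num.int.
Proof.
move=> dw kw; have [l wl] := dyadic_level dw.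
apply: (@ee_doubling l).
  by rewrite mulrAC rpredM// rpredX.
move=> m.
have d2 : dyadic (2 ^+ (k + m)) by exact: (dyadic_expz (k + m)%N).
have h : Bz (- k%:Z) (Q2_of_rat (2 ^+ (k + m))).
  apply/Bz_dyadic => //; rewrite -exprnN exprD mulrAC mulfV ?expf_neq0// mul1r.
  by rewrite rpredX.
have : 0 < complex.Re (chi w (Q2_of_rat (2 ^+ (k + m)))) by exact: kw.
rewrite (@chiE w l (2 ^+ (k + m)))//; last by rewrite subrr; exact: Bz0.
by rewrite exprD mulrA.
Qed.

End characters.

(** * Rearrangements of finite sums *)

Section double_sums.
Variable V : zmodType.

Lemma sum_triangle_le (G : nat -> V) n :
  \sum_(a < n) \sum_(k < a.+1) G k = \sum_(i < n) G i *+ (n - i).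
Proof.
elim: n => [|n IH]; first by rewrite !big_ord0.
rewrite big_ord_recr /= IH [in RHS]big_ord_recr /= subSnn mulr1n [in LHS]big_ord_recr /= addrA.
congr (_ + _); rewrite -big_split /=; apply: eq_bigr => i _.
by rewrite subSn ?mulrSr// ltnW.
Qed.

Lemma sum_triangle_lt (G : nat -> V) n :
  \sum_(a < n) \sum_(k < a) G k.+1 = \sum_(i < n) G i *+ (n - i) - G 0%N *+ n.
Proof.
rewrite -sum_triangle_le -[n in _ *+ n]card_ord -sumr_const -sumrB.
by apply: eq_bigr => a _; rewrite big_ord_recl addrC addKr.
Qed.

(** Each difference +i or -i arises from [n - i] pairs; the diagonal is counted in both sums and
    subtracted once. *)
Lemma sum_square_diff (G : int -> V) n :
  \sum_(a < n) \sum_(b < n) G (a%:Z - b%:Z) =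
  \sum_(i < n) G i%:Z *+ (n - i) + (\sum_(i < n) G (- i%:Z) *+ (n - i) - G 0 *+ n).
Proof.
have -> : G 0 = G (- (0%N%:Z)) by rewrite oppr0.
rewrite -(sum_triangle_le (fun i => G i%:Z)) -(sum_triangle_lt (fun i => G (- i%:Z))).
elim: n => [|n IH]; first by rewrite !big_ord0 addr0.
rewrite big_ord_recr /= (eq_bigr (fun a : 'I_n => \sum_(b < n) G (a%:Z - b%:Z) + G (a%:Z - n%:Z))); last first.
  by move=> a _; rewrite big_ord_recr.
rewrite big_split /= IH [X in _ = X + _]big_ord_recr [X in _ = _ + X]big_ord_recr /=.
have -> : \sum_(b < n.+1) G (n%:Z - b%:Z) = \sum_(k < n.+1) G k%:Z.
  rewrite [LHS](reindex_inj rev_ord_inj) /=; apply: eq_bigr => i _; congr G.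
  by have := ltn_ord i; lia.
have -> : \sum_(a < n) G (a%:Z - n%:Z) = \sum_(k < n) G (- k.+1%:Z).
  rewrite [LHS](reindex_inj rev_ord_inj) /=; apply: eq_bigr => i _; congr G.
  by have := ltn_ord i; lia.
by rewrite -addrA [X in _ + X]addrC addrACA.
Qed.

(** Substitute n - i for i. The left side is the shape of the negative half of a window, where the
    index [i] stands for the difference i - n with weight i. *)
Lemma sum_weighted_tail (K : int -> V) n :
  \sum_(i < n) K (i%:Z - n%:Z) *+ i = \sum_(i < n) K (- i%:Z) *+ (n - i) - K 0 *+ n.
Proof.
case: n => [|n]; first by rewrite !big_ord0 mulr0n subrr.
rewrite big_ord_recl mulr0n add0r [in RHS]big_ord_recl /= subn0 oppr0.
rewrite [in RHS]addrC addKr (reindex_inj rev_ord_inj) /=.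
apply: eq_bigr => i _; rewrite /bump /= !add1n subSS subnSK//.
by congr (K _ *+ _); have := ltn_ord i; lia.
Qed.

Lemma sum_cyclic (F : nat -> V) (Q a : nat) : (0 < Q)%N ->
  \sum_(i < Q) F ((i + a) %% Q)%N = \sum_(i < Q) F i.
Proof.
move=> Q0; pose h (i : 'I_Q) := Ordinal (ltn_pmod (i + a) Q0).
have hinj : injective h.
  move=> i k [] /eqP; rewrite eqn_modDr !modn_small// => /eqP; exact: val_inj.
by rewrite [RHS](reindex_inj hinj).
Qed.

End double_sums.

Lemma esum_finite_support (R : realType) (I : choiceType) (X : set I) (g : I -> R) :
  finite_set X -> (forall i, ~ X i -> g i = 0) -> (forall i, 0 <= g i) ->
  (\esum_(i in setT) (g i)%:E = (\sum_(i \in X) g i)%:E)%E.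
Proof.
move=> finX g0 gge; rewrite -fsumEFin// -esum_fset//; last by move=> i _; rewrite lee_fin.
rewrite [RHS]esum_mkcond; apply: eq_esum => i _; case: ifPn => // /negP iX.
by rewrite g0// => ?; apply: iX; exact/mem_set.
Qed.

(** * Autocorrelation and its Fourier transform *)

Section autocorrelation.
Variables (R : realType) (theta : {measure set (borel Q2) -> \bar R}).
Hypothesis htheta : haar theta.
Local Notation rr := (ratr : rat -> R).
Local Notation t0 := (unit_vol theta).

(** The divisor is the volume of Z_2: the set has one point per coset of Z_2, hence density 1 /
    t0. *)
Definition gamma_weight (t : rat) : R :=
  if t \in dyadic then Num.max 0 (1 - `|rr t|) / t0 else 0.

Lemma gamma_weight_ge0 t : 0 <= gamma_weight t.
Proof.
rewrite /gamma_weight; case: ifP => // _.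
by rewrite divr_ge0 ?le_max ?lexx// ltW// unit_vol_gt0.
Qed.

Definition gamma : {measure set (borel Q2) -> \bar R} :=
  atomic (fun t => NngNum (gamma_weight_ge0 t)) Q2_of_rat.

Lemma Q2_T1 (x : Q2) : closed [set x].
Proof.
have -> : [set x] = \bigcap_(l : nat) coset (- l%:Z) x.
  apply/seteqP; split => [_ -> l _|y H]; first by rewrite /coset/= subrr; exact: Bz0.
  apply/eqP; rewrite -subr_eq0; apply/eqP/absQ2_eq0/eqP; rewrite eq_le absQ2_ge0 andbT.
  apply/ler_addgt0Pr => e e0; rewrite add0r ltW//.
  apply: le_lt_trans (H (Num.bound e^-1) I) _.
  by rewrite -exprnN realalg.RealAlg.upper_nthrootVP.
by apply: closed_bigI => l _; exact: closed_coset.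
Qed.

Lemma gamma_support j t : Bz j%:Z (Q2_of_rat t) ->
  (forall i, (i < 2 ^ j.+1)%N -> t <> window j 0 i) -> gamma_weight t = 0.
Proof.
move=> tj tw; rewrite /gamma_weight; case: ifPn => // /set_mem dt.
have [t1|] := ltP (`|t|) (1 : rat).
  have tI : t * 2 ^+ j \is a Num.int by apply/(@Bz_dyadic j%:Z).
  have [||i il tE] := @window_cover j 0 t; rewrite ?expr0//.
  by exfalso; move: il tE; rewrite addn1 => /tw.
move=> t1; rewrite max_l ?mul0r// subr_le0 -ratr_norm.
by rewrite -[1](rmorph1 (@ratr R)) ler_rat.
Qed.

Lemma Rintegral_gamma (j : nat) (h : Q2 -> R) : (forall x, ~ Bz j x -> h x = 0) ->
  \int[gamma]_x h x =
  \sum_(i < 2 ^ j.+1) gamma_weight (window j 0 i) * h (Q2_of_rat (window j 0 i)).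
Proof.
move=> h0.
pose X := window j 0 @` `I_(2 ^ j.+1).
have finX : finite_set X by exact: finite_image.
have nn (k : Q2 -> R) : (forall x, 0 <= k x) -> (forall x, ~ Bz j x -> k x = 0) ->
    (\int[gamma]_x (k x)%:E = (\sum_(t \in X) gamma_weight t * k (Q2_of_rat t))%:E)%E.
  move=> k0 ks; rewrite (integral_atomic _ _ Q2_T1)//.
  rewrite (eq_esum (b := fun t => (gamma_weight t * k (Q2_of_rat t))%:E)); last first.
    by move=> t _; rewrite EFinM.
  apply: esum_finite_support => // t; last by rewrite mulr_ge0 ?gamma_weight_ge0.
  move=> tX; have [tj|/ks ->] := pselect (Bz j (Q2_of_rat t)); last by rewrite mulr0.
  rewrite (gamma_support tj) ?mul0r// => i il tE; apply: tX; exists i => //.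
rewrite /Rintegral integralE.
have -> : ((fun x => (h x)%:E)^\+ = fun x => (Num.max (h x) 0)%:E)%E.
  by apply/funext => x; rewrite funeposE EFin_max.
have -> : ((fun x => (h x)%:E)^\- = fun x => (Num.max (- h x) 0)%:E)%E.
  by apply/funext => x; rewrite funenegE EFin_max.
rewrite !nn; try by move=> x; rewrite le_max lexx orbT.
2-3: by move=> x /h0 ->; rewrite ?oppr0 maxxx.
rewrite -EFinB /=.
have E (k : Q2 -> R) : \sum_(t \in X) gamma_weight t * k (Q2_of_rat t) =
    \sum_(i < 2 ^ j.+1) gamma_weight (window j 0 i) * k (Q2_of_rat (window j 0 i)).
  rewrite (fsbig_ord _ (2 ^ j.+1) (fun i => gamma_weight (window j 0 i) * k (Q2_of_rat (window j 0 i)))).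
  by apply: fsbig_image => i k' _ _; exact: window_inj.
rewrite (E (fun x => Num.max (h x) 0)) (E (fun x => Num.max (- h x) 0)) -sumrB; apply: eq_bigr => i _; rewrite -mulrBr; congr (_ * _).
by have [h1|h1] := leP (h (Q2_of_rat (window j 0 i))) 0; rewrite ?oppr_le0 /Num.max; case: ltP; case: ltP; lra.
Qed.

(** At t = m / 2^j the weight (1 - |t|)_+ is (2^j - |m|) / 2^j, and 2^j - |m| counts the pairs in
    [S_j] with difference t. On functions supported in [Bz j], [gamma] is therefore the
    autocorrelation of the single block [S_j]. *)
Lemma Cintegral_gamma (j : nat) (F : Q2 -> Cx R) : (forall x, ~ Bz j x -> F x = 0) ->
  Cintegral gamma F = (((2 ^ j)%:R * t0)^-1)%:C%C *
    \sum_(a < 2 ^ j) \sum_(b < 2 ^ j) F (grid j a - grid j b).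
Proof.
move=> F0; pose N := (2 ^ j)%N.
pose G (m : int) : Cx R := F (Q2_of_rat (m%:~R / 2 ^+ j)).
have -> : \sum_(a < 2 ^ j) \sum_(b < 2 ^ j) F (grid j a - grid j b) =
    \sum_(a < N) \sum_(b < N) G (a%:Z - b%:Z).
  apply: eq_bigr => a _; apply: eq_bigr => b _; congr F.
  by rewrite /grid -Q2_of_ratB /coset_rep -exprnN -mulrBl intrB !pmulrn.
rewrite sum_square_diff.
have N0 : 0 < (N%:R : R) by rewrite ltr0n expn_gt0.
have t00 := unit_vol_gt0 htheta.
(* Up to the common denominator, the weights of the triangle along the window are 0, 1, ..., N, ...,
   1. *)
have wE i : (i < 2 ^ j.+1)%N -> gamma_weight (window j 0 i) =
    (if (i < N)%N then i else (N.*2 - i)%N)%:R / (N%:R * t0).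
  move=> il; rewrite /gamma_weight mem_set; last exact: window_dyadic.
  rewrite /window addn0 rmorphM /= fmorphV rmorphB rmorphXn /= !rmorph_nat -natrX -/N.
  have il' : (i <= N.*2)%N by rewrite -mul2n /N -expnS ltnW.
  have H (k : nat) (x : R) : `|x| = 1 - k%:R / N%:R ->
      Num.max 0 (1 - `|x|) / t0 = k%:R / (N%:R * t0).
    move=> ->; rewrite subKr max_r ?divr_ge0// -mulrA -invfM//.
  apply: H; case: ltnP => iN.
    rewrite ler0_norm; first by field; rewrite gt_eqF.
    by rewrite pmulr_lle0 ?invr_gt0// subr_le0 ler_nat ltnW.
  rewrite ger0_norm; first by rewrite natrB// -muln2 natrM; field; rewrite gt_eqF.
  by rewrite pmulr_lge0 ?invr_gt0// subr_ge0 ler_nat.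
have key (h : Q2 -> R) : (forall x, ~ Bz j x -> h x = 0) -> \int[gamma]_x h x =
   (N%:R * t0)^-1 * (\sum_(i < N) h (Q2_of_rat (i%:Z%:~R / 2 ^+ j)) *+ (N - i) +
    (\sum_(i < N) h (Q2_of_rat ((- i%:Z)%:~R / 2 ^+ j)) *+ (N - i) - h (Q2_of_rat (0%:~R / 2 ^+ j)) *+ N)).
  move=> h0; rewrite (Rintegral_gamma h0) expnS mul2n -addnn -/N.
  rewrite (big_ord_twice (fun i => gamma_weight (window j 0 i) * h (Q2_of_rat (window j 0 i)))).
  rewrite addrC mulrDr; congr (_ + _).
    rewrite mulr_sumr; apply: eq_bigr => i _.
    rewrite wE; last by rewrite expnS mul2n -addnn ltn_add2r.
    rewrite ltnNge leq_addl /= -addnn subnDr.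
    rewrite /window addn0 natrD addrK -pmulrn.
    by rewrite mulrnAr -[RHS]mulr_natl mulrA.
  rewrite -(sum_weighted_tail (fun m => h (Q2_of_rat (m%:~R / 2 ^+ j)))) mulr_sumr.
  apply: eq_bigr => i _; rewrite wE; last by rewrite expnS mul2n -addnn ltn_addr.
  rewrite ltn_ord /window addn0 intrB -!pmulrn.
  by rewrite mulrnAr -[RHS]mulr_natl mulrA.
rewrite /Cintegral key; last by move=> x /F0 ->.
rewrite key; last by move=> x /F0 ->.
have ReC (c : R) (z : R[i]) : complex.Re (c%:C%C * z) = c * complex.Re z.
  by case: z => x y /=; rewrite mul0r subr0.
have ImC (c : R) (z : R[i]) : complex.Im (c%:C%C * z) = c * complex.Im z.
  by case: z => x y /=; rewrite mul0r addr0.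
apply/eqP; rewrite eq_complex ReC ImC /=.
rewrite (raddfD (@complex.Re R)) (raddfD (@complex.Im R)).
rewrite (raddfB (@complex.Re R)) (raddfB (@complex.Im R)).
rewrite !(raddf_sum (@complex.Re R)) !(raddf_sum (@complex.Im R)).
rewrite !(raddfMn (@complex.Re R)) !(raddfMn (@complex.Im R)).
apply/andP; split; apply/eqP; congr (_ * (_ + (_ - _))); apply: eq_bigr => i _.
- by rewrite (raddfMn (@complex.Re R)).
- by rewrite (raddfMn (@complex.Re R)).
- by rewrite (raddfMn (@complex.Im R)).
- by rewrite (raddfMn (@complex.Im R)).
Qed.

Lemma gamma_radon : radon gamma.
Proof.
apply: (@atomic_is_radon _ _ _ _ _ Q2_T1 (fun k => Bz k%:Z)).
- by move=> k; exact: open_Bz.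
- by move=> k l kl; apply: Bz_le; rewrite lez_nat.
- move=> x; have [k _ xk] : (\bigcup_(j : nat) Bz j%:Z) x by rewrite Bz_bigcup.
  by exists k.
- move=> k; rewrite atomicE esum_mkcond.
  rewrite (eq_esum (b := fun t => (gamma_weight t * \1_(Bz k) (Q2_of_rat t))%:E)); last first.
    move=> t _; rewrite indicE; have [|] := boolP (Q2_of_rat t \in Bz k) => h.
      by rewrite mulr1 ifT//; apply/mem_set; move/set_mem : h.
    by rewrite mulr0 ifF//; apply/negbTE; apply: contra h => /set_mem ?; exact/mem_set.
  rewrite (esum_finite_support (X := window k 0 @` `I_(2 ^ k.+1))) ?ltry//.
  + exact: finite_image.
  + move=> t tX; rewrite indicE; case: (boolP (_ \in _)) => [/set_mem tk|_]; last by rewrite mulr0.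
    rewrite (gamma_support tk) ?mul0r// => i il tE; apply: tX; exists i => //.
  + by move=> t; rewrite mulr_ge0 ?gamma_weight_ge0// indicE.
Qed.

End autocorrelation.

Lemma normc_sum (R : realType) n (F : 'I_n -> R[i]) :
  normc (\sum_(i < n) F i) <= \sum_(i < n) normc (F i).
Proof.
elim: n F => [|n IH] F; first by rewrite !big_ord0 normc0.
by rewrite !big_ord_recr /=; apply: le_trans (le_normcD _ _) _; rewrite lerD2r.
Qed.

Lemma normc_sum_le (R : realType) n (F : 'I_n -> R[i]) (c : R) :
  (forall i, normc (F i) <= c) -> normc (\sum_(i < n) F i) <= n%:R * c.
Proof.
move=> Fc; apply: le_trans (normc_sum _) _; apply: le_trans (ler_sum _ (fun i _ => Fc i)) _.
by rewrite sumr_const card_ord mulr_natl.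
Qed.

Lemma normc_real (R : realType) (c : R) : normc (c%:C)%C = `|c|.
Proof. by rewrite /= expr0n addr0 sqrtr_sqr. Qed.

Lemma nsq_dist (R : realType) (u v : R[i]) :
  `|nsq u - nsq v| <= normc (u - v) * (normc u + normc v).
Proof.
rewrite !nsq_normc subr_sqr normrM [X in _ * X]ger0_norm ?addr_ge0 ?normc_ge0//.
rewrite ler_wpM2r ?addr_ge0 ?normc_ge0// ler_norml.
have h (a b : R[i]) : normc a <= normc b + normc (a - b).
  by rewrite -{1}(subrK b a) addrC le_normcD.
have := h u v; have := h v u; rewrite -[normc (v - u)]normcN opprB.
by move=> h1 h2; apply/andP; split; lra.
Qed.

(** * The Fourier identity at a finite level *)

Section identity.
Variables (R : realType) (theta : {measure set (borel Q2) -> \bar R}).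
Hypothesis htheta : haar theta.
Local Notation rr := (ratr : rat -> R).
Local Notation t0 := (unit_vol theta).
Local Notation Cint f := (Cintegral theta f).
Variables (f : Q2 -> Cx R) (j : nat).
Hypothesis cf : continuous f.
Hypothesis f0 : forall x, ~ Bz j x -> f x = 0.

Lemma sum_cut (q : Q2 -> Cx R) (l : nat) : (forall x, ~ Bz j x -> q x = 0) ->
  q = fun x => \sum_(i < 2 ^ (j + l)) cut (coset (- l%:Z) (grid j i)) q x.
Proof.
move=> q0; apply/funext => x; have [jx|/q0 qx] := pselect (Bz j x); last first.
  by rewrite big1// => i _; rewrite /cut qx if_same.
have [i il xi] := @Bz_cover j%:Z (j + l)%N x jx.
have Elj : j%:Z - (j + l)%N%:Z = - l%:Z by lia.
rewrite Elj in xi.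
rewrite (bigD1 (Ordinal il))//= big1 ?addr0.
  by rewrite /cut mem_set.
move=> k ki; rewrite /cut ifF//; apply: contraNF ki => /set_mem xk.
apply/eqP/val_inj/(@Bz_coset_rep_uniq j%:Z (j + l)%N) => //=.
by rewrite Elj; apply: (@Bz_trans _ x) => //; exact/BzC.
Qed.

Definition piece_int (l i : nat) : R[i] := Cint (cut (coset (- l%:Z) (grid j i)) f).

Let tame_cut (q : Q2 -> Cx R) k c : tameC q -> tameC (cut (coset k c) q).
Proof. by apply: tameC_cut; exact: measurable_coset. Qed.

Let tf : tameC f := tameC_continuous cf f0.

Lemma Cint_pieces (q : Q2 -> Cx R) (l : nat) (z : nat -> R[i]) (e : R) :
  tameC q -> (forall x, ~ Bz j x -> q x = 0) ->
  (forall i x, (i < 2 ^ (j + l))%N -> coset (- l%:Z) (grid j i) x -> normc (q x - z i) <= e) ->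
  normc (Cint q - (t0 * 2 ^- l)%:C%C * \sum_(i < 2 ^ (j + l)) z i) <= e * 2 * (t0 * 2 ^+ j).
Proof.
move=> tq q0 qe.
rewrite {1}(sum_cut l q0) (Cint_sum htheta); last by move=> i; exact: tame_cut.
rewrite mulr_sumr -sumrB.
have -> : e * 2 * (t0 * 2 ^+ j) = (2 ^ (j + l))%:R * (e * 2 * (t0 * 2 ^- l)).
  by rewrite natrX exprD; field; rewrite expf_neq0.
apply: normc_sum_le => i; rewrite exprnN [_%:C%C * _]mulrC.
apply: (Cint_coset htheta (c := grid j i) (k := - l%:Z)).
- exact: tame_cut.
- by move=> x nx; rewrite /cut ifF//; apply/negP => /set_mem.
- by move=> x xi; rewrite /cut mem_set//; exact: qe.
Qed.

Lemma inv_transform_chi (w : rat) : inv_transform theta f (chiD R w) = Cint (fun x => chi R w x * f x).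
Proof. by []. Qed.

Lemma chi_mul_continuous w : continuous (fun x => chi R w x * f x : Cx R).
Proof.
have wl := levelP (dyadic_or0P w); rewrite chi_dyadic_or0.
apply/continuousCP => x e e0; have [l lP] := (continuousCP f).1 cf x e e0.
exists (maxn l (level (dyadic_or0 w))) => y yx.
rewrite (@chi_coset _ _ (level (dyadic_or0 w)) x y)//; [|exact: dyadic_or0P|].
  rewrite -mulrBr normcM.
  have -> : normc (chi R (dyadic_or0 w) x) = 1 by rewrite /= cos2Dsin2 sqrtr1.
  by rewrite mul1r; apply: lP; apply: Bz_le yx; rewrite lerN2 lez_nat leq_maxl.
by apply: Bz_le yx; rewrite lerN2 lez_nat leq_maxr.
Qed.

Lemma chi_mul_support w x : ~ Bz j x -> chi R w x * f x = 0.
Proof. by move=> /f0 ->; rewrite mulr0. Qed.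

Lemma tame_chi_mul w : tameC (fun x => chi R w x * f x : Cx R).
Proof.
apply: (@tameC_continuous _ _ j); first exact: chi_mul_continuous.
exact: chi_mul_support.
Qed.

Lemma coset_rep_grid l (w : nat) i :
  rr (w%:R / 2 ^+ l * coset_rep j i) = w%:R * (i%:R / 2 ^+ (j + l)).
Proof.
rewrite /coset_rep -exprnN !rmorphM /= !fmorphV !rmorphXn /= !rmorph_nat exprD.
by field; rewrite !expf_neq0.
Qed.

(** A character of frequency m / 2^l is constant on the cosets of [Bz (- l)], so the transform is
    exactly a discrete Fourier transform of the integrals over these cosets. *)
Lemma inv_transform_piece l (m : nat) :
  inv_transform theta f (chiD R (m%:R / 2 ^+ l)) =
  \sum_(i < 2 ^ (j + l)) ee (m%:R * (i%:R / 2 ^+ (j + l))) * piece_int l i.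
Proof.
rewrite inv_transform_chi; set w := m%:R / 2 ^+ l.
have dw : dyadic w by exists m%:Z, l.
have wl : w * 2 ^+ l \is a Num.int by rewrite /w divfK ?expf_neq0// pmulrn intr_int.
rewrite {1}(sum_cut l (@chi_mul_support w)) (Cint_sum htheta); last first.
  by move=> i; apply: tame_cut; exact: tame_chi_mul.
apply: eq_bigr => i _; rewrite /piece_int -(CintZ htheta); last exact: tame_cut.
congr Cintegral; apply/funext => x; rewrite /cut; case: ifPn => [/set_mem xi|_]; last by rewrite mulr0.
by rewrite (chiE R dw wl (dyadic_coset_rep j i) xi) coset_rep_grid.
Qed.

Definition inv_density (w : rat) : R := nsq (inv_transform theta f (chiD R w)) / t0 ^+ 2.

Lemma inv_density_ge0 w : 0 <= inv_density w.
Proof. by rewrite divr_ge0 ?nsq_ge0 ?sqr_ge0. Qed.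

Lemma inv_density_bounded : exists c, forall w, inv_density w <= c.
Proof.
have [M fM] := continuousC_bounded cf f0.
exists ((M * 2 * (t0 * 2 ^ j%:Z)) ^+ 2 / t0 ^+ 2) => w.
rewrite ler_wpM2r ?invr_ge0 ?sqr_ge0// nsq_normc.
have h : normc (inv_transform theta f (chiD R w)) <= M * 2 * (t0 * 2 ^ j%:Z).
  have := @Cint_coset _ _ htheta (fun x => chi R w x * f x) j%:Z 0 0 M (tame_chi_mul w).
  rewrite mul0r subr0; apply => x; first by rewrite coset0; exact: chi_mul_support.
  rewrite subr0 normcM => _.
  have -> : normc (chi R w x) = 1 by rewrite /= cos2Dsin2 sqrtr1.
  by rewrite mul1r.
by rewrite ler_sqr ?nnegrE ?normc_ge0// (le_trans _ h)// normc_ge0.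
Qed.

(** The character of frequency 2^j is trivial on [Bz j], outside of which [f] vanishes. *)
Lemma inv_density_periodic w : inv_density (w + 2 ^+ j) = inv_density w.
Proof.
suff E : inv_transform theta f (chiD R (w + 2 ^+ j)) = inv_transform theta f (chiD R w).
  by rewrite /inv_density E.
rewrite !inv_transform_chi; congr Cintegral; apply/funext => x; have [jx|/f0 ->] := pselect (Bz j x); last by rewrite !mulr0.
congr (_ * _); have [dw|ndw] := pselect (dyadic w); last first.
  rewrite /chi /dyadic_or0 !memNset// => dw; apply: ndw.
  by rewrite -[w](addrK (2 ^+ j)); apply: dyadicB => //; exact: (dyadic_expz j%:Z).
have dj : dyadic (2 ^+ j) by exact: (dyadic_expz j%:Z).
have [l wl] := dyadic_level dw; have [d dd xd] := Q2_dyadic_dense (- l%:Z) x.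
rewrite (chiE R (dyadicD dw dj) _ dd xd); last first.
  by rewrite mulrDl rpredD// rpredM// rpredX.
rewrite (chiE R dw wl dd xd); apply: eeDint; rewrite -rmorphB /= ratr_is_int -mulrBl addrC addKr.
rewrite mulrC; apply/(@Bz_dyadic j%:Z) => //.
rewrite -[Q2_of_rat d](subKr x); apply: BzB => //.
by apply: Bz_le xd; lia.
Qed.

(** The kernel is 4^-j times a squared Dirichlet sum, and multiplying the discrete transform by that
    sum amounts to adding 2^j cyclically consecutive entries. Parseval then trades the sum over
    frequencies for a sum over positions. *)
Lemma fejer_sum_pieces l :
  fejer_sum inv_density l j = (2 ^+ j * 2 ^+ l)^-1 *
  \sum_(i < 2 ^ (j + l)) nsq (\sum_(a < 2 ^ j)
     (2 ^+ l / t0)%:C%C * piece_int l ((i + a) %% 2 ^ (j + l))).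
Proof.
set Q := (2 ^ (j + l))%N; have Q0 : (0 < Q)%N by rewrite expn_gt0.
have t00 : t0 != 0 by rewrite gt_eqF// unit_vol_gt0.
have p0 k : (2 : R) ^+ k != 0 by rewrite expf_neq0.
rewrite /fejer_sum [(l + j)%N]addnC -/Q.
transitivity (\sum_(m < Q) (4 ^+ j * t0 ^+ 2)^-1 * nsq (\sum_(i < Q) ee (m%:R * (i%:R / 2 ^+ (j + l))) *
   \sum_(a < 2 ^ j) piece_int l ((i + a) %% Q))).
  apply: eq_bigr => m _; set w : rat := m%:R / 2 ^+ l.
  (* The kernel is even; the negative sign makes the phase of index [a] turn into the forward shift
     from [i] to [i + a]. *)
  have -> : fejer j (rr w) = (4 ^+ j)^-1 * nsq (dirichlet j (- rr w)).
    rewrite nsq_dirichlet mulKf ?expf_neq0//; apply: eq_bigr => i _.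
    by rewrite mulrN mulNr cosN.
  rewrite /inv_density -mulrA [nsq (dirichlet _ _) * _]mulrA -nsqM [_ / t0 ^+ 2]mulrC mulrA -invfM.
  congr (_ * nsq _); rewrite inv_transform_piece /dirichlet mulr_suml.
  under [RHS]eq_bigr do rewrite mulr_sumr.
  rewrite [RHS]exchange_big; apply: eq_bigr => a _ /=.
  pose QQ : R := 2 ^+ (j + l).
  have QQ0 : QQ != 0 by exact: p0.
  pose H i := ee (- (m%:R * (a%:R / QQ))) * (ee (m%:R * (i%:R / QQ)) * piece_int l i) : R[i].
  transitivity (\sum_(i < Q) H i).
    rewrite mulr_sumr /H; apply: eq_bigr => i _; congr (ee _ * _).
    rewrite /w /QQ rmorphM /= fmorphV rmorphXn /= !rmorph_nat exprD.
    by field; rewrite !p0.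
  rewrite -(sum_cyclic H a Q0); apply: eq_bigr => i _; rewrite /H mulrA -eeD; congr (_ * _).
  apply: eeDint.
  have E : ((i + a) %% Q)%N%:R = i%:R + a%:R - ((i + a) %/ Q)%N%:R * QQ :> R.
    rewrite /QQ -natrX -/Q -natrM -natrD {2}(divn_eq (i + a) Q) natrD addrC addKr//.
  rewrite E (_ : _ - _ = - (m * ((i + a) %/ Q))%N%:R); first by rewrite rpredN pmulrn intr_int.
  rewrite natrM; move: ((i + a) %/ Q)%N%:R (m%:R : R) => u v; rewrite -/QQ; move: (QQ) QQ0 => q q0; field.
  exact: q0.
rewrite -mulr_sumr (parseval (j + l) (fun i => \sum_(a < 2 ^ j) piece_int l ((i + a) %% Q))) mulrA.
rewrite [LHS](_ : _ = (2 ^+ j * 2 ^+ l)^-1 * ((2 ^+ l / t0) ^+ 2 *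
    \sum_(i < Q) nsq (\sum_(a < 2 ^ j) piece_int l ((i + a) %% Q)))); last first.
  rewrite mulrA; congr (_ * _); rewrite natrX exprD.
  have -> : (4 : R) ^+ j = 2 ^+ j * 2 ^+ j by rewrite -exprMn; congr (_ ^+ _); ring.
  by move: (2 ^+ j) (2 ^+ l) (p0 j) (p0 l) (unit_vol theta) t00 => A B A0 B0 t t0'; field; rewrite A0 B0 t0'.
congr (_ * _); rewrite mulr_sumr; apply: eq_bigr => i _.
rewrite -mulr_sumr nsqM; congr (_ * _).
by rewrite /nsq /= expr0n addr0.
Qed.

Lemma gridD (m n : nat) : grid j (m + n) = grid j m + grid j n.
Proof. by rewrite /grid -Q2_of_ratD /coset_rep natrD mulrDl. Qed.

Lemma grid_mul_mod (l q : nat) : Bz (- l%:Z) (grid j (q * 2 ^ (j + l))).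
Proof.
apply/Bz_dyadic; first exact: dyadic_coset_rep.
rewrite /coset_rep -!exprnN natrM natrX exprD.
rewrite [X in X \is a _](_ : _ = q%:R); first by rewrite pmulrn intr_int.
by field; rewrite !expf_neq0.
Qed.

Lemma grid_mod (l m : nat) : Bz (- l%:Z) (grid j m - grid j (m %% 2 ^ (j + l))).
Proof. by rewrite {1}(divn_eq m (2 ^ (j + l))) gridD addrK; exact: grid_mul_mod. Qed.

Definition conv : Q2 -> Cx R := convolution theta f (tilde f).

Lemma convE t : conv t = Cint (fun x => f x * conjc (f (x - t)) : Cx R).
Proof.
by rewrite /conv /convolution /tilde; congr Cintegral; apply/funext => x; rewrite opprB.
Qed.

Lemma conv_support t : ~ Bz j t -> conv t = 0.
Proof.
move=> nt; rewrite convE -(Cint0 htheta); congr Cintegral; apply/funext => x.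
have [jx|/f0 ->] := pselect (Bz j x); last by rewrite mul0r.
rewrite [f (x - t)]f0 ?conjc0 ?mulr0// => jxt; apply: nt.
by rewrite -[t](subKr x); exact: BzB.
Qed.

Lemma conjcB (u v : R[i]) : conjc (u - v) = conjc u - conjc v.
Proof. by case: u v => [? ?] [? ?]; apply/eqP; rewrite eq_complex /=; apply/andP; split; apply/eqP; ring. Qed.

Lemma normc_conj (u : R[i]) : normc (conjc u) = normc u.
Proof. by case: u => ? ? /=; rewrite sqrrN. Qed.

Lemma normc_mulB (u v u' v' : R[i]) :
  normc (u * v - u' * v') <= normc u * normc (v - v') + normc (u - u') * normc v'.
Proof.
have -> : u * v - u' * v' = u * (v - v') + (u - u') * v' by ring.
by apply: le_trans (le_normcD _ _) _; rewrite !normcM.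
Qed.

Lemma conv_integrand_continuous t : continuous (fun x => f x * conjc (f (x - t)) : Cx R).
Proof.
have [M fM] := continuousC_bounded cf f0.
have M0 : 0 <= M by rewrite (le_trans _ (fM 0))// normc_ge0.
have cf' := (continuousCP f).1 cf.
apply/continuousCP => x e e0; pose d := e / (2 * (M + 1)).
have d0 : 0 < d by rewrite divr_gt0// mulr_gt0//; lra.
have [l1 l1P] := cf' x _ d0; have [l2 l2P] := cf' (x - t) _ d0.
exists (maxn l1 l2) => y yx.
have h1 : normc (f y - f x) < d.
  by apply: l1P; apply: Bz_le yx; rewrite lerN2 lez_nat leq_maxl.
have h2 : normc (f (y - t) - f (x - t)) < d.
  by apply: l2P; rewrite opprB addrA subrK; apply: Bz_le yx; rewrite lerN2 lez_nat leq_maxr.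
apply: le_lt_trans (normc_mulB _ _ _ _) _; rewrite -conjcB !normc_conj.
have h3 := fM y; have h4 := fM (x - t).
apply: (@le_lt_trans _ _ (M * d + d * M)).
  by rewrite lerD// ler_pM ?normc_ge0// ltW.
have -> : e = d * (2 * (M + 1)) by rewrite /d divfK// gt_eqF// mulr_gt0//; lra.
nra.
Qed.

Lemma tame_conv_integrand t : tameC (fun x => f x * conjc (f (x - t)) : Cx R).
Proof.
apply: (@tameC_continuous _ _ j); first exact: conv_integrand_continuous.
by move=> x /f0 ->; rewrite mul0r.
Qed.

Variables (M e : R) (l : nat).
Hypothesis fM : forall x, normc (f x) <= M.
Hypothesis fe : forall x y, Bz (- l%:Z) (x - y) -> normc (f x - f y) <= e.
Hypothesis e0 : 0 <= e.
Local Notation Q := (2 ^ (j + l))%N.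

(** Samples of [f] indexed by the cyclic group of order [Q]. Wrapping around is harmless, since a
    full turn moves the point by 2^l, an element of [Bz (- l)], on whose cosets [f] is nearly
    constant. *)
Definition fgrid (i : nat) : R[i] := f (grid j (i %% Q)).

Let M0 : 0 <= M. Proof. by rewrite (le_trans _ (fM 0))// normc_ge0. Qed.
Let Q0 : (0 < Q)%N. Proof. by rewrite expn_gt0. Qed.
Let t00 : 0 < t0. Proof. exact: unit_vol_gt0. Qed.

Lemma conv_estimate (a b : nat) : (a < 2 ^ j)%N ->
  normc (conv (grid j a - grid j b) -
    (t0 * 2 ^- l)%:C%C * \sum_(i < Q) fgrid (i + a) * conjc (fgrid (i + b)))
  <= 4 * M * e * (t0 * 2 ^+ j).
Proof.
move=> aN; have aQ : (a <= Q)%N.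
  by rewrite (leq_trans (ltnW aN))// leq_exp2l// leq_addr.
(* In the cyclic index [Q - a] stands for -a: the factor f(x - t) with t = grid a - grid b is
   sampled at i + b - a, and a rotation by [a] makes the sum symmetric. *)
pose z i := fgrid i * conjc (fgrid (i + b + (Q - a))).
have -> : \sum_(i < Q) fgrid (i + a) * conjc (fgrid (i + b)) = \sum_(i < Q) z i.
  rewrite -(sum_cyclic z a Q0); apply: eq_bigr => i _; rewrite /z /fgrid modn_mod.
  congr (_ * conjc (f (grid _ _))).
  by rewrite -addnA modnDml -addnA [(a + _)%N]addnCA subnKC// addnA modnDr.
rewrite convE; have -> : 4 * M * e * (t0 * 2 ^+ j) = (2 * M * e) * 2 * (t0 * 2 ^+ j) by ring.
apply: Cint_pieces; first exact: tame_conv_integrand.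
  by move=> x /f0 ->; rewrite mul0r.
move=> i x iQ xi; rewrite /z /fgrid (modn_small iQ).
set k := (i + b + (Q - a))%N.
have h : Bz (- l%:Z) (x - (grid j a - grid j b) - grid j (k %% Q)).
  apply: (@Bz_trans _ (grid j k)); last exact: grid_mod.
  have -> : x - (grid j a - grid j b) - grid j k = (x - grid j i) - grid j (1 * Q).
    have -> : grid j (1 * Q) = grid j a + grid j (Q - a) by rewrite mul1n -gridD subnKC.
    rewrite /k !gridD.
    move: (grid j a) (grid j b) (grid j i) (grid j (Q - a)) => A B C D.
    rewrite !opprD !opprK !addrA.
    rewrite [x - A + B - C]addrAC addrK.
    by rewrite [x - A - C]addrAC.
  by apply: BzB => //; exact: grid_mul_mod.
apply: le_trans (normc_mulB _ _ _ _) _; rewrite -conjcB !normc_conj.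
apply: (@le_trans _ _ (M * e + e * M)); last by rewrite le_eqVlt; apply/orP; left; apply/eqP; ring.
by rewrite lerD// ler_pM ?normc_ge0 ?fe.
Qed.

Lemma piece_estimate i :
  normc ((2 ^+ l / t0)%:C%C * piece_int l (i %% Q) - fgrid i) <= 2 * e.
Proof.
have h : normc (piece_int l (i %% Q) - fgrid i * (t0 * 2 ^ (- l%:Z))%:C%C) <= e * 2 * (t0 * 2 ^ (- l%:Z)).
  apply: (Cint_coset htheta (c := grid j (i %% Q))).
  - exact: tame_cut.
  - by move=> x nx; rewrite /cut ifF//; apply/negP => /set_mem.
  - by move=> x xi; rewrite /cut mem_set//; exact: fe.
have s0 : 0 < 2 ^+ l / t0 by rewrite divr_gt0.
have E : t0 * 2 ^ (- l%:Z) * (2 ^+ l / t0) = 1.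
  by rewrite -exprnN; field; rewrite (gt_eqF t00) expf_neq0.
have -> : (2 ^+ l / t0)%:C%C * piece_int l (i %% Q) - fgrid i =
   (2 ^+ l / t0)%:C%C * (piece_int l (i %% Q) - fgrid i * (t0 * 2 ^ (- l%:Z))%:C%C).
  have E2 : (2 ^+ l / t0)%:C%C * (t0 * 2 ^ (- l%:Z))%:C%C = 1 :> R[i].
    have E' : 2 ^+ l / t0 * (t0 * 2 ^ (- l%:Z)) = 1 by rewrite -[LHS]mulrC.
    by rewrite -(rmorphM (@real_complex R)) E' rmorph1.
  by rewrite mulrBr mulrCA E2 mulr1.
rewrite normcM normc_real (gtr0_norm s0) mulrC -ler_pdivlMr//.
apply: le_trans h _; rewrite ler_pdivlMr// -[leLHS]mulrA E; lra.
Qed.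

(** Both sides are close to the same Riemann sum [S]. Expanding its squares yields the double sum
    over [S_j] of [Cintegral_gamma], with each value of [conv] replaced by its sampled version;
    unexpanded, it is [fejer_sum_pieces] with piece integrals replaced by samples. *)
Lemma fejer_sum_estimate :
  normc (Cintegral (gamma htheta) conv - (fejer_sum inv_density l j)%:C%C) <=
  4 * (2 ^+ j) ^+ 2 * e * (2 * M + e).
Proof.
pose N := (2 ^ j)%N; have NE : N%:R = 2 ^+ j :> R by rewrite natrX.
have N0 : 0 < (2 : R) ^+ j by rewrite exprn_gt0.
have L0 : 0 < (2 : R) ^+ l by rewrite exprn_gt0.
pose S := (2 ^+ j * 2 ^+ l)^-1 * \sum_(i < Q) nsq (\sum_(a < N) fgrid (i + a)).
rewrite -(subrKA S%:C%C); apply: le_trans (le_normcD _ _) _.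
have -> : 4 * (2 ^+ j) ^+ 2 * e * (2 * M + e) =
   4 * (2 ^+ j) ^+ 2 * e * M + 4 * (2 ^+ j) ^+ 2 * e * (M + e) by ring.
apply: lerD.
  rewrite (Cintegral_gamma htheta conv_support).
  have -> : S%:C%C = ((2 ^ j)%:R * t0)^-1%:C%C * \sum_(a < N) \sum_(b < N)
      ((t0 * 2 ^- l)%:C%C * \sum_(i < Q) fgrid (i + a) * conjc (fgrid (i + b))).
    under eq_bigr do rewrite -mulr_sumr.
    rewrite -mulr_sumr mulrA -rmorphM /= /S rmorphM /=.
    have -> : ((2 ^ j)%:R * t0)^-1 * (t0 * 2 ^- l) = (2 ^+ j * 2 ^+ l)^-1.
      by rewrite natrX; field; rewrite (gt_eqF t00) (gt_eqF N0) (gt_eqF L0).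
    congr (_ * _); rewrite rmorph_sum /=.
    under eq_bigr do rewrite nsq_sum.
    rewrite exchange_big; apply: eq_bigr => a _ /=.
    by rewrite exchange_big.
  rewrite -mulrBr -sumrB normcM normc_real gtr0_norm; last by rewrite invr_gt0 mulr_gt0 ?ltr0n ?expn_gt0.
  rewrite mulrC ler_pdivrMr ?mulr_gt0 ?ltr0n ?expn_gt0//.
  have -> : 4 * (2 ^+ j) ^+ 2 * e * M * ((2 ^ j)%:R * t0) =
      N%:R * (N%:R * (4 * M * e * (t0 * 2 ^+ j))) by rewrite !NE; ring.
  apply: normc_sum_le => a; rewrite -sumrB; apply: normc_sum_le => b.
  exact: conv_estimate.
have -> : S%:C%C - (fejer_sum inv_density l j)%:C%C = (S - fejer_sum inv_density l j)%:C%C.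
  by rewrite rmorphB.
rewrite normc_real fejer_sum_pieces /S -mulrBr -sumrB normrM.
rewrite gtr0_norm; last by rewrite invr_gt0 mulr_gt0.
rewrite mulrC ler_pdivrMr ?mulr_gt0//.
apply: le_trans (ler_norm_sum _ _ _) _.
have -> : 4 * (2 ^+ j) ^+ 2 * e * (M + e) * (2 ^+ j * 2 ^+ l) =
   \sum_(i < Q) (4 * (2 ^+ j) ^+ 2 * e * (M + e)).
  by rewrite sumr_const card_ord -[RHS]mulr_natr natrX exprD.
apply: ler_sum => i _; apply: le_trans (nsq_dist _ _) _.
set u := \sum_(a < N) fgrid (i + a); set v := \sum_(a < 2 ^ j) _.
have vu : normc (v - u) <= 2 ^+ j * (2 * e).
  rewrite /v /u -sumrB -NE; apply: normc_sum_le => a; exact: piece_estimate.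
have un : normc u <= 2 ^+ j * M by rewrite -NE; apply: normc_sum_le => a; exact: fM.
have vn : normc v <= 2 ^+ j * (2 * e) + 2 ^+ j * M.
  rewrite -[v](subrK u); apply: le_trans (le_normcD _ _) _; exact: lerD.
have -> : 4 * (2 ^+ j) ^+ 2 * e * (M + e) =
  2 ^+ j * (2 * e) * (2 ^+ j * M + (2 ^+ j * (2 * e) + 2 ^+ j * M)) by ring.
apply: ler_pM; rewrite ?addr_ge0 ?normc_ge0//; last exact: lerD.
by rewrite -normcN opprB.
Qed.

End identity.

(** * The Fourier transform of the autocorrelation *)

Section diffraction.
Variables (R : realType) (theta : {measure set (borel Q2) -> \bar R}).
Hypothesis htheta : haar theta.
Local Notation t0 := (unit_vol theta).

Definition gammahat_weight (w : rat) : R := dyadic_weight R w / t0 ^+ 2.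

Lemma gammahat_weight_ge0 w : 0 <= gammahat_weight w.
Proof. by rewrite divr_ge0 ?dyadic_weight_ge0 ?sqr_ge0. Qed.

Definition gammahat : {measure set (borel (dualQ2 R)) -> \bar R} :=
  atomic (fun w => NngNum (gammahat_weight_ge0 w)) (chiD R).

(** Take [phi] constant and [j = 0] in [fsum_dyadic_le_level]: the kernel of level 0 is 1, so the
    weights sinc^2 over 2^-k Z add up to at most 2^k. *)
Lemma gammahat_nbhd_fin k : (gammahat (@dual_nbhd R k) < +oo)%E.
Proof.
apply: (@le_lt_trans _ _ ((2 ^ k)%:R / t0 ^+ 2)%:E); last exact: ltry.
rewrite atomicE; apply: ge_ereal_sup => _ [X [finX XU] <-].
rewrite fsumEFin// lee_fin.
have c0 : 0 <= (t0 ^+ 2)^-1 by rewrite invr_ge0 sqr_ge0.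
have := @fsum_dyadic_le_level R 0 (fun=> (t0 ^+ 2)^-1) (fun=> erefl) (fun=> c0) X k finX.
have -> : fejer_sum (fun=> (t0 ^+ 2)^-1) k 0 = (2 ^ k)%:R / t0 ^+ 2.
  rewrite /fejer_sum addn0 -mulr_suml; congr (_ * _).
  rewrite (eq_bigr (fun=> 1)) ?sumr_const ?card_ord// => i _.
  by rewrite /fejer big_ord0.
by apply => w Xw dw; apply: (@dual_nbhd_chi R) => //; exact: XU.
Qed.

Lemma gammahat_radon : radon gammahat.
Proof.
apply: (@atomic_is_radon _ _ _ _ _ (@dual_T1 R) (@dual_nbhd R)).
- exact: open_dual_nbhd.
- exact: dual_nbhd_le.
- exact: dual_nbhd_cover.
- exact: gammahat_nbhd_fin.
Qed.

Lemma gammahat_pure_point : pure_point gammahat.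
Proof. exact: atomic_pure_point. Qed.

(** As the spacing 2^-l shrinks, the real numbers [fejer_sum] converge to [c]. This makes [c] real,
    and [esum_dyadic_weight] identifies the limit with the integral over the dual. *)
Lemma gamma_fourier_transform : fourier_transform theta (gamma htheta) gammahat.
Proof.
split; first exact: gammahat_radon.
move=> f Cf; have [cf _] := Cf; have [j f0] := Cc_support Cf.
have [M fM] := continuousC_bounded cf f0.
have M0 : 0 <= M by rewrite (le_trans _ (fM 0))// normc_ge0.
set c := Cintegral (gamma htheta) (convolution theta f (tilde f)).
have N0 : 0 < (2 : R) ^+ j by rewrite exprn_gt0.
have lim (d : R) : 0 < d -> exists L, forall l, (L <= l)%N ->
    normc (c - (fejer_sum (inv_density theta f) l j)%:C%C) <= d.
  move=> d0; pose D := 4 * (2 ^+ j) ^+ 2 * (2 * M + 1).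
  have D0 : 0 < D by rewrite !mulr_gt0 ?exprn_gt0//; lra.
  pose e := Num.min 1 (d / D).
  have e0 : 0 < e by rewrite lt_min ltr01 divr_gt0.
  have [L LP] := unif_continuousC_supp cf f0 e0.
  exists L => l Ll.
  have h : normc (c - (fejer_sum (inv_density theta f) l j)%:C%C) <=
      4 * (2 ^+ j) ^+ 2 * e * (2 * M + e).
    apply: (fejer_sum_estimate htheta cf f0 fM) => x y xy; exact/ltW/(LP l).
  apply: le_trans h _.
  have e1 : e <= 1 by rewrite ge_min lexx.
  have eD : e * D <= d by rewrite -ler_pdivlMr// ge_min lexx orbT.
  apply: le_trans eD; rewrite /D.
  have -> : 4 * (2 ^+ j) ^+ 2 * e * (2 * M + e) = e * (4 * (2 ^+ j) ^+ 2 * (2 * M + e)) by ring.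
  rewrite ler_wpM2l ?(ltW e0)// ler_wpM2l ?lerD2l//.
split.
  apply/eqP; rewrite -normr_le0; apply/ler_addgt0Pr => d /lim[L /(_ L (leqnn _)) h].
  by have := le_trans (Im_le_normc _) h; rewrite Im_sub /= subr0 add0r.
rewrite (integral_atomic _ _ (@dual_T1 R)); last by move=> h; rewrite sqr_ge0.
rewrite (eq_esum (b := fun w => ((dyadic_weight R w)%:E * (inv_density theta f w)%:E)%E)); last first.
  move=> w _; rewrite -!EFinM; congr EFin.
  rewrite -[(NngNum _)%:num]/(gammahat_weight w) /gammahat_weight /inv_density nsq_normc.
  by rewrite [RHS]mulrA [LHS]mulrAC.
have [b bP] := inv_density_bounded htheta cf f0.
apply: (@esum_dyadic_weight R j (inv_density theta f) (inv_density_periodic theta f0)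
  (@inv_density_ge0 _ theta f) b (complex.Re c) bP).
move=> d /lim[L LP]; exists L => l /LP h.
by have := le_trans (Re_le_normc _) h; rewrite Re_sub /= -normrN opprB.
Qed.

End diffraction.

(** A canonical point of the coset: equal cosets are equal sets, hence yield the same choice. Finite
    families of cosets thereby become finite sets of points. *)
Definition coset_pt (j : int) (x : Q2) : Q2 := xget 0 (coset j x).

Lemma coset_sym j x y : coset j x y -> coset j y x.
Proof. by move=> /BzC. Qed.

Lemma coset_refl j x : coset j x x.
Proof. by rewrite /coset/= subrr; exact: Bz0. Qed.

Lemma coset_eq j x y : coset j x y -> coset j x = coset j y.
Proof.
move=> xy; apply/seteqP; split => z zx; apply: Bz_trans zx _ => //.
by apply/BzC.
Qed.

Lemma coset_ptP j x : coset j x (coset_pt j x).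
Proof. by apply: (@xgetPex _ 0 (coset j x)); exists x; exact: coset_refl. Qed.

Lemma coset_pt_eq j x y : coset j x y -> coset_pt j x = coset_pt j y.
Proof. by move=> /coset_eq E; rewrite /coset_pt E. Qed.

Lemma coset_ptE j x y : (coset_pt j x == coset_pt j y) <-> coset j x y.
Proof.
split=> [/eqP E|/coset_pt_eq ->//]; apply: Bz_trans (coset_ptP j x).
by rewrite E; apply/BzC; exact: coset_ptP.
Qed.

Lemma coset_pt_idem j x : coset_pt j (coset_pt j x) = coset_pt j x.
Proof. by apply/esym/coset_pt_eq; exact: coset_ptP. Qed.

Lemma finite_coset_pt j (K : set Q2) : compact K -> finite_set (coset_pt j @` K).
Proof.
move=> /compact_sub_Bz[m Km].
apply: (@sub_finite_set _ _ ((fun i => coset_pt j (grid m i)) @` `I_(2 ^ `|(m%:Z - j)%R|%N))); last first.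
  exact: finite_image.
move=> _ [x /Km xm <-]; have [i il xi] := @Bz_cover m `|(m%:Z - j)%R|%N x xm.
exists i => //; apply: coset_pt_eq; rewrite /coset/=; apply: Bz_le xi; lia.
Qed.

Lemma sum_fibers (V : nmodType) (I J : eqType) (h : I -> J) (W : seq I) (P : seq J) (g : I -> V) :
  uniq P -> (forall x, x \in W -> h x \in P) ->
  \sum_(x <- W) g x = \sum_(c <- P) \sum_(x <- W | h x == c) g x.
Proof.
move=> uP hP; rewrite (exchange_big_dep xpredT)//= big_seq [RHS]big_seq.
apply: eq_bigr => x xW; rewrite -big_filter.
have -> : [seq c <- P | h x == c] = [:: h x].
  have -> : [seq c <- P | h x == c] = [seq c <- P | pred1 (h x) c].
    by apply: eq_filter => c; rewrite /= eq_sym.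
  by rewrite filter_pred1_uniq// hP.
by rewrite big_seq1.
Qed.

(** * Averages along van Hove sequences *)

Section averaging.
Variables (R : realType) (theta : {measure set (borel Q2) -> \bar R}).
Hypothesis htheta : haar theta.
Local Notation t0 := (unit_vol theta).
Variable j : nat.
Local Notation v := (t0 * 2 ^+ j).
Let v0 : 0 < v. Proof. by rewrite mulr_gt0 ?unit_vol_gt0 ?exprn_gt0. Qed.

Definition reps (K : set Q2) : {fset Q2} := fset_set (coset_pt j @` K).

Lemma repsP K c : compact K -> reflect (exists2 x, K x & coset_pt j x = c) (c \in reps K).
Proof.
move=> cK; rewrite /reps in_fset_set; last exact: finite_coset_pt.
by apply: (iffP idP) => [/set_mem[x Kx <-]|[x Kx <-]]; [exists x|apply/mem_set; exists x].
Qed.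

Lemma haar_bigcup_coset (A : {fset Q2}) : (forall c, c \in A -> coset_pt j c = c) ->
  theta (\bigcup_(c in [set` A]) coset j c) = (#|` A|%:R * v)%:E.
Proof.
move=> Ac; rewrite measure_fin_bigcup//; last 2 first.
- move=> c c' /= /Ac Ec /Ac Ec' [x [xc xc']]; rewrite -Ec -Ec'; apply: coset_pt_eq.
  by rewrite (coset_eq xc); exact: coset_sym.
- by move=> c _; exact: measurable_coset.
rewrite fsbig_finite//= set_fsetK.
rewrite (eq_bigr (fun=> v%:E)); last by move=> c _; exact: haar_coset_vol.
by rewrite sumEFin big_const_seq count_predT iter_addr_0 mulr_natl.
Qed.

Definition inner_reps (K : set Q2) : {fset Q2} := [fset c in reps K | `[< (coset j c `<=` K)%classic >]]%fset.

Lemma reps_idem K c : compact K -> c \in reps K -> coset_pt j c = c.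
Proof. by move=> cK /(repsP _ cK)[x _ <-]; exact: coset_pt_idem. Qed.

Lemma inner_repsP K c : c \in inner_reps K <-> c \in reps K /\ coset j c `<=` K.
Proof.
rewrite /inner_reps !inE /=; split=> [/andP[? /asboolP]//|[? ?]].
by apply/andP; split => //; exact/asboolP.
Qed.

Lemma compact_closed_Q2 (K : set Q2) : compact K -> closed K.
Proof.
apply: compact_closed => x y xy; apply/eqP; rewrite -subr_eq0; apply/eqP/absQ2_eq0/eqP.
rewrite eq_le absQ2_ge0 andbT; apply/ler_addgt0Pr => e e0; rewrite add0r ltW//.
have [z [zx zy]] : coset (- (Num.bound e^-1)%:Z) x `&` coset (- (Num.bound e^-1)%:Z) y !=set0.
  by apply: xy; apply/nbhs_Q2; exists (Num.bound e^-1).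
apply: le_lt_trans (_ : 2 ^ (- (Num.bound e^-1)%:Z) < e); last first.
  by rewrite -exprnN realalg.RealAlg.upper_nthrootVP.
by apply: Bz_trans zy; exact/BzC.
Qed.

Lemma measurable_compact (K : set Q2) : compact K -> measurable (K : set (borel Q2)).
Proof.
move=> /compact_closed_Q2 cK; rewrite -[X in measurable X]setCK; apply: measurableC.
by apply: sub_sigma_algebra; exact: closed_openC.
Qed.

Lemma haar_le_reps K : compact K -> fine (theta K) <= #|` reps K|%:R * v.
Proof.
move=> cK; rewrite -lee_fin fineK ?haar_compact_fin// -haar_bigcup_coset; last first.
  by move=> c; exact: reps_idem.
apply: le_measure; rewrite ?inE; first exact: measurable_compact.
  by apply: fin_bigcup_measurable => // c _; exact: measurable_coset.
move=> x Kx; exists (coset_pt j x); first by apply/repsP => //; exists x.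
exact/coset_sym/coset_ptP.
Qed.

Lemma inner_reps_le_haar K : compact K -> #|` inner_reps K|%:R * v <= fine (theta K).
Proof.
move=> cK; rewrite -lee_fin fineK ?haar_compact_fin// -haar_bigcup_coset; last first.
  by move=> c /inner_repsP[+ _]; exact: reps_idem.
apply: le_measure; rewrite ?inE; last by move=> x [c /= /inner_repsP[_ cK'] /cK'].
  by apply: fin_bigcup_measurable => // c _; exact: measurable_coset.
exact: measurable_compact.
Qed.

Lemma inner_reps_sub K : (inner_reps K `<=` reps K)%fset.
Proof. by apply/fsubsetP => c /inner_repsP[]. Qed.

(** The set [Bz j + K] is the union of the cosets that meet [K], and [Bz j] plus the complement of
    [K] is the union of those not contained in [K]. Cosets with both properties therefore lie in the
    boundary. *)
Lemma boundary_ge K : compact K ->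
  (#|` reps K|%:R - #|` inner_reps K|%:R) * v <= fine (theta (boundary (Bz j) K)).
Proof.
move=> cK.
have -> : #|` reps K|%:R - #|` inner_reps K|%:R = #|` (reps K `\` inner_reps K)%fset|%:R :> R.
  rewrite cardfsD natrB ?fsubset_leq_card ?fsubsetIl//.
  by rewrite (fsetIidPr (inner_reps_sub K)).
have openKA A : open (add_sets (Bz j) A).
  apply: open_Q2 => x [u ju [y Ay <-]]; exists 0%N => z zx.
  exists (z - y); last by exists y => //; rewrite subrK.
  have -> : z - y = (z - (u + y)) + u by rewrite opprD addrA addrAC subrK.
  by apply: BzD => //; apply: Bz_le zx.
have mb : measurable (boundary (Bz j) K : set (borel Q2)).
  apply: measurableI; first exact: sub_sigma_algebra.
  rewrite -[X in measurable X]setCK; apply: measurableC.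
  by apply: sub_sigma_algebra; apply: closed_openC; exact: closed_closure.
have mA (A : {fset Q2}) : measurable (\bigcup_(c in [set` A]) coset j c : set (borel Q2)).
  by apply: fin_bigcup_measurable => // c _; exact: measurable_coset.
have bfin : theta (boundary (Bz j) K) \is a fin_num.
  rewrite ge0_fin_numE//.
  apply: (@le_lt_trans _ _ (theta (\bigcup_(c in [set` reps K]) coset j c))).
    apply: le_measure; rewrite ?inE//; move=> _ [[u ju [y Ky <-]] _].
    exists (coset_pt j y); first by apply/repsP => //; exists y.
    apply: (@Bz_trans _ y); first by rewrite addrK.
    exact/coset_sym/coset_ptP.
  by rewrite haar_bigcup_coset ?ltry// => c; exact: reps_idem.
rewrite -lee_fin fineK// -haar_bigcup_coset; last first.
  by move=> c; rewrite inE => /andP[_]; exact: reps_idem.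
apply: le_measure; rewrite ?inE// => x [c /=].
rewrite inE => /andP[cI cR] xc; split.
  have /(repsP _ cK)[y Ky yc] := cR.
  exists (x - y); last by exists y => //; rewrite subrK.
  by apply: (Bz_trans xc); rewrite -yc; exact: coset_ptP.
apply: subset_closure.
have [y cy nKy] : exists2 y, coset j c y & ~ K y.
  apply: contrapT => H; move/negP : cI; apply; apply/inner_repsP; split => // y cy.
  by apply: contrapT => nKy; apply: H; exists y.
exists (x - y); last by exists y => //; rewrite subrK.
by apply: (Bz_trans xc); exact/BzC.
Qed.

End averaging.

Lemma cvg_dist_bound (R : realType) (x y : nat -> R) (l : R) :
  (forall n, `|x n - l| <= y n) -> y @ \oo --> (0 : R) -> x @ \oo --> l.
Proof.
move=> xy /cvgrPdist_lt y0; apply/cvgrPdist_lt => e /y0[N _ NP].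
exists N => // n /NP /=; rewrite sub0r normrN => yn.
by rewrite distrC (le_lt_trans (xy n))// (le_lt_trans _ yn)// ler_norm.
Qed.

Section van_hove.
Variables (R : realType) (theta : {measure set (borel Q2) -> \bar R}).
Hypothesis htheta : haar theta.
Local Notation t0 := (unit_vol theta).
Variable F : nat -> set Q2.
Hypothesis hF : van_hove theta F.
Local Notation vol n := (fine (theta (F n))).

Let cF n : compact (F n). Proof. by have [] := hF. Qed.
Let vol_gt0 n : 0 < vol n.
Proof. by have [_ h _] := hF; rewrite fine_gt0// h /= -ge0_fin_numE// haar_compact_fin. Qed.
Let v0 j : 0 < t0 * 2 ^+ j. Proof. by rewrite mulr_gt0 ?exprn_gt0// unit_vol_gt0. Qed.

Definition defect (j n : nat) : R := (#|` reps j (F n)|%:R - #|` inner_reps j (F n)|%:R) / vol n.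

Lemma defect_ge0 j n : 0 <= defect j n.
Proof.
rewrite divr_ge0 ?(ltW (vol_gt0 n))// subr_ge0 ler_nat.
exact/fsubset_leq_card/inner_reps_sub.
Qed.

Lemma defect_cvg j : defect j @ \oo --> (0 : R).
Proof.
have [_ _ /(_ _ (@compact_Bz j)) h] := hF.
apply: (@cvg_dist_bound _ _ (fun n => (fine (theta (boundary (Bz j) (F n))) / vol n) * (t0 * 2 ^+ j)^-1)).
  move=> n; rewrite subr0 ger0_norm ?defect_ge0// /defect mulrAC.
  by rewrite ler_wpM2r ?invr_ge0 ?(ltW (vol_gt0 n))// ler_pdivlMr// boundary_ge.
by rewrite -(mul0r ((t0 * 2 ^+ j)^-1)); apply: cvgMl h.
Qed.

(** If no coset of [Bz j] lay inside [F n], the defect would be at least 1 / (t0 2^j), because the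
    cosets meeting [F n] cover it. As the defect tends to 0, [F n] eventually contains such a coset,
    so its volume is at least t0 2^j. *)
Lemma inv_vol_cvg : (fun n => (vol n)^-1) @ \oo --> (0 : R).
Proof.
apply/cvgrPdist_lt => e e0.
pose j := Num.bound ((t0 * e)^-1).
have /cvgrPdist_lt/(_ ((t0 * 2 ^+ j)^-1)) := defect_cvg j.
rewrite invr_gt0 => /(_ (v0 j))[N _ NP]; exists N => // n /NP /=.
rewrite !sub0r !normrN ger0_norm ?defect_ge0// gtr0_norm ?invr_gt0// => dn.
have t00 := unit_vol_gt0 htheta.
have I1 : (0 < #|` inner_reps j (F n)|)%N.
  rewrite lt0n; apply/eqP => I0; move: dn; rewrite /defect I0 subr0.
  rewrite ltr_pdivrMr// mulrC ltr_pdivlMr// ltNge => /negP; apply.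
  exact: haar_le_reps.
have := inner_reps_le_haar htheta j (@cF n).
have : t0 * 2 ^+ j <= #|` inner_reps j (F n)|%:R * (t0 * 2 ^+ j).
  by rewrite ler_peMl ?(ltW (v0 j))// ler1n.
move=> /le_trans h /h {}h; apply: le_lt_trans (_ : (t0 * 2 ^+ j)^-1 < e).
  by rewrite lef_pV2 ?posrE.
have : (t0 * e)^-1 < 2 ^+ j by apply: upper_nthrootP.
rewrite -[ltLHS]mul1r ltr_pdivrMr ?mulr_gt0// => h2.
rewrite -[ltLHS]mul1r ltr_pdivrMr//.
by move: (2 ^+ j) h2 => p h2; rewrite (_ : e * (t0 * p) = p * (t0 * e))//; ring.
Qed.

(* Cosets that lie inside [F n] and avoid the finitely many exceptional ones all
   contribute [T]; the others are asymptotically negligible. *)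
Lemma averaging (j : nat) (bad : seq Q2) (u : nat -> Q2 -> R) (M T : R) :
  (forall n c, `|u n c| <= M) ->
  (forall n c, coset_pt j c = c -> coset j c `<=` F n ->
    (forall b, b \in bad -> ~ Bz j (c - b)) -> u n c = T) ->
  (fun n => (\sum_(c <- reps j (F n)) u n c) / vol n) @ \oo --> T / (t0 * 2 ^+ j).
Proof.
move=> uM uT; set v := t0 * 2 ^+ j; pose B := (size bad)%:R : R.
(* Each coset that is not inner or is bad costs at most M + |T|; the last term accounts for counting
   cosets instead of measuring volume. *)
pose E n := (M + `|T|) * (defect j n + B * (vol n)^-1) + `|T| * defect j n.
have E0 : E @ \oo --> (0 : R).
  have -> : (0 : R) = (M + `|T|) * (0 + B * 0) + `|T| * 0 by rewrite !mulr0 !addr0 mulr0.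
  by apply: cvgD; apply: cvgMr; [apply: cvgD; [|apply: cvgMr; exact: inv_vol_cvg]|]; exact: defect_cvg.
apply: cvg_dist_bound E0 => n.
have MT0 : 0 <= M + `|T| by rewrite addr_ge0// (le_trans _ (uM n 0)).
set P := reps j (F n); set I := inner_reps j (F n).
pose bb := [fset c in P | c \in [seq coset_pt j b | b <- bad]]%fset.
have bbB : #|` bb|%:R <= B.
  rewrite ler_nat -(size_map (coset_pt j)); apply: uniq_leq_size; first exact: fset_uniq.
  by move=> c; rewrite !inE /= => /andP[].
have main : `|\sum_(c <- P) u n c - T * #|` P|%:R| <= (M + `|T|) * ((#|` P|%:R - #|` I|%:R) + B).
  have -> : T * #|` P|%:R = \sum_(c <- P) T.
    by rewrite big_const_seq count_predT iter_addr_0 mulr_natr.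
  rewrite -sumrB; apply: le_trans (ler_norm_sum _ _ _) _.
  apply: (@le_trans _ _ (\sum_(c <- P) (M + `|T|) * ((c \notin I)%:R + (c \in bb)%:R))).
    rewrite big_seq [leRHS]big_seq; apply: ler_sum => c cP.
    have [cI|cI] := boolP (c \in I); last first.
      apply: le_trans (ler_normB _ _) _; apply: le_trans (lerD (uM n c) (lexx _)) _.
      by rewrite ler_peMr// lerDl.
    have [cb|cb] := boolP (c \in bb).
      apply: le_trans (ler_normB _ _) _; apply: le_trans (lerD (uM n c) (lexx _)) _.
      by rewrite add0r mulr1.
    rewrite addr0 mulr0 uT ?subrr ?normr0//.
    - exact: reps_idem (@cF n) cP.
    - by have /inner_repsP[] := cI.
    move=> b bbad cb'; move/negP : cb; apply; rewrite !inE /= cP /=.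
    apply/mapP; exists b => //; rewrite -(reps_idem (@cF n) cP).
    exact/coset_pt_eq/coset_sym.
  rewrite -mulr_sumr ler_wpM2l// big_split /= lerD//.
    rewrite -natr_sum -natrB ?ler_nat; last exact/fsubset_leq_card/inner_reps_sub.
    rewrite -big_mkcond /= sum1_count -size_filter.
    have -> : (#|` P| - #|` I|)%N = #|` (P `\` I)%fset|.
      by rewrite cardfsD (fsetIidPr (inner_reps_sub j (F n))).
    apply: uniq_leq_size; first by rewrite filter_uniq ?fset_uniq.
    by move=> c; rewrite mem_filter !inE.
  apply: le_trans bbB; rewrite -natr_sum ler_nat -big_mkcond /= sum1_count -size_filter.
  by apply: uniq_leq_size; rewrite ?filter_uniq ?fset_uniq// => c; rewrite mem_filter => /andP[].
have h1 : `|#|` P|%:R / vol n - v^-1| <= defect j n.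
  have le1 := haar_le_reps htheta j (@cF n); have le2 := inner_reps_le_haar htheta j (@cF n).
  have vn := vol_gt0 n; have vj := v0 j.
  have -> : #|` P|%:R / vol n - v^-1 = (#|` P|%:R * v - vol n) / (vol n * v).
    by field; rewrite !gt_eqF.
  rewrite ger0_norm; last by rewrite divr_ge0 ?subr_ge0// ltW// (mulr_gt0 vn vj).
  rewrite ler_pdivrMr ?(mulr_gt0 vn vj)// /defect mulrA divfK ?gt_eqF// mulrBl.
  by rewrite lerD2l lerN2.
rewrite /E -[X in `|X|](subrKA (T * (#|` P|%:R / vol n))); apply: le_trans (ler_normD _ _) _.
apply: lerD.
  rewrite mulrA -mulrBl normrM [X in _ * X]ger0_norm ?invr_ge0 ?(ltW (vol_gt0 n))//.
  rewrite ler_pdivrMr//; apply: le_trans main _; rewrite -mulrA ler_wpM2l//.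
  by rewrite mulrDl /defect divfK ?gt_eqF// divfK ?gt_eqF.
by rewrite -mulrBr normrM ler_wpM2l.
Qed.

End van_hove.

Lemma card_sub_seq (T : choiceType) (A : set T) (s : seq T) :
  A `<=` [set` s] -> finite_set A /\ (#|` fset_set A| <= size s)%N.
Proof.
move=> As; have finA : finite_set A by apply: sub_finite_set As _; exact: finite_seq.
split => //; apply: uniq_leq_size; first exact: fset_uniq.
by move=> x; rewrite in_fset_set// => /set_mem/As.
Qed.

Lemma translateE (w : set Q2) g y : translate w g y <-> w (y + g).
Proof.
split=> [[x wx <-]|wyg]; first by rewrite subrK.
by exists (y + g) => //; rewrite addrK.
Qed.

Definition block (j : nat) (p : Q2) : set Q2 := [set p + grid j i | i in `I_(2 ^ j)].

Definition all_blocks_but (w : set Q2) (j : nat) (bad : seq Q2) :=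
  forall x, (forall b, b \in bad -> ~ Bz j (x - b)) ->
  exists p, w `&` coset j x = block j p.

Lemma grid0 j : grid j 0 = 0.
Proof. by rewrite /grid /coset_rep mul0r Q2_of_rat0. Qed.

(** * Sets that consist of translated blocks *)

Section hierarchical.
Variable w : set Q2.
Hypothesis w_ex : forall x, exists2 g, w g & Bz 0 (x - g).
Hypothesis w_uniq : forall g g', w g -> w g' -> Bz 0 (g - g') -> g = g'.

Lemma w_delone : delone w.
Proof.
split.
  exists (Bz 0); first exact: compact_Bz.
  apply/seteqP; split => // x _; have [g wg xg] := w_ex x.
  by exists (x - g) => //; exists g => //; rewrite subrK.
exists (Bz 0); split.
- by apply/nbhs_Q2; exists 0%N => y; rewrite subr0.
- by rewrite precompact_closed; [exact: compact_Bz|exact: closed_Bz].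
- move=> g g' wg wg' [_ [[u u0 <-] [u' u'0 E]]]; apply: w_uniq => //.
  have -> : g - g' = u' - u.
    by apply/eqP; rewrite subr_eq addrAC eq_sym subr_eq E addrC.
  exact: BzB.
Qed.

Lemma w_pt_ex x : exists g, w g /\ Bz 0 (x - g).
Proof. by have [g] := w_ex x; exists g. Qed.

Definition w_pt x : Q2 := xget 0 [set g | w g /\ Bz 0 (x - g)].

Lemma w_ptP x : w (w_pt x) /\ Bz 0 (x - w_pt x).
Proof. exact: (@xgetPex _ 0 [set g | w g /\ Bz 0 (x - g)]) (w_pt_ex x). Qed.

Definition coset_pts (j : nat) (x : Q2) : seq Q2 :=
  [seq w_pt (x + grid j i) | i <- iota 0 (2 ^ j)].

Lemma size_coset_pts j x : size (coset_pts j x) = (2 ^ j)%N.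
Proof. by rewrite size_map size_iota. Qed.

Lemma coset_ptsP (j : nat) x : w `&` coset j x `<=` [set` coset_pts j x].
Proof.
move=> g [wg /(@Bz_cover j j)[i il]]; rewrite subrr => gi.
apply/mapP; exists i; first by rewrite mem_iota.
have [wp xp] := w_ptP (x + grid j i); apply: w_uniq => //.
by apply: Bz_trans xp; rewrite opprD addrA.
Qed.

Definition base_patch (j i : nat) : set Q2 := translate (block j 0) (grid j i).

Lemma patch_restrict (j : nat) g : translate w g `&` Bz j = translate (w `&` coset j g) g.
Proof.
apply/seteqP; split => y.
  by move=> [/translateE wy jy]; apply/translateE; split => //; rewrite /coset/= addrK.
by move=> /translateE[wy]; rewrite /coset/= addrK => jy; split => //; exact/translateE.
Qed.

Lemma translate_block (j : nat) p h : translate (block j p) (p + h) = translate (block j 0) h.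
Proof.
apply/seteqP; split => y /translateE[i il E]; apply/translateE; exists i => //.
  by move: E => /eqP; rewrite addrCA (inj_eq (addrI _)) => /eqP ->; rewrite add0r.
by rewrite add0r in E; rewrite E addrCA.
Qed.

Definition patch_seq (j : nat) (bad : seq Q2) : seq (set Q2) :=
  [seq base_patch j i | i <- iota 0 (2 ^ j)] ++
  flatten [seq [seq translate w g `&` Bz j | g <- coset_pts j b] | b <- bad].

(** In a regular coset the patch at [g] depends only on the index of [g] within its block. Each
    exceptional coset has at most 2^j points and thus at most that many further patches. *)
Lemma patches_sub (j : nat) bad : all_blocks_but w j bad ->
  patches w (Bz j) `<=` [set` patch_seq j bad].
Proof.
move=> H _ [g wg <-]; rewrite /patch_seq /= mem_cat.
have [[b bb gb]|nb] := pselect (exists2 b, b \in bad & Bz j (g - b)).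
  apply/orP; right; apply/flatten_mapP; exists b => //; apply/mapP; exists g => //.
  exact: coset_ptsP.
apply/orP; left; have [b bb|p E] := H g; first by move=> gb; apply: nb; exists b.
have : block j p g by rewrite -E; split => //; exact: coset_refl.
move=> [i il gi]; apply/mapP; exists i; first by rewrite mem_iota.
by rewrite patch_restrict E -gi translate_block.
Qed.

Lemma size_patch_seq j bad : size (patch_seq j bad) = (2 ^ j * (size bad).+1)%N.
Proof.
rewrite size_cat size_map size_iota size_flatten /shape -map_comp mulnS; congr addn.
elim: bad => [|b bad IH]; first by rewrite muln0.
by rewrite /= IH size_map size_coset_pts mulnS.
Qed.

Lemma card_patches (j : nat) bad : all_blocks_but w j bad ->
  finite_set (patches w (Bz j)) /\ (#|` fset_set (patches w (Bz j))| <= 2 ^ j * (size bad).+1)%N.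
Proof. by move=> /patches_sub/card_sub_seq; rewrite size_patch_seq. Qed.

Hypothesis w_blocks : forall j, exists bad, all_blocks_but w j bad.

Lemma w_flc : flc w.
Proof.
move=> A /compact_sub_Bz[j Aj]; have [bad /card_patches[fin _]] := w_blocks j.
apply: (@sub_finite_set _ _ ((fun P => P `&` A) @` patches w (Bz j))); last exact: finite_image.
move=> _ [g wg <-]; exists (translate w g `&` Bz j); first by exists g.
by rewrite -setIA (setIidr Aj).
Qed.

Section frequencies.
Variables (R : realType) (theta : {measure set (borel Q2) -> \bar R}).
Hypothesis htheta : haar theta.
Local Notation t0 := (unit_vol theta).

(** Once [A] lies in [Bz j], the patch at [g] is determined by the part of [w] in the coset of [g].
    All regular cosets inside [F n] therefore contain the same number of solutions, and [averaging]
    applies. *)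
Lemma w_upf : upf theta w.
Proof.
move=> A P cA _ [p0 Pp0] F hF.
have cF n : compact (F n) by have [] := hF.
have [j Aj] := compact_sub_Bz cA; have [bad Hbad] := w_blocks j.
pose G n := [set g | F n g /\ translate w g `&` A = P].
pose H := [set h | Bz j h /\ translate (block j 0) h `&` A = P].
(* Here [g] ranges over all of [F n], not only over [w]. A point [p0] of the non-empty patch ties
   [g] to the point [p0 + g] of [w], which makes every count finite. *)
have PA (v : set Q2) g : translate v g `&` A = P -> v (p0 + g) /\ Bz j p0.
  move=> E; have : (translate v g `&` A) p0 by rewrite E.
  by move=> [/translateE ? /Aj].
pose Gs c := [seq x - p0 | x <- coset_pts j c].
have GsP n c : G n `&` coset j c `<=` [set` Gs c].
  move=> g [[_ /PA[wg jp0]] cg]; apply/mapP; exists (p0 + g); last by rewrite addrC addKr.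
  apply: coset_ptsP; split => //; rewrite /coset/= -addrA; exact: BzD.
have finG n : finite_set (G n).
  apply: (@sub_finite_set _ _ (\bigcup_(c in [set` reps j (F n)]) (G n `&` coset j c))).
    move=> g Gg; exists (coset_pt j g).
      by apply/(repsP _ _ (cF n)); exists g => //; exact: Gg.1.
    by split => //; exact/coset_sym/coset_ptP.
  apply: bigcup_finite; first exact: finite_fset.
  by move=> c _; have [] := card_sub_seq (GsP n c).
pose Hs := [seq grid j i - p0 | i <- iota 0 (2 ^ j)].
have [finH _] : finite_set H /\ (#|` fset_set H| <= size Hs)%N.
  apply: card_sub_seq => h [_ /PA[[i il E] _]]; apply/mapP; exists i; first by rewrite mem_iota.
  by rewrite add0r in E; rewrite E addrC addKr.
pose u n c : R := (size [seq x <- fset_set (G n) | coset_pt j x == c])%:R.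
pose T : R := #|` fset_set H|%:R.
have main : (fun n => (\sum_(c <- reps j (F n)) u n c) / fine (theta (F n))) @ \oo --> T / (t0 * 2 ^+ j).
  apply: (averaging htheta hF (bad := bad) (M := (2 ^ j)%:R)).
  - move=> n c; rewrite ger0_norm// ler_nat.
    rewrite -[(2 ^ j)%N](_ : size (Gs c) = _); last by rewrite size_map size_coset_pts.
    apply: uniq_leq_size; first by rewrite filter_uniq ?fset_uniq.
    move=> x; rewrite mem_filter in_fset_set// => /andP[/eqP xc /set_mem Gx].
    by apply: (GsP n); split => //; rewrite -xc; exact/coset_sym/coset_ptP.
  - move=> n c cc cF' nb; congr (_%:R); have [p E] := Hbad c nb.
    have pc : coset j c p.
      have : block j p p by exists 0%N; rewrite ?grid0 ?addr0//= expn_gt0.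
      by rewrite -E => -[].
    rewrite -[RHS](size_map (fun h => p + h)); apply: perm_size; apply: uniq_perm.
    + by rewrite filter_uniq ?fset_uniq.
    + by rewrite map_inj_uniq ?fset_uniq//; exact: addrI.
    have key g : coset j c g -> translate w g `&` A = translate (block j 0) (g - p) `&` A.
      move=> cg; rewrite -(translate_block j p) [p + _]addrC subrK -E (coset_eq cg).
      by rewrite -[A in LHS](setIidr Aj) setIA patch_restrict.
    move=> g; rewrite mem_filter in_fset_set//; apply/andP/mapP.
      move=> [/eqP gc /set_mem[Fg Pg]].
      have cg : coset j c g by rewrite -gc; exact/coset_sym/coset_ptP.
      exists (g - p); last by rewrite addrC subrK.
      rewrite in_fset_set//; apply/mem_set; split; last by rewrite -key.
      by apply: (Bz_trans cg); exact/BzC.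
    move=> [h]; rewrite in_fset_set// => /set_mem[jh Ph] ->.
    have cph : coset j c (p + h) by rewrite /coset/= addrAC; exact: BzD.
    split; first by apply/eqP; rewrite -[RHS]cc; exact/esym/coset_pt_eq.
    by apply/mem_set; split; [exact: cF'|rewrite key// addrC addKr].
apply: (cvgP (T / (t0 * 2 ^+ j))); apply: cvg_trans main; apply: near_eq_cvg.
near=> n; congr (_ / _); rewrite /u -natr_sum; congr (_%:R).
have := @sum_fibers nat _ _ (coset_pt j) (fset_set (G n)) (reps j (F n)) (fun=> 1%N) (fset_uniq _).
rewrite sum1_size => -> //; last first.
  move=> x; rewrite in_fset_set// => /set_mem[Fx _].
  by apply/(repsP _ _ (cF n)); exists x.
by apply: eq_bigr => c _; rewrite sum1_count size_filter.
Unshelve. all: by end_near. Qed.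

Lemma cvg_complex (z : nat -> Cx R) (l : R[i]) :
  (fun n => complex.Re (z n)) @ \oo --> complex.Re l ->
  (fun n => complex.Im (z n)) @ \oo --> complex.Im l -> z @ \oo --> (l : Cx R).
Proof.
move=> /cvgrPdist_lt zr /cvgrPdist_lt zi; apply/cvgrPdist_lt => e e0.
have er : e = ((complex.Re e)%:C)%C.
  by move: e0; case: e => a b; rewrite ltcE /= => /andP[/eqP -> ?].
move: e0; rewrite er ltcR => e0; have e20 : 0 < complex.Re e / 2 by rewrite divr_gt0.
have [N1 _ H1] := zr _ e20; have [N2 _ H2] := zi _ e20.
exists (maxn N1 N2) => // n /=; rewrite geq_max => /andP[/H1/= h1 /H2/= h2].
rewrite normC_real ltcR; apply: le_lt_trans (normc_le_ReIm _) _.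
by rewrite Re_sub Im_sub /= [ltRHS]splitr ltrD.
Qed.

Lemma normc_sum_seq (I : Type) (s : seq I) (Pr : pred I) (g : I -> R[i]) (M : R) :
  (forall i, normc (g i) <= M) ->
  normc (\sum_(i <- s | Pr i) g i) <= (size [seq i <- s | Pr i])%:R * M.
Proof.
move=> gM; rewrite -big_filter; elim: [seq i <- s | Pr i] => [|a t IH].
  by rewrite big_nil normc0 mul0r.
rewrite big_cons; apply: le_trans (le_normcD _ _) _.
by rewrite /= -[(size t).+1]add1n natrD mulrDl mul1r lerD.
Qed.

(** Since [f] vanishes off [Bz j], only pairs in a common coset contribute, and every regular coset
    contributes the double sum [D] over [S_j]. Divided by the volume t0 2^j of a coset, this is the
    integral against [gamma] by [Cintegral_gamma]. *)
Lemma w_autocorrelation : unique_autocorrelation theta w (gamma htheta).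
Proof.
split; first exact: gamma_radon.
move=> F hF f Cf; have [cf _] := Cf; have [j f0] := Cc_support Cf.
have [M fM] := continuousC_bounded cf f0; have [bad Hbad] := w_blocks j.
have M0 : 0 <= M by rewrite (le_trans _ (fM 0))// normc_ge0.
have cF n : compact (F n) by have [] := hF.
pose W n := fset_set (F n `&` w).
have finW n : finite_set (F n `&` w).
  apply: (@sub_finite_set _ _ (\bigcup_(c in [set` reps j (F n)]) (w `&` coset j c))).
    move=> g [Fg wg]; exists (coset_pt j g); first by apply/(repsP _ _ (cF n)); exists g.
    by split => //; exact/coset_sym/coset_ptP.
  apply: bigcup_finite; first exact: finite_fset.
  by move=> c _; have [] := card_sub_seq (@coset_ptsP j c).
pose U n c : R[i] := \sum_(x <- W n | coset_pt j x == c) \sum_(y <- W n | coset_pt j y == c) f (x - y).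
pose D : R[i] := \sum_(a < 2 ^ j) \sum_(b < 2 ^ j) f (grid j a - grid j b).
have WP n x : x \in W n <-> F n x /\ w x.
  by rewrite /W in_fset_set//; split=> [/set_mem//|?]; exact/mem_set.
have sizeW n c : (size [seq x <- W n | coset_pt j x == c] <= 2 ^ j)%N.
  rewrite -(size_coset_pts j c); apply: uniq_leq_size; first by rewrite filter_uniq ?fset_uniq.
  move=> x; rewrite mem_filter => /andP[/eqP xc /WP[Fx wx]].
  by apply: coset_ptsP; split => //; rewrite -xc; exact/coset_sym/coset_ptP.
have boundU n c : normc (U n c) <= (2 ^ j)%:R * ((2 ^ j)%:R * M).
  apply: le_trans (@normc_sum_seq _ _ _ _ ((2 ^ j)%:R * M) _) _; last first.
    by rewrite ler_wpM2r ?mulr_ge0// ler_nat.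
  move=> x; apply: le_trans (@normc_sum_seq _ _ _ _ M _) _ => //.
  by rewrite ler_wpM2r// ler_nat.
have goodU n c : coset_pt j c = c -> coset j c `<=` F n ->
    (forall b, b \in bad -> ~ Bz j (c - b)) -> U n c = D.
  move=> cc cF' nb; have [p E] := Hbad c nb.
  have pW : perm_eq [seq x <- W n | coset_pt j x == c] [seq p + grid j i | i <- iota 0 (2 ^ j)].
    apply: uniq_perm; first by rewrite filter_uniq ?fset_uniq.
      rewrite map_inj_in_uniq ?iota_uniq// => a b; rewrite !mem_iota /= => al bl /addrI ab.
      apply: (@Bz_coset_rep_uniq j%:Z j) => //; rewrite -/(grid j a) -/(grid j b) ab !subrr.
      exact: Bz0.
    move=> x; rewrite mem_filter; apply/andP/mapP.
      move=> [/eqP xc /WP[Fx wx]]; have : block j p x.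
        by rewrite -E; split => //; rewrite -xc; exact/coset_sym/coset_ptP.
      by move=> [i il <-]; exists i; rewrite ?mem_iota.
    move=> [k]; rewrite mem_iota /= => kl ->.
    have [wx cx] : (w `&` coset j c) (p + grid j k) by rewrite E; exists k.
    split; last by apply/WP; split => //; exact: cF'.
    by apply/eqP; rewrite -[RHS]cc; exact/esym/coset_pt_eq.
  have sumE (g : Q2 -> R[i]) : \sum_(x <- W n | coset_pt j x == c) g x = \sum_(i < 2 ^ j) g (p + grid j i).
    have iE : iota 0 (2 ^ j) = index_iota 0 (2 ^ j) by rewrite /index_iota subn0.
    by rewrite -big_filter (perm_big _ pW) big_map iE big_mkord.
  rewrite /U sumE; apply: eq_bigr => a _; rewrite sumE; apply: eq_bigr => b _.
  by rewrite opprD addrACA subrr add0r.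
have totalE n : \sum_(p \in (F n `&` w) `*` (F n `&` w)) f (p.1 - p.2) = \sum_(c <- reps j (F n)) U n c.
  have memW x : x \in W n -> coset_pt j x \in reps j (F n).
    by move=> /WP[Fx _]; apply/(repsP _ _ (cF n)); exists x.
  rewrite -(pair_fsbig _ (fun x y : Q2 => f (x - y)) (finW n) (finW n)) fsbig_finite//= -/(W n).
  rewrite (sum_fibers (h := coset_pt j) _ (fset_uniq (reps j (F n))) memW).
  apply: eq_bigr => c _; apply: eq_bigr => x /eqP xc.
  rewrite fsbig_finite//= -/(W n) (bigID (fun y => coset_pt j y == c)) /= [X in _ + X]big1 ?addr0//.
  move=> y yc; apply: f0 => xy; move/negP : yc; apply; by rewrite -xc; apply/coset_ptE.
have ReM (r : R) (z : R[i]) : complex.Re (r%:C%C * z) = r * complex.Re z.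
  by case: z => a b /=; rewrite mul0r subr0.
have ImM (r : R) (z : R[i]) : complex.Im (r%:C%C * z) = r * complex.Im z.
  by case: z => a b /=; rewrite mul0r addr0.
have natE : (2 ^ j)%:R * t0 = t0 * 2 ^+ j by rewrite natrX mulrC.
apply: cvg_complex; rewrite (Cintegral_gamma htheta f0) -/D natE ?ReM ?ImM.
  have E : (fun n => complex.Re (((fine (theta (F n)))^-1)%:C%C *
      \sum_(p \in (F n `&` w) `*` (F n `&` w)) f (p.1 - p.2))) =
    (fun n => (\sum_(c <- reps j (F n)) complex.Re (U n c)) / fine (theta (F n))).
    by apply/funext => n; rewrite ReM totalE mulrC (raddf_sum (@complex.Re R)).
  rewrite E mulrC; apply: (averaging htheta hF (u := fun n c => complex.Re (U n c)) (bad := bad)).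
    by move=> n c; apply: le_trans (Re_le_normc _) (boundU n c).
  by move=> n c cc cF' nb; rewrite goodU.
have E : (fun n => complex.Im (((fine (theta (F n)))^-1)%:C%C *
    \sum_(p \in (F n `&` w) `*` (F n `&` w)) f (p.1 - p.2))) =
  (fun n => (\sum_(c <- reps j (F n)) complex.Im (U n c)) / fine (theta (F n))).
  by apply/funext => n; rewrite ImM totalE mulrC (raddf_sum (@complex.Im R)).
rewrite E mulrC; apply: (averaging htheta hF (u := fun n c => complex.Im (U n c)) (bad := bad)).
  by move=> n c; apply: le_trans (Im_le_normc _) (boundU n c).
by move=> n c cc cF' nb; rewrite goodU.
Qed.

Lemma w_pure_point_diffractive : pure_point_diffractive theta w.
Proof.
exists (gamma htheta), (gammahat theta); split.
- exact: w_autocorrelation.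
- exact: gamma_fourier_transform.
- exact: gammahat_pure_point.
Qed.

End frequencies.
End hierarchical.

(** * Construction of the Delone set *)

Section construction.
Variable c : nat -> nat.
Hypothesis c_gt : forall k, (k.+1 < c k)%N.
Hypothesis c_nd : forall k, (c k <= c k.+1)%N.

Lemma c_le k l : (k <= l)%N -> (c k <= c l)%N.
Proof. by move=> kl; apply: (homo_leq leqnn leq_trans c_nd). Qed.

(* The cosets of 2^-k Z_2 through the points [2 ^- p], [c k <= p < c k.+1], are shifted by
   [p]; [odd_at p] shows that they are disjoint for different [p]. *)
Definition special (k p : nat) (h : rat) :=
  (c k <= p < c k.+1)%N /\ (h - 2 ^- p) * 2 ^+ k \is a Num.int.

(** The default pair of [xget] gives shift 0 to the points that lie in no special coset. *)
Definition shift (h : rat) : nat :=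
  (xget (0%N, 0%N) [set kp : nat * nat | special kp.1 kp.2 h]).2.

Definition unit_dyadic : set rat := [set h | dyadic h /\ 0 <= h < 1].

Definition omega : set Q2 := [set Q2_of_rat (h + (shift h)%:R) | h in unit_dyadic].

(** In lowest terms the denominator of [h] is exactly 2^p, that is, [h] has 2-adic valuation -p. *)
Definition odd_at (p : nat) (h : rat) := exists m : int, h * 2 ^+ p = (m * 2 + 1)%:~R.

Lemma odd_at_uniq p p' h : odd_at p h -> odd_at p' h -> p = p'.
Proof.
wlog : p p' / (p <= p')%N.
  move=> H h1 h2; have [/H|/ltnW/H] := leqP p p'; first exact.
  by move=> H'; apply/esym/H'.
rewrite leq_eqVlt => /orP[/eqP//|pp'] [m E] [m' E'].
have : h * 2 ^+ p' = ((m * 2 + 1) * 2 ^+ (p' - p).-1 * 2)%:~R.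
  rewrite -mulrA -exprSr prednK ?subn_gt0// intrM -E rmorphXn /= -mulrA -exprD.
  by rewrite subnKC// ltnW.
by rewrite E' => /intr_inj; set q := _ * 2 ^+ _; lia.
Qed.

Lemma special_lt k p h : special k p h -> (k.+1 < p)%N.
Proof. by move=> [/andP[ckp _] _]; apply: leq_trans ckp. Qed.

(** An element of 2^-k Z is added to 2^-p with p > k, which leaves the denominator 2^p unchanged. So
    [h] determines [p], and then [k], as the intervals between consecutive values of [c] are
    disjoint. *)
Lemma special_odd k p h : special k p h -> odd_at p h.
Proof.
move=> sp; have kp := special_lt sp; have [_ /intrP[m E]] := sp.
exists (m * 2 ^+ (p - k).-1).
have -> : m * 2 ^+ (p - k).-1 * 2 = m * 2 ^+ (p - k).
  by rewrite -mulrA -exprSr prednK// subn_gt0 ltnW// ltnW.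
rewrite intrD intrM rmorphXn /= -E -mulrA -exprD subnKC; last by rewrite ltnW// ltnW.
by rewrite mulrBl mulVf ?expf_neq0// subrK.
Qed.

Lemma special_uniq k k' p p' h : special k p h -> special k' p' h -> p = p' /\ k = k'.
Proof.
move=> s s'; have pp' := odd_at_uniq (special_odd s) (special_odd s'); split => //.
move: s s'; rewrite -pp' => -[/andP[h1 h2] _] [/andP[h1' h2'] _].
apply/eqP; rewrite eqn_leq; apply/andP; split; rewrite leqNgt; apply/negP => /c_le kk'.
  by move: (leq_trans kk' h1); rewrite leqNgt h2'.
by move: (leq_trans kk' h1'); rewrite leqNgt h2.
Qed.

Lemma shift_special k p h : special k p h -> shift h = p.
Proof.
move=> s; have h1 := @xgetPex _ (0%N, 0%N) [set kp : nat * nat | special kp.1 kp.2 h] (ex_intro _ (k, p) s).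
by have [] := special_uniq h1 s.
Qed.

Lemma shift_none h : (forall k p, ~ special k p h) -> shift h = 0%N.
Proof. by move=> H; rewrite /shift xgetPN// => -[k p]; exact: H. Qed.

Lemma shift_ext h h' : (forall k p, special k p h <-> special k p h') -> shift h = shift h'.
Proof.
move=> H; rewrite /shift; congr (xget _ _).2; apply/seteqP.
by split => -[k p] /= /H.
Qed.

Lemma dyadic_nat (n : nat) : dyadic n%:R.
Proof. by rewrite pmulrn; exact: dyadic_int. Qed.

Lemma Bz_nat (n : nat) k : (0 <= k)%R -> Bz k (Q2_of_rat n%:R).
Proof.
move=> k0; apply: (@Bz_le 0) => //; apply/Bz_dyadic; first exact: dyadic_nat.
by rewrite expr0z mulr1 pmulrn intr_int.
Qed.

Lemma Bz0_int d : dyadic d -> Bz 0 (Q2_of_rat d) -> d \is a Num.int.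
Proof. by move=> dd /Bz_dyadic-/(_ dd); rewrite expr0z mulr1. Qed.

Lemma int_small (m : int) : -1 < (m%:~R : rat) -> (m%:~R : rat) < 1 -> m = 0.
Proof. by rewrite -[-1](rmorphN1 intr) -[1](rmorph1 intr) !ltr_int; lia. Qed.

Lemma omega_ex x : exists2 g, omega g & Bz 0 (x - g).
Proof.
have [d dd xd] := Q2_dyadic_dense 0 x.
pose h := d - (Num.floor d)%:~R.
have dh : dyadic h by apply: dyadicB => //; exact: dyadic_int.
have h01 : 0 <= h < 1.
  have /andP[h1 h2] := floor_itv d.
  by rewrite /h subr_ge0 h1 /= ltrBlDr addrC -[1](rmorph1 intr) -intrD.
exists (Q2_of_rat (h + (shift h)%:R)); first by exists h.
apply: (Bz_trans xd); rewrite -Q2_of_ratB; apply/Bz_dyadic.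
  by apply: dyadicB => //; apply: dyadicD => //; exact: dyadic_nat.
rewrite expr0z mulr1 opprD addrA {1}/h subKr rpredB ?intr_int//.
by rewrite pmulrn intr_int.
Qed.

Lemma omega_uniq g g' : omega g -> omega g' -> Bz 0 (g - g') -> g = g'.
Proof.
move=> [h [dh /andP[h0 h1]] <-] [h' [dh' /andP[h0' h1']] <-].
rewrite -Q2_of_ratB => /Bz0_int H.
have /intrP[m E] : h - h' \is a Num.int.
  have {}H : h + (shift h)%:R - (h' + (shift h')%:R) \is a Num.int.
    by apply: H; apply: dyadicB; apply: dyadicD => //; exact: dyadic_nat.
  have -> : h - h' = (h + (shift h)%:R - (h' + (shift h')%:R)) + ((shift h')%:R - (shift h)%:R).
    by move: (shift h)%:R (shift h')%:R => a b; ring.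
  by rewrite rpredD// rpredB// pmulrn intr_int.
have m0 : m = 0 by apply: int_small; rewrite -E; lra.
by have -> : h = h' by apply/eqP; rewrite -subr_eq0 E m0.
Qed.

Lemma omega_dyadic : omega `<=` Q2_of_rat @` dyadic.
Proof.
move=> _ [h [dh _] <-]; exists (h + (shift h)%:R) => //.
by apply: dyadicD => //; exact: dyadic_nat.
Qed.

Definition bad_centers (j : nat) : seq Q2 := [seq Q2_of_rat (2 ^- p) | p <- iota 0 (c j)].

Lemma dyadic_expNn p : dyadic (2 ^- p).
Proof. by have := dyadic_expz (- p%:Z); rewrite -exprnN. Qed.

(** A special coset of level [k < j] has p < c k.+1 <= c j, so its centre occurs in
    [bad_centers j]. *)
Lemma special_level j k p x h : dyadic h -> (forall b, b \in bad_centers j -> ~ Bz j (x - b)) ->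
  Bz j (x - Q2_of_rat h) -> special k p h -> (j <= k)%N.
Proof.
move=> dh nb xh sp; rewrite leqNgt; apply/negP => kj; have [/andP[_ pc] hp] := sp.
apply: (nb (Q2_of_rat (2 ^- p))).
  by apply: map_f; rewrite mem_iota (leq_trans pc)// c_le.
apply: (Bz_trans xh); rewrite -Q2_of_ratB; apply/(@Bz_dyadic j%:Z).
  by apply: dyadicB => //; exact: dyadic_expNn.
exact: int_expn_le (ltnW kj) hp.
Qed.

(** By [special_level] only special cosets of level [k >= j] are met outside the bad cosets, and
    these contain the whole coset of 2^-j Z_2. *)
Lemma shift_coset j x h h' : dyadic h -> dyadic h' ->
  (forall b, b \in bad_centers j -> ~ Bz j (x - b)) ->
  Bz j (x - Q2_of_rat h) -> Bz j (x - Q2_of_rat h') -> shift h = shift h'.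
Proof.
move=> + + nb.
have H k p u v : dyadic u -> dyadic v -> Bz j (x - Q2_of_rat u) -> Bz j (x - Q2_of_rat v) ->
    special k p u -> special k p v.
  move=> du dv xu xv sp; have jk := special_level du nb xu sp; have [cp up] := sp.
  split => //; have uv : (v - u) * 2 ^+ k \is a Num.int.
    apply: (int_expn_le jk); apply/(@Bz_dyadic j%:Z); first exact: dyadicB.
    by rewrite Q2_of_ratB; apply: (@Bz_trans _ x) => //; exact/BzC.
  by rewrite -[v](subrK u) -addrA mulrDl rpredD.
by move=> dh dh' xh xh'; apply: shift_ext => k p; split; exact: H.
Qed.

Lemma omega_blocks j : all_blocks_but omega j (bad_centers j).
Proof.
move=> x nb; have p2 : 0 < (2 : rat) ^+ j by rewrite exprn_gt0.
have [d dd xd] := Q2_dyadic_dense j x.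
(* The representative of the coset in [0, 2^-j). The points h0 + i / 2^j are then exactly those of
   the coset in [0, 1), and their common shift moves them as one block. *)
pose h0 := d - (Num.floor (d * 2 ^+ j))%:~R / 2 ^+ j.
have dh0 : dyadic h0 by apply: dyadicB => //; exists (Num.floor (d * 2 ^+ j)), j.
have h0E : h0 * 2 ^+ j = d * 2 ^+ j - (Num.floor (d * 2 ^+ j))%:~R.
  by rewrite /h0 mulrBl divfK// gt_eqF.
have /andP[h00 h01] : 0 <= h0 * 2 ^+ j < 1.
  have /andP[h1 h2] := floor_itv (d * 2 ^+ j).
  by rewrite h0E subr_ge0 h1 /= ltrBlDr addrC -[1](rmorph1 intr) -intrD.
have xh0 : Bz j (x - Q2_of_rat h0).
  apply: (Bz_trans xd); rewrite -Q2_of_ratB; apply/(@Bz_dyadic j%:Z); first exact: dyadicB.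
  by rewrite -exprnP /h0 subKr divfK ?gt_eqF// intr_int.
exists (Q2_of_rat (h0 + (shift h0)%:R)); apply/seteqP; split.
  move=> _ [[h [dh /andP[hge hlt]] <-] gx].
  have xh : Bz j (x - Q2_of_rat h).
    apply/BzC; rewrite -[Q2_of_rat h](addrK (Q2_of_rat (shift h)%:R)) -Q2_of_ratD addrAC.
    by apply: BzB => //; exact: Bz_nat.
  have /intrP[m mE] : (h - h0) * 2 ^+ j \is a Num.int.
    apply/(@Bz_dyadic j%:Z); first exact: dyadicB.
    by rewrite Q2_of_ratB; apply: (@Bz_trans _ x) => //; exact/BzC.
  have hj0 : 0 <= h * 2 ^+ j by rewrite mulr_ge0// ltW.
  have hj1 : h * 2 ^+ j < 2 ^+ j by rewrite -[ltRHS]mul1r ltr_pM2r.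
  have m0 : 0 <= m.
    have : -1 < (m%:~R : rat) by rewrite -mE mulrBl; lra.
    by rewrite -[-1](rmorphN1 intr) ltr_int; lia.
  have m1 : (`|m| < 2 ^ j)%N.
    rewrite -ltz_nat gez0_abs// -(@ltr_int rat) -mE -pmulrn natrX mulrBl; lra.
  exists `|m|%N => //; rewrite /grid -Q2_of_ratD; congr Q2_of_rat.
  rewrite (shift_coset dh dh0 nb xh xh0) /coset_rep -exprnN (pmulrn 1 `|m|%N) gez0_abs// -mE.
  by rewrite mulfK ?gt_eqF// addrAC [h0 + _]addrC subrK.
move=> _ [i /= il <-]; rewrite /grid -Q2_of_ratD.
pose h := h0 + coset_rep j i.
have dh : dyadic h by apply: dyadicD => //; exact: dyadic_coset_rep.
have xh : Bz j (x - Q2_of_rat h).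
  by rewrite /h Q2_of_ratD opprD addrA; apply: BzB => //; exact: Bz_coset_rep.
have hj : h * 2 ^+ j = h0 * 2 ^+ j + i%:R.
  by rewrite /h mulrDl /coset_rep -exprnN divfK// gt_eqF.
have -> : h0 + (shift h0)%:R + coset_rep j i = h + (shift h)%:R.
  by rewrite (shift_coset dh dh0 nb xh xh0) /h addrAC.
split.
  exists h => //; split => //; apply/andP; split.
    by rewrite -(pmulr_lge0 _ p2) hj addr_ge0.
  rewrite -(ltr_pM2r p2) hj mul1r.
  have : (i%:R : rat) + 1 <= 2 ^+ j by rewrite natr1 -natrX ler_nat.
  by lra.
rewrite /coset/= Q2_of_ratD addrAC; apply: BzD; first exact/BzC.
exact: Bz_nat.
Qed.

Definition special_center (p : nat) : Q2 := Q2_of_rat (2 ^- p + p%:R).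

Definition special_patch (k p : nat) : set Q2 := translate omega (special_center p) `&` Bz k.+1.

(* The point [2 ^- k.+1 + 2 ^- p] is not shifted, whereas [2 ^- p] is: seen from the latter,
   the position of the former reveals [p]. *)
Definition marker (k p : nat) : Q2 := Q2_of_rat (2 ^- k.+1 - p%:R).

Lemma expNn_lt (m n : nat) : (m < n)%N -> (2 : rat) ^- n < 2 ^- m.
Proof. by move=> mn; rewrite ltf_pV2 ?posrE ?exprn_gt0// ltr_eXn2l. Qed.

Lemma special_center_omega k p : (c k <= p < c k.+1)%N -> omega (special_center p).
Proof.
move=> ckp; have kp : (k.+1 < p)%N by move: ckp => /andP[+ _]; exact: leq_trans.
have sp : special k p (2 ^- p) by split; rewrite // subrr mul0r.
exists (2 ^- p); last by rewrite (shift_special sp).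
split; first exact: dyadic_expNn.
rewrite invr_ge0 exprn_ge0//=; have := @expNn_lt 0 p; rewrite expr0 invr1; apply.
by apply: leq_trans kp.
Qed.

(** As p > k + 1, the number 2^-(k+1) + 2^-p has denominator 2^p, so it could only lie in the
    special coset belonging to [p], whose level is [k]; the term 2^-(k+1) puts it outside. *)
Lemma marker_omega k p : (c k <= p < c k.+1)%N -> omega (marker k p + special_center p).
Proof.
move=> ckp; have kp : (k.+1 < p)%N by move: ckp => /andP[+ _]; exact: leq_trans.
have kp' : (2 : rat) ^- p < 2 ^- k.+1 := expNn_lt kp.
rewrite /marker /special_center -Q2_of_ratD.
have -> : 2 ^- k.+1 - p%:R + (2 ^- p + p%:R) = 2 ^- k.+1 + 2 ^- p :> rat.
  by move: (2 ^- k.+1) (2 ^- p) (p%:R) => a b d; ring.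
pose h : rat := 2 ^- k.+1 + 2 ^- p.
have p2 : 0 < (2 : rat) ^- p by rewrite invr_gt0 exprn_gt0.
have h12 : 2 ^- k.+1 <= (1 / 2 : rat).
  by rewrite mul1r lef_pV2 ?posrE ?exprn_gt0// -[leLHS]expr1 ler_eXn2l.
exists h; first split.
- by apply: dyadicD; exact: dyadic_expNn.
- by rewrite /h; apply/andP; split; lra.
rewrite shift_none ?addr0// => k' p' s'.
have ho : odd_at p h.
  exists (2 ^+ (p - k.+1).-1).
  rewrite -exprSr prednK ?subn_gt0// intrD rmorphXn /= /h mulrDl mulVf ?expf_neq0//.
  have -> : (2 : rat) ^+ p = 2 ^+ k.+1 * 2 ^+ (p - k.+1) by rewrite -exprD subnKC// ltnW.
  by rewrite mulrA mulVf ?expf_neq0// mul1r.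
have pp' := odd_at_uniq ho (special_odd s').
have sp : special k p (2 ^- p) by split; rewrite // subrr mul0r.
have kk' : k' = k.
  move: s'; rewrite -pp' => -[/andP[h1' h2'] _]; move: ckp => /andP[h1 h2].
  apply/eqP; rewrite eqn_leq; apply/andP; split; rewrite leqNgt; apply/negP => /c_le kk'.
    by move: (leq_trans kk' h1'); rewrite leqNgt h2.
  by move: (leq_trans kk' h1); rewrite leqNgt h2'.
(* The integrality demanded by [special] would concern 2^-(k+1) times 2^k, which is 1/2. *)
by move: s' => [_]; rewrite -pp' kk' /h addrK exprS invfM -mulrA mulVf ?expf_neq0.
Qed.

Lemma marker_patch k p : (c k <= p < c k.+1)%N -> special_patch k p (marker k p).
Proof.
move=> ckp; split; first by apply/translateE; exact: marker_omega.
rewrite /marker Q2_of_ratB; apply: BzB; last exact: Bz_nat.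
apply/(@Bz_dyadic k.+1%:Z); first exact: dyadic_expNn.
by rewrite -exprnP mulVf ?expf_neq0.
Qed.

(** Equal patches would put both markers, seen from the centre of [p], into [omega]. They differ by
    the integer p - p', hence lie in one coset of Z_2, which contains a single point of [omega]. *)
Lemma special_patch_inj k p p' : (c k <= p < c k.+1)%N -> (c k <= p' < c k.+1)%N ->
  special_patch k p = special_patch k p' -> p = p'.
Proof.
move=> ckp ckp' E; have := marker_patch ckp'; rewrite -E => -[/translateE wp' _].
have wp := marker_omega ckp.
have D : marker k p' + special_center p - (marker k p + special_center p) = Q2_of_rat (p%:R - p'%:R).
  rewrite /marker -!Q2_of_ratD -Q2_of_ratB; congr Q2_of_rat.
  by move: (2 ^- k.+1) (2 ^- p) (p%:R) (p'%:R) => a b d e; ring.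
have /(omega_uniq wp' wp)/eqP : Bz 0 (marker k p' + special_center p - (marker k p + special_center p)).
  by rewrite D Q2_of_ratB; apply: BzB; exact: Bz_nat.
rewrite -subr_eq0 D => /eqP; rewrite -Q2_of_rat0 => /Q2_of_rat_inj/eqP.
by rewrite subr_eq0 eqr_nat => /eqP.
Qed.

Lemma card_patches_ge k : (c k.+1 - c k <= #|` fset_set (patches omega (Bz k.+1))|)%N.
Proof.
have [fin _] := card_patches omega_ex omega_uniq (@omega_blocks k.+1).
rewrite -(size_iota (c k) (c k.+1 - c k)) -(size_map (special_patch k)).
have mi p : p \in iota (c k) (c k.+1 - c k) -> (c k <= p < c k.+1)%N.
  by rewrite mem_iota subnKC.
apply: uniq_leq_size.
  rewrite map_inj_in_uniq ?iota_uniq// => p p' /mi h /mi h'; exact: special_patch_inj.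
move=> _ /mapP[p /mi ckp ->]; rewrite in_fset_set//; apply/mem_set.
by exists (special_center p) => //; exact: special_center_omega ckp.
Qed.

Lemma card_patches_le (j : nat) : (#|` fset_set (patches omega (Bz j))| <= 2 ^ j * (c j).+1)%N.
Proof.
have [_] := card_patches omega_ex omega_uniq (@omega_blocks j).
by rewrite size_map size_iota.
Qed.

End construction.

(** * Prescribed upper and lower entropy *)

Section extended_limits.
Variable R : realType.
Implicit Types (u : (\bar R)^nat) (a x y : \bar R).

Lemma limn_esup_le u a : (exists N, forall n, (N <= n)%N -> (u n <= a)%E) -> (limn_esup u <= a)%E.
Proof.
move=> [N uN]; rewrite /limn_esup limf_esupE; apply: ge_ereal_inf.
exists (ereal_sup (u @` [set n | (N <= n)%N])); first by exists [set n | (N <= n)%N] => //; exists N.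
by apply: ge_ereal_sup => _ [n /uN un <-].
Qed.

Lemma limn_esup_ge u a : (forall N, exists2 n, (N <= n)%N & (a <= u n)%E) -> (a <= limn_esup u)%E.
Proof.
move=> ua; rewrite /limn_esup limf_esupE; apply: le_ereal_inf_tmp => _ [A [N _ NA] <-].
by have [n Nn an] := ua N; apply: le_ereal_sup_tmp; exists (u n) => //; exists n => //; exact: NA.
Qed.

Lemma limn_einf_ge u a : (exists N, forall n, (N <= n)%N -> (a <= u n)%E) -> (a <= limn_einf u)%E.
Proof.
move=> [N uN]; rewrite /limn_einf leeNr; apply: limn_esup_le; exists N => n /uN.
by rewrite leeN2.
Qed.

Lemma limn_einf_le u a : (forall N, exists2 n, (N <= n)%N & (u n <= a)%E) -> (limn_einf u <= a)%E.
Proof.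
move=> ua; rewrite /limn_einf leeNl; apply: limn_esup_ge => N.
by have [n Nn un] := ua N; exists n => //; rewrite leeN2.
Qed.

(** Treats finite and infinite [x] together, matching the truncation of [target i] at [i]. *)
Lemma le_of_min_nat x y : (0 <= x)%E -> (forall M : nat, (Order.min x M%:R%:E <= y)%E) -> (x <= y)%E.
Proof.
case: x => [x| |]// x0 xy; last first.
  rewrite leye_eq; apply/eqP/eq_infty => t.
  apply: le_trans (xy (Num.truncn t).+1); rewrite le_min leey lee_fin.
  exact/ltW/truncnS_gt.
have := xy (Num.truncn x).+1; rewrite min_l// lee_fin; exact/ltW/truncnS_gt.
Qed.

End extended_limits.

Section levels.
Variables (R : realType) (r s : \bar R).
Hypothesis s_ge0 : (0 <= s)%E.
Hypothesis s_le_r : (s <= r)%E.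

(* [rate j = max_(i <= j) target i / 2 ^ (j - i)] approaches [r] at the powers of two, and
   decays to [s] between them. *)
Definition target (i : nat) : R :=
  fine (Order.min (if 2 ^ trunc_log 2 i == i then r else s)%N i%:R%:E).

(** Halving is the fastest admissible descent: it keeps 2^j times the rate nondecreasing, which the
    doubling condition on [c] requires. *)
Fixpoint rate (j : nat) : R :=
  if j is k.+1 then Num.max (target k.+1) (rate k / 2) else target 0.

Lemma rateS k : rate k.+1 = Num.max (target k.+1) (rate k / 2).
Proof. by []. Qed.

Lemma targetE i :
  (target i)%:E = Order.min (if 2 ^ trunc_log 2 i == i then r else s)%N i%:R%:E.
Proof.
rewrite /target fineK// ge0_fin_numE.
  by rewrite gt_min ltry orbT.
by rewrite le_min lee_fin ler0n andbT; case: ifP => // _; exact: le_trans s_le_r.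
Qed.

Lemma target_ge0 i : 0 <= target i.
Proof.
rewrite -lee_fin targetE le_min lee_fin ler0n andbT; case: ifP => // _.
exact: le_trans s_le_r.
Qed.

Lemma target_le_nat i : target i <= i%:R.
Proof. by rewrite -lee_fin targetE ge_min lexx orbT. Qed.

Lemma target_le_r i : ((target i)%:E <= r)%E.
Proof. by rewrite targetE ge_min; case: ifP; rewrite ?lexx ?s_le_r. Qed.

Lemma target_ge_s i : (Order.min s i%:R%:E <= (target i)%:E)%E.
Proof.
rewrite targetE le_min ge_min [X in _ && X]ge_min lexx orbT andbT.
by case: ifP; rewrite ?lexx ?s_le_r.
Qed.

Lemma rate_ge_target j : target j <= rate j.
Proof. by case: j => [|j] /=; rewrite ?lexx// le_max lexx. Qed.

Lemma rate_ge0 j : 0 <= rate j.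
Proof. exact: le_trans (target_ge0 j) (rate_ge_target j). Qed.

Lemma rate_half j : rate j / 2 <= rate j.+1.
Proof. by rewrite rateS le_max lexx orbT. Qed.

Lemma rate_le_nat j : rate j <= j%:R.
Proof.
elim: j => [|j IH]/=; rewrite ?ge_max target_le_nat//=.
have := rate_ge0 j; rewrite -(natr1 j); lra.
Qed.

Lemma rate_le_r j : ((rate j)%:E <= r)%E.
Proof.
elim: j => [|j IH]; first exact: target_le_r.
rewrite rateS EFin_max ge_max target_le_r; apply: le_trans IH; rewrite lee_fin.
have := rate_ge0 j; lra.
Qed.

Lemma rate_pow2 m : (Order.min r (2 ^ m)%:R%:E <= (rate (2 ^ m))%:E)%E.
Proof.
apply: (@le_trans _ _ (target (2 ^ m))%:E); last by rewrite lee_fin rate_ge_target.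
by rewrite targetE trunc_expnK// eqxx.
Qed.

(** At 2^m the rate is at most 2^m by [rate_le_nat]. No power of two follows before 2^(m+1), so
    every step halves the bound until the target [s] takes over. *)
Lemma rate_decay s0 m n : s = s0%:E -> (n < 2 ^ m)%N ->
  rate (2 ^ m + n) <= Num.max s0 (2 ^+ m / 2 ^+ n).
Proof.
move=> sE; elim: n => [|n IH] nm.
  by rewrite addn0 expr0 divr1 le_max -natrX rate_le_nat orbT.
rewrite addnS rateS ge_max; apply/andP; split.
  rewrite le_max -lee_fin targetE -addnS (@trunc_log_eq _ m)//.
    rewrite -[X in X == _]addn0 eqn_add2l -sE.
    by rewrite /= ge_min lexx.
  by rewrite leq_addr expnS mul2n -addnn ltn_add2l.
have s00 : 0 <= s0 by rewrite -lee_fin -sE.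
have -> : 2 ^+ m / 2 ^+ n.+1 = 2 ^+ m / 2 ^+ n / 2 :> R by rewrite exprSr invfM mulrA.
have := IH (ltnW nm).
move: (2 ^+ m / _) (rate _) => a b; rewrite !le_max => /orP[]h; apply/orP; [left|right]; lra.
Qed.

Section density.
Variables (z : nat -> R) (C : R).
Hypothesis z_ge : forall n, (1 < n)%N -> rate (trunc_log 2 n) <= z n.
Hypothesis z_le : forall n, (1 < n)%N ->
  z n <= rate (trunc_log 2 n) + C / (trunc_log 2 n).+1%:R.

Lemma error_small e : 0 < e -> exists N, forall n, (2 ^ N <= n)%N -> C / (trunc_log 2 n).+1%:R <= e.
Proof.
move=> e0; exists (Num.truncn (C / e)).+1 => n nN.
rewrite ler_pdivrMr ?ltr0n// mulrC -ler_pdivrMr// (le_trans (ltW (truncnS_gt _)))//.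
by rewrite ler_nat (leq_trans (trunc_log_max _ nN)).
Qed.

Lemma gt1_exp N n : (2 ^ N.+1 <= n)%N -> (1 < n)%N.
Proof. by apply: leq_trans; rewrite -{1}(expn0 2) ltn_exp2l. Qed.

Lemma limn_esup_rate : limn_esup (fun n => (z n)%:E) = r.
Proof.
apply/eqP; rewrite eq_le; apply/andP; split.
  apply/lee_addgt0Pr => e e0; have [N NC] := error_small e0.
  apply: limn_esup_le; exists (2 ^ N.+1)%N => n nN.
  apply: (@le_trans _ _ ((rate (trunc_log 2 n))%:E + e%:E)%E).
    rewrite -EFinD lee_fin (le_trans (z_le (gt1_exp nN)))// lerD2l NC//.
    by rewrite (leq_trans _ nN)// leq_exp2l.
  by apply: leeD2r; exact: rate_le_r.
apply: le_of_min_nat => [|M]; first exact: le_trans s_le_r.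
apply: limn_esup_ge => N.
(* The level of the ball of radius 2^(2^m) is the power of two 2^m, where the target is [r]
   truncated at 2^m. *)
pose m := (maxn M N).+1; exists (2 ^ (2 ^ m))%N.
  apply: (@leq_trans m); first by rewrite leqW// leq_maxr.
  exact: leq_trans (ltnW (ltn_expl m (ltnSn 1))) (ltnW (ltn_expl (2 ^ m) (ltnSn 1))).
apply: (@le_trans _ _ (rate (2 ^ m))%:E).
  apply: le_trans (rate_pow2 m); rewrite le_min ge_min lexx/= ge_min lee_fin ler_nat.
  by rewrite (leq_trans _ (ltnW (ltn_expl m (ltnSn 1)))) ?orbT// leqW// leq_maxl.
rewrite lee_fin -{1}(@trunc_expnK 2 (2 ^ m))//; apply: z_ge.
by rewrite -{1}(expn0 2) ltn_exp2l// expn_gt0.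
Qed.

Lemma limn_einf_rate : limn_einf (fun n => (z n)%:E) = s.
Proof.
apply/eqP; rewrite eq_le; apply/andP; split; last first.
  apply: le_of_min_nat => // M; apply: limn_einf_ge.
  exists (2 ^ M.+1)%N => n nM.
  apply: (@le_trans _ _ (rate (trunc_log 2 n))%:E); last by rewrite lee_fin (z_ge (gt1_exp nM)).
  apply: (@le_trans _ _ (target (trunc_log 2 n))%:E); last by rewrite lee_fin rate_ge_target.
  apply: le_trans (target_ge_s _); rewrite le_min ge_min lexx/= ge_min lee_fin ler_nat.
  by rewrite (leq_trans _ (trunc_log_max _ nM)) ?orbT.
have [->|] := eqVneq s +oo%E; first by rewrite leey.
case Es : s s_ge0 => [s0| |]// s00 _.
apply/lee_addgt0Pr => e e0; have [N NC] := @error_small (e / 2) ltac:(lra).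
have [K eK] : exists K : nat, 2 ^- K <= e / 2.
  exists (Num.truncn (e / 2)^-1).+1; rewrite -[leRHS]invrK lef_pV2 ?posrE ?exprn_gt0 ?invr_gt0//; last lra.
  rewrite (le_trans (ltW (truncnS_gt _)))// -natrX ler_nat.
  exact/ltnW/ltn_expl.
apply: limn_einf_le => N'.
have [m [m3 mK mN mN']] : exists m, [/\ 3 <= m, K <= m, N <= m & N' <= m]%N.
  by exists (maxn (maxn 3 K) (maxn N N')); rewrite !leq_max !leqnn !orbT.
(* After 2m halvings the bound 2^m has become 2^-m, and 2m < 2^m, valid as m >= 3, keeps the level
   before the next peak. *)
pose j := (2 ^ m + 2 * m)%N; exists (2 ^ j)%N.
  apply: (@leq_trans j); last exact/ltnW/ltn_expl.
  by rewrite /j; move: (2 ^ m)%N => q; lia.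
have mj : (m < j)%N by rewrite /j (leq_trans (ltn_expl m (ltnSn 1)))// leq_addr.
rewrite -EFinD lee_fin; apply: (le_trans (z_le _)).
  by rewrite -{1}(expn0 2) ltn_exp2l//; lia.
have m2 : (2 * m < 2 ^ m)%N.
  elim: (m) m3 => [//|k IH]; rewrite leq_eqVlt => /orP[/eqP <-//|k3].
  by have := IH k3; rewrite expnS; move: (2 ^ k)%N => q; lia.
have h1 : C / (trunc_log 2 (2 ^ j)).+1%:R <= e / 2.
  by apply: NC; rewrite leq_exp2l//; lia.
rewrite trunc_expnK// in h1 *.
have h2 : rate j <= s0 + e / 2.
  apply: (le_trans (rate_decay Es m2)); rewrite ge_max lerDl; apply/andP; split; first lra.
  rewrite mul2n -addnn exprD invfM mulrA divff ?expf_neq0// mul1r.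
  have : 2 ^- m <= 2 ^- K :> R.
    by rewrite lef_pV2 ?posrE ?exprn_gt0// ler_eXn2l ?ltr1n.
  have : 0 <= s0 by rewrite -lee_fin.
  lra.
by rewrite (le_trans (lerD h2 h1))// -addrA -splitr.
Qed.

End density.
End levels.

(** Modulo Z_2 the point [x] is a rational, whose absolute value is 0 or an integer power of two.
    Hence patch counts change only when [n] passes a power of two. *)
Lemma ballQ2_Bz n : (0 < n)%N -> ballQ2 n = Bz (trunc_log 2 n).
Proof.
move=> n0; apply/seteqP; split => x /=; rewrite /ballQ2 /Bz /= => xn; last first.
  by rewrite (le_trans xn)// -exprnP -natrX ler_nat trunc_logP.
have [d _ xd] := Q2_dyadic_dense 0 x; rewrite /Bz /= expr0z in xd.
have dn : abs2 d <= n%:R.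
  rewrite -absQ2_of_rat -[Q2_of_rat d](subKr x) (le_trans (absQ2D_max _ _))//.
  by rewrite ge_max xn absQ2N (le_trans xd)// ler1n.
rewrite -[x](subrK (Q2_of_rat d)) (le_trans (absQ2D_max _ _))// ge_max absQ2_of_rat.
apply/andP; split; first by rewrite (le_trans xd)// -exprnP exprn_ege1.
move: dn; rewrite /abs2; case: eqVneq => [_ _|_]; first by rewrite exprz_ge0.
move: (_ - _ : int) => z; rewrite ler_eXz2l//; case: z => [z|z] // zn.
by rewrite lez_nat; apply: trunc_log_max => //; rewrite -(@ler_nat rat) natrX.
Qed.

Section entropy.
Variables (R : realType) (theta : {measure set (borel Q2) -> \bar R}) (r s : \bar R).
Hypothesis htheta : haar theta.
Hypothesis s_ge0 : (0 <= s)%E.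
Hypothesis s_le_r : (s <= r)%E.

Definition log_count (j : nat) : R := unit_vol theta * 2 ^+ j * rate r s j.

(** Essentially exp(log_count j). The factor 2^(j+1) provides both [thresholds_gt] and the doubling,
    and it adds only O(j) to the logarithm. *)
Definition thresholds (j : nat) : nat := (2 ^ j.+1 * (Num.truncn (expR (log_count j))).+1)%N.

Lemma log_count_ge0 j : 0 <= log_count j.
Proof. by rewrite !mulr_ge0 ?rate_ge0// ltW// unit_vol_gt0. Qed.

Lemma log_count_nd j : log_count j <= log_count j.+1.
Proof.
rewrite /log_count exprSr -!mulrA ler_pM2l ?unit_vol_gt0// ler_pM2l ?exprn_gt0//.
by have := rate_half r s j; lra.
Qed.

Lemma thresholds_gt k : (k.+1 < thresholds k)%N.
Proof. by rewrite /thresholds mulnS (leq_trans (ltn_expl k.+1 (ltnSn 1)))// leq_addr. Qed.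

Lemma thresholds_double k : (2 * thresholds k <= thresholds k.+1)%N.
Proof.
by rewrite /thresholds mulnA -expnS leq_mul2l ltnS le_truncn ?orbT// ler_expR log_count_nd.
Qed.

Lemma thresholds_nd k : (thresholds k <= thresholds k.+1)%N.
Proof. by apply: leq_trans (thresholds_double k); rewrite leq_pmull. Qed.

Let w := omega thresholds.
Let count (j : nat) := #|` fset_set (patches w (Bz j))|.

(** By doubling, the difference of consecutive thresholds is at least half of the larger one, which
    still exceeds exp(log_count k.+1). *)
Lemma count_ge k : expR (log_count k.+1) <= (count k.+1)%:R.
Proof.
apply: (@le_trans _ _ (thresholds k.+1 - thresholds k)%N%:R).
  apply: (le_trans (ltW (truncnS_gt _))); rewrite ler_nat.
  have E : thresholds k.+1 = (2 * (2 ^ k.+1 * (Num.truncn (expR (log_count k.+1))).+1))%N.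
    by rewrite /thresholds expnS mulnA.
  have := thresholds_double k; rewrite E leq_pmul2l//.
  have := @leq_pmull (Num.truncn (expR (log_count k.+1))).+1 (2 ^ k.+1) (expn_gt0 2 k.+1).
  by move: (Num.truncn _) (thresholds k) (2 ^ _ * _)%N => v t q; clear; lia.
by rewrite ler_nat; apply: card_patches_ge; [exact: thresholds_gt|exact: thresholds_nd].
Qed.

(** The exponent collects j from the points per coset, j + 1 from the thresholds, and 2 for
    absorbing the two increments by one. *)
Lemma count_le j : (count j)%:R <= 2 ^+ (2 * j + 3) * expR (log_count j) :> R.
Proof.
have e1 : 1 <= expR (log_count j) by rewrite -[leLHS]expR0 ler_expR log_count_ge0.
apply: (@le_trans _ _ (2 ^ j * (thresholds j).+1)%N%:R).
  by rewrite ler_nat; apply: card_patches_le; exact: thresholds_nd.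
have tr : (Num.truncn (expR (log_count j)))%:R <= expR (log_count j).
  by have /andP[] := truncn_itv (expR_ge0 (log_count j)).
have : (thresholds j).+1%:R <= 2 ^+ (j + 3) * expR (log_count j).
  have -> : (j + 3 = j.+1 + 2)%N by lia.
  rewrite exprD -(natr1 (thresholds j)) natrM natrX -(natr1 (Num.truncn _)).
  have : 1 <= 2 ^+ j.+1 :> R by rewrite exprn_ege1// ler1n.
  move: tr e1; move: (expR _) => e; move: (Num.truncn _)%:R (2 ^+ _) => a b; nra.
move=> h; rewrite natrM natrX mul2n -addnn -addnA exprD -mulrA.
by rewrite ler_pM2l ?exprn_gt0.
Qed.

(** Turns the error (2j + 3) ln 2 / (t0 2^j) of the density, left by [count_le], into a constant
    over j + 1. *)
Lemma polynomial_le_expn j : ((2 * j + 3) * j.+1 <= 12 * 2 ^ j)%N.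
Proof.
case: j => [|j]//; elim: j => [|j IH]//; case: j IH => [|j IH]//.
rewrite expnS; move: IH; move: (2 ^ _)%N => q; nia.
Qed.

Lemma log_patch_densityE n : (0 < n)%N ->
  log_patch_density theta w n =
  (ln (count (trunc_log 2 n))%:R / (unit_vol theta * 2 ^+ trunc_log 2 n))%:E.
Proof. by move=> n0; rewrite /log_patch_density ballQ2_Bz// haar_Bz. Qed.

Let entropy_error : R := 12 * ln 2 / unit_vol theta.

Lemma log_patch_density_ge n : (1 < n)%N ->
  rate r s (trunc_log 2 n) <= fine (log_patch_density theta w n).
Proof.
move=> n1; rewrite log_patch_densityE ?(ltnW n1)//; have : (0 < trunc_log 2 n)%N by rewrite trunc_log_gt0.
case: (trunc_log 2 n) => // j _; have := unit_vol_gt0 htheta => t0.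
rewrite ler_pdivlMr ?(mulr_gt0 t0) ?exprn_gt0// mulrC -/(log_count j.+1) -[leLHS]expRK.
by rewrite ler_ln ?posrE ?expR_gt0 ?(lt_le_trans (expR_gt0 _) (count_ge j)) ?count_ge.
Qed.

Lemma log_patch_density_le n : (1 < n)%N ->
  fine (log_patch_density theta w n) <=
  rate r s (trunc_log 2 n) + entropy_error / (trunc_log 2 n).+1%:R.
Proof.
move=> n1; rewrite log_patch_densityE ?(ltnW n1)//; have : (0 < trunc_log 2 n)%N by rewrite trunc_log_gt0.
case: (trunc_log 2 n) => // j _; have := unit_vol_gt0 htheta => t0.
have p0 : 0 < 2 ^+ j.+1 :> R by rewrite exprn_gt0.
have c0 := lt_le_trans (expR_gt0 _) (count_ge j).
have : ln (count j.+1)%:R <= (2 * j.+1 + 3)%:R * ln 2 + log_count j.+1.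
  rewrite -[X in _ + X]expRK mulr_natl -lnXn// -lnM ?posrE ?expR_gt0 ?exprn_gt0//.
  by rewrite ler_ln ?posrE ?count_le// (mulr_gt0 _ (expR_gt0 _)) ?exprn_gt0.
have l2 : 0 < ln (2 : R) by rewrite ln_gt0// ltr1n.
have : (2 * j.+1 + 3)%:R * j.+2%:R <= 12 * 2 ^+ j.+1 :> R.
  by rewrite -natrX -!natrM ler_nat polynomial_le_expn.
rewrite ler_pdivrMr ?(mulr_gt0 t0)// /log_count /entropy_error.
have j0 : 0 < j.+2%:R :> R by rewrite ltr0n.
move: (2 * j.+1 + 3)%:R j.+2%:R (2 ^+ _) (ln 2) (rate _ _ _) (unit_vol _) (ln (count _)%:R) t0 p0 l2 j0.
move=> a b p l v t x t0 p0 l0 b0 abp xa.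
have -> : (v + 12 * l / t / b) * (t * p) = t * p * v + 12 * p / b * l.
  by field; rewrite !gt_eqF.
apply: (le_trans xa); rewrite addrC lerD2l ler_pM2r//.
by rewrite ler_pdivlMr.
Qed.

Lemma limn_esup_entropy : limn_esup (log_patch_density theta w) = r.
Proof. exact: (limn_esup_rate s_ge0 s_le_r log_patch_density_ge log_patch_density_le). Qed.

Lemma limn_einf_entropy : limn_einf (log_patch_density theta w) = s.
Proof. exact: (limn_einf_rate s_ge0 s_le_r log_patch_density_ge log_patch_density_le). Qed.

End entropy.

Theorem theorem4p4 (R : realType) (theta : {measure set (borel Q2) -> \bar R})
    (htheta : haar theta) (r s : \bar R) (hs : (0 <= s)%E) (hsr : (s <= r)%E) :
  exists w : set Q2,
    [/\ delone w /\ flc w,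
        w `<=` Q2_of_rat @` dyadic,
        upf theta w /\ pure_point_diffractive theta w,
        limn_esup (log_patch_density theta w) = r
      & limn_einf (log_patch_density theta w) = s].
Proof.
pose c := thresholds theta r s.
have c_nd : forall k, (c k <= c k.+1)%N := thresholds_nd r s htheta.
have ex := omega_ex c; have uniq := @omega_uniq c.
have blocks j : exists bad, all_blocks_but (omega c) j bad.
  by exists (bad_centers c j); exact: omega_blocks.
exists (omega c); split.
- by split; [exact: w_delone|exact: w_flc].
- exact: omega_dyadic.
- by split; [exact: w_upf|exact: w_pure_point_diffractive].
- exact: limn_esup_entropy.
- exact: limn_einf_entropy.
Qed.
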